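(* Let $1\le\theta\le r$ be integers. Assume: (A1) there are positive numbers $\mu_{\min},\mu_{\max},\lambda_{\max}$ such that $0<\mu_{\min}\le\mu(\mathbf{x},\mathbf{y})\le\mu_{\max}$ and $0\le\lambda(\mathbf{x},\mathbf{z})\le\lambda_{\max}$ for all $\mathbf{x}\in\Omega$, $\mathbf{y},\mathbf{z}\in U$; (A5) $\mu_0,\lambda_0\in W^{\theta,\infty}(\Omega)$ and $\sum_j\|\psi_j\|_{W^{\theta,\infty}(\Omega)}$, $\sum_j\|\phi_j\|_{W^{\theta,\infty}(\Omega)}$ are finite. For $\mathbf{y},\mathbf{z}\in U$ let $\mathbf{u}$ and $\mathbf{u}_h$ be the solutions of the parametric elasticity problem and of its Galerkin finite element discretization of degree at most $r$, respectively. Assume that the elasticity problem has the following regularity property: for every right-hand side $\mathbf{f}\in\mathbf{H}^{\theta-1}(\Omega)$ and every $\mathbf{y},\mathbf{z}\in U$, the solution satisfies $\mathbf{u}(\cdot,\mathbf{y},\mathbf{z})\in\mathbf{H}^{\theta+1}(\Omega)$ and $\|\mathbf{u}(\cdot,\mathbf{y},\mathbf{z})\|_{\mathbf{H}^{\theta+1}}\le\widetilde C\|\mathbf{f}\|_{\mathbf{H}^{\theta-1}}$, with $\widetilde C$ independent of $\mathbf{f},\mathbf{y},\mathbf{z}$. Then, when $\mathbf{f}\in\mathbf{H}^{\theta-1}(\Omega)$, $$\|\mathbf{u}(\cdot,\mathbf{y},\mathbf{z})-\mathbf{u}_h(\cdot,\mathbf{y},\mathbf{z})\|_{\mathbf{V}}\le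 C\,h^\theta\|\mathbf{f}\|_{\mathbf{H}^{\theta-1}}\quad\text{for every }\mathbf{y},\mathbf{z}\in U.$$ Moreover, if $\mathcal{L}:\mathbf{L}^2(\Omega)\to\mathbb{R}$ is a bounded linear functional (that is, $|\mathcal{L}(\mathbf{w})|\le\|\mathcal{L}\|\,\|\mathbf{w}\|$), then $$|\mathcal{L}(\mathbf{u}(\cdot,\mathbf{y},\mathbf{z}))-\mathcal{L}(\mathbf{u}_h(\cdot,\mathbf{y},\mathbf{z}))|\le C\,h^{\theta+1}\|\mathbf{f}\|_{\mathbf{H}^{\theta-1}}\|\mathcal{L}\|\quad\text{for every }\mathbf{y},\mathbf{z}\in U.$$ The constant $C$ depends on $\Omega$, $\mu_{\max}$, $\mu_{\min}$, $\lambda_{\max}$ (and on $\widetilde C$ and the finite element approximation constant), but not on $h$.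
   Context: $d\in\{2,3\}$ and $\Omega\subset\mathbb{R}^d$ is a bounded domain (with polyhedral boundary, or with boundary smooth enough for the assumed regularity property). $\mathbf{V}=[H^1_0(\Omega)]^d$ with norm $\|\mathbf{w}\|_{\mathbf{V}}=(\sum_{i=1}^d\|w_i\|_{H^1(\Omega)}^2)^{1/2}$; $\mathbf{H}^J(\Omega)=[H^J(\Omega)]^d$ with the analogous norm $\|\cdot\|_{\mathbf{H}^J}$; $\mathbf{H}^0(\Omega)=\mathbf{L}^2(\Omega)=[L^2(\Omega)]^d$ with norm $\|\cdot\|$. $U=(-\frac12,\frac12)^{\mathbb{N}}$; for $\mathbf{y}=(y_j)_{j\ge1},\mathbf{z}=(z_j)_{j\ge1}\in U$, $\mu(\mathbf{x},\mathbf{y})=\mu_0(\mathbf{x})+\sum_{j\ge1}y_j\psi_j(\mathbf{x})$ and $\lambda(\mathbf{x},\mathbf{z})=\lambda_0(\mathbf{x})+\sum_{j\ge1}z_j\phi_j(\mathbf{x})$, where $\{\psi_j\}$, $\{\phi_j\}$ are orthogonal basis functions for $L^2(\Omega)$. With $\boldsymbol{\varepsilon}(\mathbf{v})=\frac12(\nabla\mathbf{v}+(\nabla\mathbf{v})^T)$ let $$\mathcal{B}(\mathbf{y},\mathbf{z};\mathbf{u},\mathbf{v})=\int_\Omega[2\mu(\mathbf{x},\mathbf{y})\,\boldsymbol{\varepsilon}(\mathbf{u}):\boldsymbol{\varepsilon}(\mathbf{v})+\lambda(\mathbf{x},\mathbf{z})\,\nabla\cdot\mathbf{u}\,\nabla\cdot\mathbf{v}]\,d\mathbf{x},\qquad\ell(\mathbf{v})=\int_\Omega\mathbf{f}\cdot\mathbf{v}\,d\mathbf{x}.$$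 The parametric elasticity problem is $-\nabla\cdot(\lambda(\nabla\cdot\mathbf{u})I+2\mu\,\boldsymbol{\varepsilon}(\mathbf{u}))=\mathbf{f}$ in $\Omega$, $\mathbf{u}=0$ on $\partial\Omega$; its solution $\mathbf{u}(\cdot,\mathbf{y},\mathbf{z})\in\mathbf{V}$ satisfies $\mathcal{B}(\mathbf{y},\mathbf{z};\mathbf{u},\mathbf{v})=\ell(\mathbf{v})$ for all $\mathbf{v}\in\mathbf{V}$. $\mathcal{T}_h$ is a regular family of triangulations of $\overline\Omega$ by simplexes with maximal element diameter $h$; $V_h\subset H^1_0(\Omega)$ is the conforming space of continuous piecewise polynomials of degree at most $r$ ($r\ge1$) on $\mathcal{T}_h$ vanishing on $\partial\Omega$; $\mathbf{V}_h=[V_h]^d$, and there is a constant $C$ depending on $\Omega$ with $\inf_{\mathbf{v}_h\in\mathbf{V}_h}\|\mathbf{v}-\mathbf{v}_h\|_{\mathbf{V}}\le Ch^{\theta}\|\mathbf{v}\|_{\mathbf{H}^{\theta+1}}$ for all $\mathbf{v}\in\mathbf{V}\cap\mathbf{H}^{\theta+1}(\Omega)$ and all integers $1\le\theta\le r$. $\mathbf{u}_h(\cdot,\mathbf{y},\mathbf{z})\in\mathbf{V}_h$ is the unique solution of $\mathcal{B}(\mathbf{y},\mathbf{z};\mathbf{u}_h,\mathbf{v}_h)=\ell(\mathbf{v}_h)$ for all $\mathbf{v}_h\in\mathbf{V}_h$. *)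

(* Defs.v *)
From HB Require Import structures.
From mathcomp Require Import all_boot all_order all_algebra.
From mathcomp Require Import all_classical all_reals all_analysis.

Set Implicit Arguments.
Unset Strict Implicit.
Unset Printing Implicit Defensive.

Import Order.TTheory GRing.Theory Num.Theory.
Import numFieldNormedType.Exports.

Local Open Scope classical_set_scope.
Local Open Scope ring_scope.

(* Lebesgue measure on 'rV[R]_n, built by iterated products with
   lebesgue_measure; measurable sets are generated by the coordinates. *)

Definition rV_display : measure_display.
Proof. exact: default_measure_display. Qed.

Section measurable_rV.
Context {R : realType} {n : nat}.

Definition rV_coord (i : 'I_n) (x : 'rV[R]_n) : measurableTypeR R := x ord0 i.

Let rV_set0 : g_sigma_preimage rV_coord set0.
Proof. exact: sigma_algebra0. Qed.

Let rV_setC A : g_sigma_preimage rV_coord A -> g_sigma_preimage rV_coord (~` A).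
Proof. exact: sigma_algebraC. Qed.

Let rV_bigcup (F : (set 'rV[R]_n)^nat) :
  (forall i, g_sigma_preimage rV_coord (F i)) ->
  g_sigma_preimage rV_coord (\bigcup_i (F i)).
Proof. exact: sigma_algebra_bigcup. Qed.

HB.instance Definition _ := @isMeasurable.Build rV_display
  'rV[R]_n (g_sigma_preimage rV_coord) rV_set0 rV_setC rV_bigcup.

Lemma measurable_rV_coord i : measurable_fun [set: 'rV[R]_n] (rV_coord i).
Proof.
move=> _ Y mY; rewrite setTI; apply: sub_sigma_algebra => /=.
rewrite -bigcup_seq/=; exists i => /=; first by rewrite mem_index_enum.
by exists Y => //; rewrite setTI.
Qed.

Lemma measurable_fun_rV d (T : measurableType d) (f : T -> 'rV[R]_n) :
  (forall i, measurable_fun [set: T] (rV_coord i \o f)) ->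
  measurable_fun [set: T] f.
Proof.
move=> mf; suff h : g_sigma_preimage (fun i => rV_coord i \o f) `<=` measurable.
  move=> _ A mA; rewrite setTI; apply: h.
  by rewrite g_sigma_preimage_comp; exists A => //; rewrite setTI.
apply: smallest_sub; first exact: sigma_algebra_measurable.
rewrite -bigcup_seq; apply: bigcup_sub => i _ A [B mB <-]; exact: mf.
Qed.

End measurable_rV.

Section lebesgue_rV.
Context {R : realType}.

Definition rV_cons n (p : measurableTypeR R * 'rV[R]_n) : 'rV[R]_n.+1 :=
  \row_i if unlift ord0 i is Some j then p.2 ord0 j else p.1.

Definition rV_uncons n (x : 'rV[R]_n.+1) : measurableTypeR R * 'rV[R]_n :=
  (x ord0 ord0, \row_j x ord0 (lift ord0 j)).

Lemma rV_consK n : cancel (@rV_cons n) (@rV_uncons n).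
Proof.
move=> [a x]; rewrite /rV_uncons /rV_cons !mxE unlift_none; congr pair.
by apply/rowP => j; rewrite !mxE liftK.
Qed.

Lemma measurable_rV_cons n : measurable_fun setT (@rV_cons n).
Proof.
apply: measurable_fun_rV => i.
case: (unliftP ord0 i) => [j|] ->.
  rewrite (_ : _ \o _ = rV_coord j \o snd); last first.
    by apply/funext => p; rewrite /rV_coord /= mxE liftK.
  by apply: measurableT_comp => //; exact: measurable_rV_coord.
rewrite (_ : _ \o _ = fst) //.
by apply/funext => p; rewrite /rV_coord /= mxE unlift_none.
Qed.

Lemma measurable_rV_uncons n : measurable_fun setT (@rV_uncons n).
Proof.
apply/measurable_fun_pairP; split; first exact: measurable_rV_coord.
apply: measurable_fun_rV => j.
rewrite (_ : _ \o _ = rV_coord (lift ord0 j)); first exact: measurable_rV_coord.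
by apply/funext => x; rewrite /rV_coord /= mxE.
Qed.

Section step.
Variables (n : nat) (m : {sigma_finite_measure set 'rV[R]_n -> \bar R}).

Definition lebesgue_rV_step :=
  pushforward (@lebesgue_measure R \x m)%E (@rV_cons n).

Let step0 : lebesgue_rV_step set0 = 0%E.
Proof. by rewrite /lebesgue_rV_step /pushforward preimage_set0 measure0. Qed.

Let step_ge0 A : (0 <= lebesgue_rV_step A)%E.
Proof. by rewrite /lebesgue_rV_step /pushforward measure_ge0. Qed.

Let step_sigma_additive : semi_sigma_additive lebesgue_rV_step.
Proof.
exact: (@measure_semi_sigma_additive _ _ _
  (measure_function_pushforward__canonical__measure_function_Measure
     (@lebesgue_measure R \x m)%E (@measurable_rV_cons n))).
Qed.

HB.instance Definition _ := isMeasure.Build _ _ _ lebesgue_rV_step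
  step0 step_ge0 step_sigma_additive.

Let step_sigma_finite : sigma_finite setT lebesgue_rV_step.
Proof.
have /sigma_finiteP[F [TF ndF Foo]] := sigma_finiteT (@lebesgue_measure R).
have /sigma_finiteP[G [TG ndG Goo]] := sigma_finiteT m.
exists (fun k => @rV_uncons n @^-1` (F k `*` G k)).
  rewrite -preimage_bigcup -[LHS](preimage_setT (@rV_uncons n)).
  congr (_ @^-1` _); rewrite -setXTT TF TG predeqE => -[x y]; split.
    move=> [/= [i _ Fix] [k _ Gky]]; exists (maxn i k) => //; split.
    - by move: x Fix; exact/subsetPset/ndF/leq_maxl.
    - by move: y Gky; exact/subsetPset/ndG/leq_maxr.
  by move=> [i _ []/= ? ?]; split; exists i.
move=> k; have [mF Fk] := Foo k; have [mG Gk] := Goo k; split.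
  rewrite -[X in measurable X]setTI; apply: measurable_rV_uncons => //.
  exact: measurableX.
rewrite /lebesgue_rV_step /pushforward -comp_preimage.
rewrite (_ : _ \o _ = id) ?preimage_id; last first.
  by apply/funext => p; exact: rV_consK.
by rewrite product_measure1E// lte_mul_pinfty// ge0_fin_numE.
Qed.

HB.instance Definition _ := Measure_isSigmaFinite.Build _ _ _ lebesgue_rV_step
  step_sigma_finite.

End step.

Fixpoint lebesgue_rV n : {sigma_finite_measure set 'rV[R]_n -> \bar R} :=
  if n is m.+1 then lebesgue_rV_step (lebesgue_rV m) else \d_(0 : 'rV[R]_0).

Lemma lebesgue_rV_box n (a b : 'rV[R]_n) : (forall i, a ord0 i <= b ord0 i) ->
  lebesgue_rV n [set x | forall i, a ord0 i <= x ord0 i <= b ord0 i] =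
  (\prod_i (b ord0 i - a ord0 i))%:E.
Proof.
elim: n => [|n IHn] in a b * => ab.
  by rewrite big_ord0 /= diracE mem_set// => -[].
pose a' := (rV_uncons a).2; pose b' := (rV_uncons b).2.
transitivity ((@lebesgue_measure R \x lebesgue_rV n)%E
  (`[a ord0 ord0, b ord0 ord0]%classic `*`
   [set x : 'rV[R]_n | forall i, a' ord0 i <= x ord0 i <= b' ord0 i])).
  congr (product_measure1 _ _ _).
  apply/seteqP; split => -[x y] /=.
    move=> h; split => [|j].
      by have := h ord0; rewrite !mxE unlift_none in_itv.
    by have := h (lift ord0 j); rewrite !mxE liftK.
  rewrite in_itv /= => -[hx hy] i; rewrite mxE.
  by case: (unliftP ord0 i) => [j|] ->//; have := hy j; rewrite !mxE.
rewrite product_measure1E//; last first.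
  rewrite (_ : mkset _ = \bigcap_(i in [set: 'I_n])
     (rV_coord i @^-1` `[a' ord0 i, b' ord0 i]%classic)); last first.
    apply/seteqP; split => x /=.
      by move=> h i _ /=; rewrite in_itv; exact: h.
    by move=> h i; have := h i I; rewrite /= in_itv.
  apply: fin_bigcap_measurable => // i _.
  by rewrite -[X in measurable X]setTI; exact: measurable_rV_coord.
rewrite IHn; last by move=> i; rewrite !mxE.
rewrite big_ord_recl EFinM; congr (_ * _)%E.
  have := lebesgue_measure_itv `[a ord0 ord0, b ord0 ord0].
  rewrite /= lte_fin => ->.
  by case: ltP => // h; rewrite (le_anti (introT andP (conj (ab ord0) h))) subrr.
by congr EFin; apply: eq_bigr => i _; rewrite !mxE.
Qed.

End lebesgue_rV.

Section sobolev.
Context {R : realType} {d : nat}.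
Implicit Types (Om : set 'rV[R]_d) (u v w : 'rV[R]_d -> R).

Local Notation leb := (@lebesgue_rV R d).

Definition domain Om := [/\ open Om, connected Om, Om !=set0 & bounded_set Om].

Definition partial (i : 'I_d) u : 'rV[R]_d -> R :=
  fun x => 'D_(delta_mx ord0 i) u x.

Definition smooth u := forall s : seq 'I_d,
  continuous (foldr partial u s) /\
  forall i x, derivable (foldr partial u s) x (delta_mx ord0 i).

Definition test_function Om : set ('rV[R]_d -> R) := [set phi | smooth phi /\
  compact (closure [set x | phi x != 0]) /\
  closure [set x | phi x != 0] `<=` Om].

Definition mi_order (a : 'I_d -> nat) : nat := (\sum_i a i)%N.

Definition mi_unit (i : 'I_d) : 'I_d -> nat := fun j => (j == i : nat).

Definition mi_of k (a : {ffun 'I_d -> 'I_k.+1}) : 'I_d -> nat := fun i => a i.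

Definition mi_partial (a : 'I_d -> nat) u : 'rV[R]_d -> R :=
  foldr (fun i g => iter (a i) (partial i) g) u (enum 'I_d).

Definition loc_integrable Om u := measurable_fun Om u /\
  forall K, compact K -> K `<=` Om -> leb.-integrable K (EFin \o u).

Definition weak_derivative Om (a : 'I_d -> nat) u : set ('rV[R]_d -> R) :=
  [set g | [/\ loc_integrable Om u, loc_integrable Om g &
    forall phi, test_function Om phi ->
      \int[leb]_(x in Om) (u x * mi_partial a phi x) =
      (-1) ^+ mi_order a * \int[leb]_(x in Om) (g x * phi x)]].

(* A representative of the weak derivative, which is unique up to a null set. *)
Definition wderiv Om (a : 'I_d -> nat) u : 'rV[R]_d -> R :=
  xget (cst 0) (weak_derivative Om a u).

(* Functions are total; only their values on Om matter. *)
Definition Lp_space (p : \bar R) Om : set ('rV[R]_d -> R) :=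
  [set u | u \_ Om \in Lfun leb p].

Definition Lp_norm (p : \bar R) Om u : R :=
  fine ('N[leb]_p[EFin \o (u \_ Om)]).

Definition sobolev_space k (p : \bar R) Om : set ('rV[R]_d -> R) :=
  [set u | forall a : 'I_d -> nat, (mi_order a <= k)%N ->
    exists2 g, weak_derivative Om a u g & Lp_space p Om g].

Definition Hnorm k Om u : R := Num.sqrt
  (\sum_(a : {ffun 'I_d -> 'I_k.+1} | (mi_order (mi_of a) <= k)%N)
     Lp_norm 2%:E Om (wderiv Om (mi_of a) u) ^+ 2).

Definition Winf_norm k Om u : R :=
  \big[Num.max/0]_(a : {ffun 'I_d -> 'I_k.+1} | (mi_order (mi_of a) <= k)%N)
     Lp_norm +oo%E Om (wderiv Om (mi_of a) u).

Definition H10 Om : set ('rV[R]_d -> R) :=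
  [set u | sobolev_space 1 2%:E Om u /\ forall e, 0 < e ->
    exists2 phi, test_function Om phi & Hnorm 1 Om (u \- phi) < e].

Definition orthogonal_basis Om (psi : nat -> 'rV[R]_d -> R) :=
  [/\ forall j, Lp_space 2%:E Om (psi j) /\ Lp_norm 2%:E Om (psi j) != 0,
      forall i j, i != j -> \int[leb]_(x in Om) (psi i x * psi j x) = 0 &
      forall w, Lp_space 2%:E Om w -> forall e, 0 < e ->
        exists n (c : nat -> R),
          Lp_norm 2%:E Om (fun x => w x - \sum_(j < n) c j * psi j x) < e].

Implicit Types F G f : 'rV[R]_d -> 'rV[R]_d.

Definition comp F (i : 'I_d) : 'rV[R]_d -> R := fun x => F x ord0 i.

Definition vL2 Om : set ('rV[R]_d -> 'rV[R]_d) :=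
  [set F | forall i, Lp_space 2%:E Om (comp F i)].

Definition vL2_norm Om F : R :=
  Num.sqrt (\sum_i Lp_norm 2%:E Om (comp F i) ^+ 2).

Definition vH k Om : set ('rV[R]_d -> 'rV[R]_d) :=
  [set F | forall i, sobolev_space k 2%:E Om (comp F i)].

Definition vH_norm k Om F : R :=
  Num.sqrt (\sum_i Hnorm k Om (comp F i) ^+ 2).

Definition vH10 Om : set ('rV[R]_d -> 'rV[R]_d) :=
  [set F | forall i, H10 Om (comp F i)].

Definition strain Om F x : 'M[R]_d := \matrix_(i, j)
  (2^-1 * (wderiv Om (mi_unit j) (comp F i) x +
           wderiv Om (mi_unit i) (comp F j) x)).

Definition divergence Om F x : R :=
  \sum_i wderiv Om (mi_unit i) (comp F i) x.

Definition elasticity_form Om (mu lam : 'rV[R]_d -> R) F G : R :=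
  \int[leb]_(x in Om)
    (2 * mu x * (\sum_i \sum_j strain Om F x i j * strain Om G x i j) +
     lam x * divergence Om F x * divergence Om G x).

Definition load Om f F : R :=
  \int[leb]_(x in Om) (\sum_i f x ord0 i * F x ord0 i).

(* With W the whole space this is the weak form of the elasticity problem,
   with W a finite element space its Galerkin discretization. *)
Definition variational_solution Om (mu lam : 'rV[R]_d -> R) f
    (W : set ('rV[R]_d -> 'rV[R]_d)) F :=
  W F /\ forall G, W G -> elasticity_form Om mu lam F G = load Om f G.

Definition bounded_linear_functional Om (L : ('rV[R]_d -> 'rV[R]_d) -> R) :=
  (forall (a : R) F G, vL2 Om F -> vL2 Om G ->
     L (fun x => a *: F x + G x) = a * L F + L G) /\
  exists M : R, forall F, vL2 Om F -> `|L F| <= M * vL2_norm Om F.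

Definition functional_norm Om (L : ('rV[R]_d -> 'rV[R]_d) -> R) : R :=
  sup [set `|L F| | F in [set F | vL2 Om F /\ vL2_norm Om F <= 1]].

End sobolev.

Section parameters.
Context {R : realType} {d : nat}.

Definition param_cube : set (nat -> R) :=
  [set y | forall j, - 2^-1 < y j < 2^-1].

(* Under summable_coef the series converges for almost every x. *)
Definition affine_coef (c0 : 'rV[R]_d -> R) (psi : nat -> 'rV[R]_d -> R)
    (y : nat -> R) : 'rV[R]_d -> R :=
  fun x => c0 x + limn (series (fun j => y j * psi j x)).

Definition summable_coef k (Om : set 'rV[R]_d) (c0 : 'rV[R]_d -> R)
    (psi : nat -> 'rV[R]_d -> R) :=
  [/\ sobolev_space k +oo%E Om c0,
      forall j, sobolev_space k +oo%E Om (psi j) &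
      cvgn (series (fun j => Winf_norm k Om (psi j)))].

Definition regularity_property k (Om : set 'rV[R]_d)
    (mu0 lam0 : 'rV[R]_d -> R) (psi phi : nat -> 'rV[R]_d -> R) (Ct : R) :=
  forall f : 'rV[R]_d -> 'rV[R]_d, vH k.-1 Om f -> forall y z, param_cube y -> param_cube z ->
  forall u, variational_solution Om (affine_coef mu0 psi y)
              (affine_coef lam0 phi z) f (vH10 Om) u ->
    vH k.+1 Om u /\ vH_norm k.+1 Om u <= Ct * vH_norm k.-1 Om f.

End parameters.

Section finite_elements.
Context {R : realType} {d : nat}.
Implicit Types (Om S : set 'rV[R]_d) (A B : 'M[R]_(d.+1, d)).

(* A simplex is given by its d + 1 vertices, the rows of a matrix; a face by
   the set of its vertices (the empty face being the empty set). *)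
Definition face A (I : pred 'I_d.+1) : set 'rV[R]_d :=
  [set x | exists t : 'rV[R]_d.+1,
    [/\ forall i, 0 <= t ord0 i, forall i, ~~ I i -> t ord0 i = 0,
        \sum_i t ord0 i = 1 & x = t *m A]].

Definition simplex A := face A xpredT.

Definition affinely_independent A :=
  row_free (\matrix_(i < d) (row (lift ord0 i) A - row ord0 A)).

Definition triangulation Om (T : seq 'M[R]_(d.+1, d)) :=
  [/\ forall A, A \in T -> affinely_independent A,
      closure Om = \bigcup_(A in [set` T]) simplex A &
      forall A B, A \in T -> B \in T -> exists I J : pred 'I_d.+1,
        simplex A `&` simplex B = face A I /\
        simplex A `&` simplex B = face B J].

Definition euclid_norm (x : 'rV[R]_d) : R := Num.sqrt (\sum_i x ord0 i ^+ 2).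

Definition diameter S : R :=
  sup [set euclid_norm (xy.1 - xy.2) | xy in S `*` S].

Definition inball_diameter S : R :=
  sup [set 2 * rho | rho in [set rho | 0 <= rho /\
    exists x, forall y, euclid_norm (y - x) <= rho -> S y]].

Definition mesh_size (T : seq 'M[R]_(d.+1, d)) : R :=
  \big[Num.max/0]_(A <- T) diameter (simplex A).

(* Meshes are indexed by their size h, which ranges over a set H. *)
Definition regular_family Om (H : set R) (T : R -> seq 'M[R]_(d.+1, d)) :=
  (forall h, H h -> triangulation Om (T h) /\ mesh_size (T h) = h) /\
  exists sigma : R, forall h, H h -> forall A, A \in T h ->
    diameter (simplex A) <= sigma * inball_diameter (simplex A).

Definition poly_fun r (p : 'rV[R]_d -> R) :=
  exists c : {ffun 'I_d -> 'I_r.+1} -> R, forall x,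
    p x = \sum_(a | (mi_order (mi_of a) <= r)%N)
            c a * \prod_i x ord0 i ^+ mi_of a i.

(* Conformity (membership in H10) is made part of the definition. *)
Definition fe_space r Om (T : seq 'M[R]_(d.+1, d)) : set ('rV[R]_d -> R) :=
  [set v | [/\ H10 Om v, {within closure Om, continuous v},
      forall x, (closure Om `\` Om°) x -> v x = 0 &
      forall A, A \in T ->
        exists2 p, poly_fun r p & forall x, simplex A x -> v x = p x]].

Definition vfe_space r Om (T : seq 'M[R]_(d.+1, d)) :
    set ('rV[R]_d -> 'rV[R]_d) :=
  [set v | forall i, fe_space r Om T (comp v i)].

Definition approximation_property r Om (H : set R)
    (T : R -> seq 'M[R]_(d.+1, d)) (Ca : R) :=
  forall h, H h -> forall k, (1 <= k <= r)%N ->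
  forall v, vH10 Om v -> vH k.+1 Om v ->
    inf [set vH_norm 1 Om (v \- vh) | vh in vfe_space r Om (T h)] <=
    Ca * h ^+ k * vH_norm k.+1 Om v.

End finite_elements.

(* Main.v *)
(* Korn's first inequality (on H^1_0 the integral of D_i u D_j v is symmetric in
   i and j) and Poincare's inequality give coercivity; Cea's lemma, approximation
   and regularity give the H^1 estimate for e = u - u_h.  For the functional it
   suffices that |e|_{L^2} <= C h |e|_V (Aubin-Nitsche).  As e is only in H^1, the
   dual problem is solved for g instead, the mollification at scale h of a nearby
   test function: |e - g| <= C h |e|_V and h^(theta-1) |g|_{H^(theta-1)} <=
   C (|e| + h |e|_V).  The part (g, e) is bounded by duality, and X = |e|,
   Y = h |e|_V satisfy X^2 <= a X Y + b (X + Y) Y, whence X <= (a + b + 1) Y. *)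

Require Import Defs.
From HB Require Import structures.
From mathcomp Require Import all_boot all_order all_algebra.
From mathcomp Require Import all_classical all_reals all_analysis.
From mathcomp Require Import measurable_realfun ring lra.

Set Implicit Arguments.
Unset Strict Implicit.
Unset Printing Implicit Defensive.

Import Order.TTheory GRing.Theory Num.Theory.
Import numFieldNormedType.Exports.

Local Open Scope classical_set_scope.
Local Open Scope ring_scope.

(** * Square-integrable functions *)

(** The regularity property is assumed at the single order theta, with data in H^(theta-1). For
    theta > 1 it says nothing about a dual problem whose data are merely in L^2, and for theta > 2
    the error itself is too rough to serve as data; this forces the smoother g. Each derivative of a
    mollified function costs h^-1, so passing from the L^2 norm to the H^(theta-1) norm loses at
    most h^-(theta-1), while approximating the dual solution gains h^theta: exactly one power of h
    survives. Mollification is applied to a test function because its extension by zero is smooth on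
    the whole space, where translations are available. The result need not vanish on the boundary,
    which is harmless, since data in H^(theta-1) carry no boundary condition. The regularity
    property speaks of given solutions only, so the existence of a dual solution has to be proved;
    this is done by minimizing the energy over the complete space of H^1_0 fields. Coercivity and
    continuity see the coefficients only through their bounds, which makes the constant uniform in y
    and z. *)

Lemma le_of_eq (disp : Order.disp_t) (T : porderType disp) (x y : T) :
  x = y -> (x <= y)%O.
Proof. by move=> ->. Qed.

Lemma Rintegral_zero d (T : measurableType d) (R : realType)
    (mu : {measure set T -> \bar R}) (D : set T) : \int[mu]_(x in D) 0 = 0 :> R.
Proof. by rewrite /Rintegral integral0. Qed.

(* Locked, because conversion checks would otherwise unfold the integral. *)
HB.lock Definition dotp {d} {T : measurableType d} {R : realType}
  (mu : {measure set T -> \bar R}) (D : set T) (u v : T -> R) : R :=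
  \int[mu]_(x in D) (u x * v x).
Canonical locked_dotp := Unlockable dotp.unlock.

Section square_integrable.
Context d (T : measurableType d) (R : realType).
Variables (mu : {measure set T -> \bar R}) (D : set T).
Hypothesis mD : measurable D.
Implicit Types (u v w : T -> R) (a : R).

(** No quotient by almost-everywhere equality is taken: [l2norm] is only a seminorm on such
    functions, and the [ae_eq] lemmas of this section do the identification. *)
Definition sqint u := measurable_fun D u /\
  mu.-integrable D (EFin \o (fun x => u x ^+ 2)).

Local Notation dotp := (dotp mu D).

Lemma dotpE u v : dotp u v = \int[mu]_(x in D) (u x * v x).
Proof. by rewrite unlock. Qed.

Definition l2norm u : R := Num.sqrt (dotp u u).

Lemma sqint_measurable u : sqint u -> measurable_fun D u.
Proof. by case. Qed.

Lemma sqintM u v : sqint u -> sqint v ->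
  mu.-integrable D (EFin \o (fun x => u x * v x)).
Proof.
move=> [mu_ iu] [mv iv].
apply: (@le_integrable _ _ _ mu D mD _ (fun x => (u x ^+ 2)%:E + (v x ^+ 2)%:E)%E).
- by apply/measurable_EFinP; exact: measurable_funM.
- move=> x Dx /=; rewrite lee_fin [leRHS]ger0_norm ?addr_ge0 ?sqr_ge0//.
  rewrite ler_norml; apply/andP; split; nra.
- exact: (@integrableD _ _ _ mu D mD _ _ iu iv).
Qed.

Lemma sqintD u v : sqint u -> sqint v -> sqint (fun x => u x + v x).
Proof.
move=> hu hv; split; first by apply: measurable_funD; [case: hu|case: hv].
apply: (@eq_integrable _ _ _ mu D mD
  (fun x => ((u x * u x)%:E + ((u x * v x)%:E + (u x * v x)%:E)) + (v x * v x)%:E)%E).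
  by move=> x _ /=; rewrite -!EFinD; congr EFin; ring.
apply: (integrableD mD); last exact: sqintM.
apply: (integrableD mD); first exact: sqintM.
by apply: (integrableD mD); exact: sqintM.
Qed.

Lemma sqintZ a u : sqint u -> sqint (fun x => a * u x).
Proof.
move=> [mu_ iu]; split; first by apply: measurable_funM => //; exact: measurable_cst.
apply: (@eq_integrable _ _ _ mu D mD (fun x => (a ^+ 2)%:E * (u x ^+ 2)%:E)%E).
  by move=> x _ /=; rewrite exprMn.
exact: (integrableZl mD).
Qed.

Lemma sqint0 : sqint (fun=> 0).
Proof.
split; first exact: measurable_cst.
apply: (@eq_integrable _ _ _ mu D mD (cst 0%E)); last exact: integrable0.
by move=> x _ /=; rewrite expr0n.
Qed.

Lemma sqintB u v : sqint u -> sqint v -> sqint (fun x => u x - v x).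
Proof.
move=> hu /(sqintZ (-1)) hv; have := sqintD hu hv.
by congr sqint; apply/funext => x; rewrite mulN1r.
Qed.

Lemma sqint_sum I (s : seq I) (F : I -> T -> R) : (forall i, sqint (F i)) ->
  sqint (fun x => \sum_(i <- s) F i x).
Proof.
move=> h; elim: s => [|i s ih].
  by under eq_fun do rewrite big_nil; exact: sqint0.
by under eq_fun do rewrite big_cons; exact: sqintD.
Qed.

Lemma dotpC u v : dotp u v = dotp v u.
Proof. by rewrite !dotpE; apply: eq_Rintegral => x _; rewrite mulrC. Qed.

Lemma dotpDl u v w : sqint u -> sqint v -> sqint w ->
  dotp (fun x => u x + v x) w = dotp u w + dotp v w.
Proof.
move=> hu hv hw; rewrite !dotpE -RintegralD//; [|exact: sqintM..].
by apply: eq_Rintegral => x _ /=; rewrite mulrDl.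
Qed.

Lemma dotpZl a u w : sqint u -> sqint w ->
  dotp (fun x => a * u x) w = a * dotp u w.
Proof.
move=> hu hw; rewrite !dotpE -RintegralZl//; last exact: sqintM.
by apply: eq_Rintegral => x _ /=; rewrite mulrA.
Qed.

Lemma dotpBl u v w : sqint u -> sqint v -> sqint w ->
  dotp (fun x => u x - v x) w = dotp u w - dotp v w.
Proof.
move=> hu hv hw; rewrite -mulN1r -dotpZl// -dotpDl//; last exact: sqintZ.
by congr dotp; apply/funext => x; rewrite mulN1r.
Qed.

Lemma dotpBr u v w : sqint u -> sqint v -> sqint w ->
  dotp w (fun x => u x - v x) = dotp w u - dotp w v.
Proof. by move=> *; rewrite dotpC dotpBl// dotpC; congr (_ - _); exact: dotpC. Qed.

Lemma dotpDr u v w : sqint u -> sqint v -> sqint w ->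
  dotp w (fun x => u x + v x) = dotp w u + dotp w v.
Proof. by move=> *; rewrite dotpC dotpDl// dotpC; congr (_ + _); exact: dotpC. Qed.

Lemma dotpZr a u w : sqint u -> sqint w ->
  dotp w (fun x => a * u x) = a * dotp w u.
Proof. by move=> *; rewrite dotpC dotpZl// dotpC. Qed.

Lemma dotp_suml I (s : seq I) (F : I -> T -> R) w : (forall i, sqint (F i)) ->
  sqint w -> dotp (fun x => \sum_(i <- s) F i x) w = \sum_(i <- s) dotp (F i) w.
Proof.
move=> h hw; elim: s => [|i s ih].
  rewrite big_nil dotpE -[RHS](Rintegral_zero mu D).
  by apply: eq_Rintegral => x _; rewrite big_nil mul0r.
rewrite big_cons -ih -dotpDl//; last exact: sqint_sum.
by congr dotp; apply/funext => x; rewrite big_cons.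
Qed.

Lemma dotp_ge0 u : 0 <= dotp u u.
Proof. by rewrite dotpE; apply: Rintegral_ge0 => x _; rewrite -expr2 sqr_ge0. Qed.

Lemma l2norm_ge0 u : 0 <= l2norm u.
Proof. exact: sqrtr_ge0. Qed.

Lemma sqr_l2norm u : l2norm u ^+ 2 = dotp u u.
Proof. by rewrite sqr_sqrtr// dotp_ge0. Qed.

Lemma integral_sqr u : sqint u ->
  (\int[mu]_(x in D) (u x ^+ 2)%:E = (l2norm u ^+ 2)%:E)%E.
Proof.
move=> [mu_ iu]; rewrite sqr_l2norm dotpE /Rintegral fineK//.
exact: integrable_fin_num.
Qed.

Lemma dotp_sqr_le u v : sqint u -> sqint v ->
  dotp u v ^+ 2 <= dotp u u * dotp v v.
Proof.
move=> hu hv.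
have q s : 0 <= dotp u u + 2 * s * dotp u v + s ^+ 2 * dotp v v.
  have := dotp_ge0 (fun x => u x + s * v x).
  have hsv : sqint (fun x => s * v x) by exact: sqintZ.
  have hs : sqint (fun x => u x + s * v x) by exact: sqintD.
  rewrite dotpDl// !dotpDr// !dotpZl// !dotpZr//.
  by rewrite (dotpC v u) => /le_trans; apply; apply: le_of_eq; ring.
have vv := dotp_ge0 v; have uu := dotp_ge0 u.
move: vv; rewrite le_eqVlt => /orP[/eqP vv|vv].
  rewrite -vv mulr0; have [->|n0] := eqVneq (dotp u v) 0; first by rewrite expr0n.
  (* With [dotp v v = 0] the quadratic is affine in [s], and this value of [s] would make it equal
     to -1. *)
  have := q (- (dotp u u + 1) / (2 * dotp u v)); rewrite -vv mulr0 addr0.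
  have -> : 2 * (- (dotp u u + 1) / (2 * dotp u v)) * dotp u v = - (dotp u u + 1).
    by field.
  lra.
(* The minimizer of the quadratic. *)
have := q (- dotp u v / dotp v v).
rewrite -(ler_pM2r vv) mul0r.
have -> : (dotp u u + 2 * (- dotp u v / dotp v v) * dotp u v
  + (- dotp u v / dotp v v) ^+ 2 * dotp v v) * dotp v v =
  dotp u u * dotp v v - dotp u v ^+ 2 by field; rewrite gt_eqF.
by rewrite subr_ge0.
Qed.

Lemma cauchy_schwarz u v : sqint u -> sqint v ->
  `|dotp u v| <= l2norm u * l2norm v.
Proof.
move=> hu hv; rewrite -ler_sqr ?nnegrE ?mulr_ge0 ?l2norm_ge0//.
by rewrite real_normK ?num_real// exprMn !sqr_l2norm dotp_sqr_le.
Qed.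

Lemma l2normD u v : sqint u -> sqint v ->
  l2norm (fun x => u x + v x) <= l2norm u + l2norm v.
Proof.
move=> hu hv; rewrite -ler_sqr ?nnegrE ?addr_ge0 ?l2norm_ge0//.
have huv : sqint (fun x => u x + v x) by exact: sqintD.
rewrite sqrrD !sqr_l2norm dotpDl// !dotpDr// (dotpC v u).
have := cauchy_schwarz hu hv; rewrite ler_norml => /andP[_]; lra.
Qed.

Lemma l2normZ a u : sqint u -> l2norm (fun x => a * u x) = `|a| * l2norm u.
Proof.
move=> hu; apply: (@pexpIrn R 2); rewrite ?nnegrE ?mulr_ge0 ?l2norm_ge0//.
rewrite exprMn !sqr_l2norm dotpZl ?dotpZr//; last exact: sqintZ.
by rewrite mulrA -expr2 real_normK ?num_real.
Qed.

Lemma l2normBC u v : l2norm (fun x => u x - v x) = l2norm (fun x => v x - u x).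
Proof.
by rewrite /l2norm !dotpE; congr Num.sqrt; apply: eq_Rintegral => x _; rewrite -mulrNN !opprB.
Qed.

Lemma l2normB u v : sqint u -> sqint v ->
  l2norm (fun x => u x - v x) <= l2norm u + l2norm v.
Proof.
move=> hu hv; have hNv : sqint (fun x => -1 * v x) by exact: sqintZ.
have := l2normD hu hNv; rewrite l2normZ// normrN1 mul1r.
by congr (l2norm _ <= _); apply/funext => x; rewrite mulN1r.
Qed.

Lemma l2norm_triangle u v w : sqint u -> sqint v -> sqint w ->
  l2norm (fun x => u x - w x) <=
  l2norm (fun x => u x - v x) + l2norm (fun x => v x - w x).
Proof.
move=> hu hv hw; have := l2normD (sqintB hu hv) (sqintB hv hw).
by congr (l2norm _ <= _); apply/funext => x; rewrite addrA subrK.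
Qed.

Lemma l2norm0 : l2norm (fun=> 0) = 0.
Proof.
rewrite /l2norm (_ : dotp _ _ = 0) ?sqrtr0// dotpE -[RHS](Rintegral_zero mu D).
by apply: eq_Rintegral => x _; rewrite mul0r.
Qed.

Lemma Rintegral_ae_eq u v : measurable_fun D u -> measurable_fun D v ->
  ae_eq mu D u v -> \int[mu]_(x in D) u x = \int[mu]_(x in D) v x.
Proof.
move=> hu hv uv; congr fine; apply: ae_eq_integral => //.
- exact/measurable_EFinP.
- exact/measurable_EFinP.
- by apply: filterS uv => x /= h /h ->.
Qed.

Lemma dotp_ae_eq u u' v v' : measurable_fun D u -> measurable_fun D u' ->
  measurable_fun D v -> measurable_fun D v' ->
  ae_eq mu D u u' -> ae_eq mu D v v' -> dotp u v = dotp u' v'.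
Proof.
move=> hu hu' hv hv' uu vv; rewrite !dotpE; apply: Rintegral_ae_eq => //; [exact: measurable_funM..|].
by apply: filterS2 uu vv => x /= h h' Dx; rewrite h// h'.
Qed.

Lemma l2norm_ae_eq u v : measurable_fun D u -> measurable_fun D v ->
  ae_eq mu D u v -> l2norm u = l2norm v.
Proof. by move=> *; rewrite /l2norm; congr Num.sqrt; exact: dotp_ae_eq. Qed.

Lemma sqint_ae_eq u v : measurable_fun D v -> ae_eq mu D u v -> sqint u -> sqint v.
Proof.
move=> hv uv [hu iu]; split => //; apply/integrableP; split.
  by apply/measurable_EFinP; exact: measurable_funX.
move/integrableP : iu => [mu2]; apply: le_lt_trans; apply: le_of_eq.
apply: ae_eq_integral => //.
- by apply: measurableT_comp => //; apply/measurable_EFinP; exact: measurable_funX.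
- by apply: measurableT_comp => //; apply/measurable_EFinP; exact: measurable_funX.
- by apply: filterS uv => x /= h Dx; rewrite h.
Qed.

Lemma sqint_bounded u v c : measurable_fun D u ->
  (forall x, D x -> `|u x| <= c * `|v x|) -> sqint v -> sqint u.
Proof.
move=> hu uv [hv iv]; split => //.
apply: (@le_integrable _ _ _ mu D mD _ (fun x => (c ^+ 2)%:E * (v x ^+ 2)%:E)%E).
- by apply/measurable_EFinP; exact: measurable_funX.
- move=> x Dx /=; rewrite lee_fin [leRHS]ger0_norm; last by rewrite mulr_ge0 ?sqr_ge0.
  rewrite ger0_norm ?sqr_ge0//; have cv := le_trans (normr_ge0 _) (uv _ Dx).
  have : `|u x| ^+ 2 <= (c * `|v x|) ^+ 2 by rewrite ler_sqr// uv.
  by rewrite exprMn !real_normK ?num_real.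
- exact: (@integrableZl _ _ _ mu D mD (c ^+ 2) (fun x => (v x ^+ 2)%:E) iv).
Qed.

End square_integrable.

Lemma sum_half_le2 (R : realFieldType) n : \sum_(0 <= k < n) 2^-1 ^+ k <= 2 :> R.
Proof.
have -> : \sum_(0 <= k < n) 2^-1 ^+ k = 2 - 2 * 2^-1 ^+ n :> R.
  elim: n => [|n ih]; first by rewrite big_geq// expr0; ring.
  by rewrite big_nat_recr//= ih exprS; field.
by rewrite lerBlDr lerDl mulr_ge0// exprn_ge0.
Qed.

Lemma cvgn_abs_series (R : realType) (v : nat -> R) (M : R) :
  (forall n, \sum_(0 <= k < n) `|v k.+1 - v k| <= M) -> cvgn v.
Proof.
move=> h; have : cvgn [normed series (fun k => v k.+1 - v k)].
  apply: nondecreasing_is_cvgn.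
    by apply: nondecreasing_series => k _ _; exact: normr_ge0.
  by exists M => _ [n _ <-]; exact: h.
move/normed_cvg => h1.
rewrite (_ : v = (fun=> v 0%N) \+ series (fun k => v k.+1 - v k)).
  by apply: is_cvgD => //; exact: is_cvg_cst.
apply/funext => n; rewrite /= /series /= telescope_sumr//.
by rewrite addrC subrK.
Qed.

Lemma limn_einf_le (R : realType) (a : nat -> \bar R) (c : \bar R) :
  (forall n, (a n <= c)%E) -> (limn_einf a <= c)%E.
Proof.
move=> h; rewrite limn_einf_lim; apply: lime_le; first exact: is_cvg_einfs.
apply: nearW => n; apply: le_trans (h n).
by apply: ereal_inf_lbound; exists n => //=.
Qed.

(** * Completeness of the space of square-integrable functions *)

Section l2_complete.
Context d (T : measurableType d) (R : realType).
Variables (mu : {measure set T -> \bar R}) (D : set T).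
Hypothesis mD : measurable D.

Local Notation nrm := (l2norm mu D).

(* Passing to a subsequence with increments at most 2^-k, the elementary bound
   [g <= 2^-k + 2^k g^2] turns square summability of the increments into
   pointwise summability. *)
Let geometric_cauchy_ae_cvg (v : nat -> T -> R) :
  (forall k, sqint mu D (v k)) ->
  (forall k, nrm (fun x => v k.+1 x - v k x) <= 2^-1 ^+ k) ->
  {ae mu, forall x, D x -> cvgn (v ^~ x)}.
Proof.
move=> hv nv.
have sv k : sqint mu D (fun x => v k.+1 x - v k x) by exact: sqintB.
pose g k x : \bar R := (2 ^+ k * (v k.+1 x - v k x) ^+ 2)%:E.
have g0 k x : (0 <= g k x)%E by rewrite lee_fin mulr_ge0 ?sqr_ge0 ?exprn_ge0.
have mg k : measurable_fun D (g k).
  apply/measurable_EFinP; apply: measurable_funM; first exact: measurable_cst.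
  by apply: measurable_funX; case: (sv k).
have ig : mu.-integrable D (fun x => \sum_(k <oo) g k x)%E.
  apply/integrableP; split.
    by apply: ge0_emeasurable_sum => // k x Dx _; exact: g0.
  apply: (@le_lt_trans _ _ (\int[mu]_(x in D) \sum_(k <oo) g k x)%E).
    apply: le_of_eq; apply: eq_integral => x _.
    by rewrite gee0_abs// nneseries_ge0.
  rewrite integral_nneseries//.
  apply: (@le_lt_trans _ _ (2%:E)); last by rewrite ltry.
  (* The weight 2^k meets a squared norm of at most 4^-k. *)
  have bk k : (\int[mu]_(x in D) g k x <= (2^-1 ^+ k)%:E)%E.
    rewrite /g; under eq_integral do rewrite EFinM.
    rewrite ge0_integralZl_EFin//.
    - rewrite integral_sqr// -EFinM lee_fin.
      apply: (@le_trans _ _ (2 ^+ k * (2^-1 ^+ k) ^+ 2)).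
        rewrite ler_pM2l ?exprn_gt0// ler_sqr ?nnegrE ?l2norm_ge0 ?exprn_ge0//.
      rewrite expr2 mulrA -exprMn divff ?expr1n ?mul1r//.
    - by move=> x Dx; rewrite lee_fin sqr_ge0.
    - apply/measurable_EFinP; apply: measurable_funX; by case: (sv k).
  apply: lime_le; first by apply: is_cvg_nneseries => n _ _; exact: integral_ge0.
  apply: nearW => n.
  apply: (@le_trans _ _ (\sum_(0 <= k < n) (2^-1 ^+ k)%:E)%E).
    by apply: lee_sum => k _; exact: bk.
  by rewrite sumEFin lee_fin sum_half_le2.
have := integrable_ae mD ig; apply: filterS => x /= h Dx.
have {}h := h Dx.
apply: (@cvgn_abs_series _ _ (2 + fine (\sum_(k <oo) g k x)%E)) => n.
apply: (@le_trans _ _ (\sum_(0 <= k < n) (2^-1 ^+ k + 2 ^+ k * (v k.+1 x - v k x) ^+ 2))).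
  apply: ler_sum => k _.
  have -> : (2 : R)^-1 ^+ k = (2 ^+ k)^-1 by rewrite exprVn.
  have : 0 < (2 : R) ^+ k by rewrite exprn_gt0.
  set c := 2 ^+ k; set t := v k.+1 x - v k x => c0.
  rewrite -(real_normK (num_real t)); set s := `|t|.
  rewrite -(ler_pM2l c0) mulrDr divff ?gt_eqF//.
  rewrite mulrA -expr2 -exprMn; nra.
rewrite big_split /=; apply: lerD; first exact: sum_half_le2.
rewrite -lee_fin fineK// -sumEFin.
by apply: nneseries_lim_ge => k _ _; exact: g0.
Qed.

(** Lower semicontinuity of the norm under almost-everywhere convergence. It yields both the square
    integrability of the limit and, applied to differences, the rate of convergence. *)
Let fatou_limit (v : nat -> T -> R) (w : T -> R) c : 0 <= c ->
  (forall k, sqint mu D (v k)) -> measurable_fun D w ->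
  {ae mu, forall x, D x -> v ^~ x @ \oo --> w x} ->
  (forall k, nrm (v k) <= c) -> sqint mu D w /\ nrm w <= c.
Proof.
move=> c0 hv mw vw nv.
have mv2 k : measurable_fun D (fun x => (v k x ^+ 2)%:E).
  by apply/measurable_EFinP; apply: measurable_funX; case: (hv k).
have key : (\int[mu]_(x in D) (w x ^+ 2)%:E <= (c ^+ 2)%:E)%E.
  apply: (@le_trans _ _ (\int[mu]_(x in D) limn_einf (fun k => (v k x ^+ 2)%:E))%E).
    apply: ae_ge0_le_integral => //.
    - by move=> x _; rewrite lee_fin sqr_ge0.
    - by apply/measurable_EFinP; exact: measurable_funX.
    - move=> x _; rewrite limn_einf_lim; apply: lime_ge; first exact: is_cvg_einfs.
      apply: nearW => n; apply: le_ereal_inf_tmp => _ [m _ <-].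
      by rewrite lee_fin sqr_ge0.
    - under eq_fun do rewrite -[limn_einf _]oppeK -limn_esupN.
      by apply: measurableT_comp => //; apply: measurable_fun_limn_esup => k;
        exact: measurableT_comp.
    - apply: filterS vw => x /= h Dx; have {}h := h Dx.
      have h2 : (v k x ^+ 2)%:E @[k --> \oo] --> (w x ^+ 2)%:E.
        by apply: cvg_EFin; [exact: nearW|apply: cvgM].
      by rewrite is_cvg_limn_einfE ?(cvg_lim _ h2)//; exact: cvgP h2.
  apply: le_trans (fatou mu mD mv2 _) _.
    by move=> n x _; rewrite lee_fin sqr_ge0.
  apply: limn_einf_le => n; rewrite integral_sqr// lee_fin ler_sqr ?nnegrE//.
  exact: l2norm_ge0.
have sw : sqint mu D w.
  split=> //; apply/integrableP; split.
    by apply/measurable_EFinP; exact: measurable_funX.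
  apply: le_lt_trans (ltry (c ^+ 2)).
  apply: le_trans key; apply: le_of_eq.
  by apply: eq_integral => x _ /=; rewrite ger0_norm ?sqr_ge0.
split=> //; move: key; rewrite integral_sqr// lee_fin ler_sqr ?nnegrE//.
exact: l2norm_ge0.
Qed.

(** A fast subsequence [v] converges almost everywhere, and [fatou_limit] applied to the tails of
    [v] minus [v k] places the limit within 2^-k of [v k]. The full sequence follows through [v k],
    which accounts for the bound 2 * 2^-k. *)
Lemma l2_complete (u : nat -> T -> R) :
  (forall n, sqint mu D (u n)) ->
  (forall e, 0 < e -> exists N, forall m n, (N <= m)%N -> (N <= n)%N ->
     nrm (fun x => u m x - u n x) < e) ->
  exists2 w, sqint mu D w &
    forall e, 0 < e -> exists N, forall n, (N <= n)%N ->
      nrm (fun x => u n x - w x) < e.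
Proof.
move=> hu cu.
have /choice[N hN] : forall k, exists N, forall m n, (N <= m)%N -> (N <= n)%N ->
     nrm (fun x => u m x - u n x) < 2^-1 ^+ k.
  by move=> k; apply: cu; rewrite exprn_gt0.
(* A running maximum, so that [n_ j] passes the threshold [N k] for every [j] at or after [k]. *)
pose n_ k := (\max_(i < k.+1) N i)%N.
have Nn i k : (i <= k)%N -> (N i <= n_ k)%N.
  move=> ik; have ik' : (i < k.+1)%N by [].
  exact: (@leq_bigmax _ (fun i : 'I_k.+1 => N i) (Ordinal ik')).
pose v k := u (n_ k).
have hv k : sqint mu D (v k) by exact: hu.
have nv j k : (k <= j)%N -> nrm (fun x => v j x - v k x) <= 2^-1 ^+ k.
  by move=> kj; apply/ltW/hN; exact: Nn.
have cv := geometric_cauchy_ae_cvg hv (fun k => nv _ _ (leqnSn k)).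
(* The upper limit is measurable whether or not the sequence converges at a given point. *)
pose w x := fine (limn_esup (fun k => (v k x)%:E)).
have mw : measurable_fun D w.
  apply: measurableT_comp => //; apply: measurable_fun_limn_esup => k.
  by apply/measurable_EFinP; case: (hv k).
have vw : {ae mu, forall x, D x -> v ^~ x @ \oo --> w x}.
  apply: filterS cv => x /= h Dx; have {}h := h Dx.
  have h2 : (v k x)%:E @[k --> \oo] --> (limn (v ^~ x))%:E.
    by apply: cvg_EFin => //; exact: nearW.
  rewrite /w is_cvg_limn_esupE; last by exact: cvgP h2.
  by rewrite (cvg_lim _ h2).
have est k : sqint mu D (fun x => w x - v k x) /\
    nrm (fun x => w x - v k x) <= 2^-1 ^+ k.
  apply: (@fatou_limit (fun j x => v (j + k)%N x - v k x)).
  - by rewrite exprn_ge0.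
  - by move=> j; exact: sqintB.
  - by apply: measurable_funB => //; case: (hv k).
  - apply: filterS vw => x /= h Dx; apply: cvgB; last exact: cvg_cst.
    by rewrite (cvg_shiftn k (v ^~ x)); exact: h.
  - by move=> j; apply: nv; rewrite leq_addl.
have sw : sqint mu D w.
  have := sqintD mD (est 0%N).1 (hv 0%N).
  by congr sqint; apply/funext => x; rewrite subrK.
exists w => // e e0.
have [k hk] : exists k, 2 * 2^-1 ^+ k < e.
  have : geometric 2 (2^-1 : R) @ \oo --> (0 : R).
    by apply: cvg_geometric; rewrite ger0_norm// invf_lt1// ltr1n.
  move/cvgrPdist_lt => /(_ _ e0)[k _ hk]; exists k.
  by have := hk k (leqnn k); rewrite /= sub0r normrN ger0_norm// mulr_ge0// exprn_ge0.
exists (n_ k) => n nk.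
apply: le_lt_trans (l2norm_triangle mD (hu n) (hv k) sw) _.
apply: le_lt_trans hk; rewrite mulrDl mul1r; apply: lerD.
  by apply/ltW/hN; [apply: leq_trans nk|]; exact: Nn.
by rewrite l2normBC; exact: (est k).2.
Qed.

End l2_complete.

(** * Lebesgue measure on row vectors *)

(** The pushforward of Lebesgue measure under a shift agrees with it on half-open intervals, hence
    everywhere by uniqueness; the claim is then a change of variables. *)
Lemma ger0_integral_translate (R : realType) (c : R) (f : R -> \bar R) :
  measurable_fun setT f -> (forall x, 0 <= f x)%E ->
  (\int[@lebesgue_measure R]_x f (x + c)%R = \int[@lebesgue_measure R]_x f x)%E.
Proof.
move=> mf f0.
pose phi (x : measurableTypeR R) : measurableTypeR R := x + c.
have mphi : measurable_fun setT phi by apply: measurable_funD.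
have E A : measurable A -> pushforward (@lebesgue_measure R) phi A = lebesgue_measure A.
  pose m := measure_function_pushforward__canonical__measure_function_Measure
    (@lebesgue_measure R) mphi.
  move=> mA; rewrite -[LHS]/(m A); apply/esym.
  apply: (@lebesgue_measure_unique R m) => //= _ [[u v]] _ <-.
  rewrite /m /=.
  rewrite /pushforward.
  have -> : phi @^-1` `]u, v]%classic = `](u - c), (v - c)]%classic.
    by apply/seteqP; split => x /=; rewrite !in_itv/= /phi ltrBlDr lerBrDr.
  rewrite !lebesgue_measure_itv/= !lte_fin ltrD2r.
  by case: ifP => // _; rewrite -?EFinB; congr EFin; ring.
transitivity (\int[pushforward (@lebesgue_measure R) phi]_x f x)%E.
  by rewrite ge0_integral_pushforward//= preimage_setT.
apply: eq_measure_integral => A mA _; exact: E.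
Qed.

Section rV_measure.
Context {R : realType}.
Implicit Types n : nat.

Local Notation leb n := (@lebesgue_rV R n).

Lemma measurable_rV_box n (P : 'I_n -> set R) : (forall i, measurable (P i)) ->
  measurable [set x : 'rV[R]_n | forall i, P i (x ord0 i)].
Proof.
move=> mP; rewrite (_ : mkset _ = \bigcap_(i in [set: 'I_n]) (rV_coord i @^-1` P i)).
  apply: fin_bigcap_measurable => // i _.
  by rewrite -[X in measurable X]setTI; apply: (measurable_rV_coord i) => //; exact: mP.
apply/seteqP; split => x /= h i; first by move=> _; exact: h.
exact: h.
Qed.

Lemma rV_coord_norm n (x : 'rV[R]_n) i : `|x ord0 i| <= `|x|.
Proof.
rewrite [leRHS]/Num.norm/= mx_normrE.
exact: (le_bigmax _ (fun ij => `|x ij.1 ij.2|) (ord0, i)).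
Qed.

(** The countable family of rational cubes is a basis. The point lies in the open cube and the
    closed cube lies in [A]: the closed version is there for [du_bois_reymond], where the cubes must
    have compact closure inside the domain. *)
Lemma open_rat_box n (A : set 'rV[R]_n) x : open A -> A x ->
  exists p : 'rV[rat]_n * nat,
    (forall i, `|x ord0 i - ratr (p.1 ord0 i)| < p.2.+1%:R^-1) /\
    forall y : 'rV[R]_n,
      (forall i, `|y ord0 i - ratr (p.1 ord0 i)| <= p.2.+1%:R^-1) -> A y.
Proof.
move=> oA Ax; have /nbhs_ballP[e /= e0 xe] : nbhs x A by exact: open_nbhs_nbhs.
have [k hk] : exists k : nat, k.+1%:R^-1 < e / 2.
  have e2 : 0 < e / 2 by rewrite divr_gt0.
  exists (Num.truncn (e / 2)^-1).
  by rewrite invf_plt ?posrE// truncnS_gt.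
have /choice[q hq] : forall i, exists q : rat, `|x ord0 i - ratr q| < k.+1%:R^-1.
  move=> i.
  have lt : x ord0 i - k.+1%:R^-1 < x ord0 i + k.+1%:R^-1.
    by rewrite ltrBlDr -addrA ltrDl addr_gt0// invr_gt0.
  have [q] := rat_in_itvoo lt; rewrite in_itv/= => /andP[q1 q2].
  by exists q; rewrite distrC ltr_distl q1 q2.
exists (\row_i q i, k) => /=; split=> [i|y hy]; first by rewrite mxE; exact: hq.
apply: xe; split=> // i j; rewrite (ord1 i) /ball/=.
have := hy j; have := hq j; rewrite mxE /= distrC => h1 h2.
rewrite -(subrKA (ratr (q j))) (le_lt_trans (ler_normD _ _))//.
rewrite (splitr e) ltrD//; first by rewrite distrC (lt_trans h1).
by rewrite distrC (le_lt_trans h2).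
Qed.

(** The sigma-algebra on row vectors is generated by the coordinates and not by the topology; the
    countable basis of rational cubes links the two. *)
Lemma open_measurable_rV n (A : set 'rV[R]_n) : open A -> measurable A.
Proof.
move=> oA.
pose box (p : 'rV[rat]_n * nat) : set 'rV[R]_n :=
  [set x | forall i, `|x ord0 i - ratr (p.1 ord0 i)| < p.2.+1%:R^-1].
have mbox p : measurable (box p).
  apply: (measurable_rV_box (P := fun i => [set t | `|t - ratr (p.1 ord0 i)| < p.2.+1%:R^-1])) => i.
  have -> : [set t : R | `|t - ratr (p.1 ord0 i)| < p.2.+1%:R^-1] =
     ball (ratr (p.1 ord0 i) : R) (p.2.+1%:R^-1).
    by apply/seteqP; split => t; rewrite /ball/= distrC.
  exact: measurable_ball.
have -> : A = \bigcup_(p in [set p | box p `<=` A]) box p.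
  apply/seteqP; split => [x Ax|x [p pA]]; last exact: pA.
  have [p [xp pA]] := open_rat_box oA Ax; exists p => // y hy.
  by apply: pA => i; exact/ltW/hy.
rewrite bigcup_mkcond; apply: countable_bigcupT_measurable; first exact: countableP.
by move=> p; case: ifP => // _; exact: measurable0.
Qed.

Lemma continuous_measurable_rV n (f : 'rV[R]_n -> R) :
  continuous f -> measurable_fun setT f.
Proof.
move=> /continuousP cf; apply: (measurability _ (RGenOpens.measurableE R)).
move=> _ [_ [a [b ->] <-]]; rewrite setTI; apply: open_measurable_rV.
exact/cf/interval_open.
Qed.

Lemma measurable_rV_addr n (c : 'rV[R]_n) :
  measurable_fun setT (fun x : 'rV[R]_n => x + c).
Proof.
apply: measurable_fun_rV => i.
rewrite (_ : _ \o _ = (fun x => rV_coord i x + c ord0 i)).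
  by apply: measurable_funD => //; exact: measurable_rV_coord.
by apply/funext => x; rewrite /rV_coord /= mxE.
Qed.

Lemma ge0_integral_rV_cons n (f : 'rV[R]_n.+1 -> \bar R) :
  measurable_fun setT f -> (forall x, 0 <= f x)%E ->
  (\int[leb n.+1]_x f x =
   \int[@lebesgue_measure R]_a \int[leb n]_y f (rV_cons (a, y)))%E.
Proof.
move=> mf f0.
rewrite [LHS](ge0_integral_pushforward (@measurable_rV_cons R n))//.
rewrite preimage_setT (fubini_tonelli1 (f \o @rV_cons R n))//; last first.
  by move=> x; exact: f0.
by apply: measurableT_comp => //; exact: measurable_rV_cons.
Qed.

(** Induction on the dimension: Tonelli peels off the first coordinate, which is shifted by the
    scalar case. *)
Lemma ge0_integral_rV_translate n (c : 'rV[R]_n) (f : 'rV[R]_n -> \bar R) :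
  measurable_fun setT f -> (forall x, 0 <= f x)%E ->
  (\int[leb n]_x f (x + c)%R = \int[leb n]_x f x)%E.
Proof.
elim: n => [|n ih] in c f * => mf f0.
  by apply: eq_integral => x _; congr f; apply/rowP => -[].
have mfa : measurable_fun setT (fun x : 'rV[R]_n.+1 => f (x + c)).
  by apply: measurableT_comp => //; exact: measurable_rV_addr.
rewrite (ge0_integral_rV_cons mfa (fun x => f0 (x + c))) (ge0_integral_rV_cons mf f0).
pose c' := (rV_uncons c).2.
have E a y : rV_cons (a, y) + c = rV_cons (a + c ord0 ord0, y + c').
  apply/rowP => i; rewrite !mxE; case: (unliftP ord0 i) => [j|] -> //=.
  by rewrite !mxE.
under eq_integral do under eq_integral do rewrite E.
have mfc a : measurable_fun setT (fun y => f (rV_cons (a, y))).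
  apply: measurableT_comp => //.
  apply: (measurableT_comp (measurable_rV_cons (n:=n))); exact: pair1_measurable.
under eq_integral => a _.
  rewrite (ih c' (fun y => f (rV_cons (a + c ord0 ord0, y))))//.
  over.
apply: (ger0_integral_translate (c ord0 ord0)
  (f := fun a => \int[leb n]_y f (rV_cons (a, y)))%E).
  apply: (measurable_fun_fubini_tonelli_F (f \o @rV_cons R n)) => //.
    by apply: measurableT_comp => //; exact: measurable_rV_cons.
  by move=> a; exact: f0.
by move=> a /=; apply: integral_ge0 => y _; exact: f0.
Qed.

Lemma integral_rV_translate n (c : 'rV[R]_n) (f : 'rV[R]_n -> \bar R) :
  measurable_fun setT f ->
  (\int[leb n]_x f (x + c)%R = \int[leb n]_x f x)%E.
Proof.
move=> mf; rewrite integralE [RHS]integralE; congr (_ - _)%E.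
- transitivity (\int[leb n]_x f^\+ (x + c)%R)%E.
    by apply: eq_integral => x _; rewrite !funeposE.
  by rewrite (ge0_integral_rV_translate c (measurable_funepos mf) (funepos_ge0 f)).
- transitivity (\int[leb n]_x f^\- (x + c)%R)%E.
    by apply: eq_integral => x _; rewrite !funenegE.
  by rewrite (ge0_integral_rV_translate c (measurable_funeneg mf) (funeneg_ge0 f)).
Qed.

Lemma lebesgue_rV_bounded n (A : set 'rV[R]_n) : measurable A -> bounded_set A ->
  (leb n A < +oo)%E.
Proof.
move=> mA [M [_ hM]].
have {}hM := hM (`|M| + 1) _; have : M < `|M| + 1 by rewrite ltr_pwDr// ler_norm.
move=> /hM {}hM; set K := `|M| + 1 in hM.
apply: (@le_lt_trans _ _ (leb n [set x | forall i, (const_mx (- K) : 'rV[R]_n) ord0 i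
   <= x ord0 i <= (const_mx K : 'rV[R]_n) ord0 i])).
  apply: le_measure; rewrite ?inE//.
    apply: (measurable_rV_box (P := fun i => [set t | (const_mx (- K) : 'rV[R]_n) ord0 i
      <= t <= (const_mx K : 'rV[R]_n) ord0 i])) => i.
    have -> : [set t : R | (const_mx (- K) : 'rV[R]_n) ord0 i <= t <=
        (const_mx K : 'rV[R]_n) ord0 i] = `[(- K), K]%classic.
      by apply/seteqP; split => t /=; rewrite !mxE in_itv.
    exact: measurable_itv.
  move=> x Ax i; rewrite !mxE -ler_norml.
  by apply: le_trans (hM _ Ax); exact: rV_coord_norm.
by rewrite lebesgue_rV_box ?ltry// => i; rewrite !mxE ge0_cp// addr_ge0.
Qed.

End rV_measure.

(** * Smooth functions and test functions *)

Section directional.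
Context {R : realType}.

Lemma is_derive_cvgP (V : normedModType R) (f : V -> R) (a v : V) (df : R) :
  is_derive a v f df <->
  (fun h : R => h^-1 *: (f (h *: v + a) - f a)) @ 0^' --> df.
Proof.
split=> [[/cvg_ex[l fl] <-]|fl].
  by rewrite /derive (cvg_lim _ fl)//; exact: norm_hausdorff.
apply: DeriveDef; first by apply/cvg_ex; exists df.
by apply: cvg_lim fl; exact: norm_hausdorff.
Qed.

(** Turns directional derivatives into derivatives in one real variable, where the chain rule, the
    mean value theorem and the fundamental theorem of calculus apply. *)
Lemma is_derive_line (V : normedModType R) (f : V -> R) (x v : V) (s df : R) :
  is_derive s 1 (fun h => f (x + h *: v)) df <-> is_derive (x + s *: v) v f df.
Proof.
rewrite !is_derive_cvgP; set q1 := fun h => _; set q2 := fun h => _.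
have -> // : q1 = q2.
apply/funext => h; rewrite /q1 /q2; congr (_ *: (f _ - _)).
by rewrite [_ *: 1]mulr1 scalerDl addrCA.
Qed.

Lemma is_derive_affine (V : normedModType R) (f : V -> R) (x c v : V) (t df : R) :
  is_derive (c + t *: x) v f df ->
  is_derive x v (fun z => f (c + t *: z)) (t * df).
Proof.
move=> h; have := (is_derive_line f (c + t *: x) v 0 df).2.
rewrite scale0r addr0 => /(_ h) {}h.
have := (is_derive_line (fun z => f (c + t *: z)) x v 0 (t * df)).1.
rewrite scale0r addr0; apply.
have := @is_derive1_comp R (fun s => f (c + t *: x + s *: v)) (fun s => t * s) 0 df t.
rewrite mulr0 mulrC (_ : _ \o _ = fun s => f (c + t *: (x + s *: v))).
  apply => //; have := @is_deriveZ _ R R id t 0 1 1 (is_derive_id _ _).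
  by rewrite [_ *: 1]mulr1.
by apply/funext => s /=; rewrite scalerDr scalerA addrA.
Qed.

End directional.

(** * Calculus of smooth functions *)

Section smooth_calculus.
Context {R : realType} {d : nat}.
Local Notation E := 'rV[R]_d.
Local Notation ei i := (delta_mx ord0 i : E).
Implicit Types (u v w : E -> R) (i j : 'I_d).

Lemma smooth_continuous u : smooth u -> continuous u.
Proof. by move=> /(_ [::])[]. Qed.

Lemma smooth_derivable u i x : smooth u -> derivable u x (ei i).
Proof. by move=> /(_ [::])[_]; exact. Qed.

Lemma smooth_is_derive u i x : smooth u -> is_derive x (ei i) u (partial i u x).
Proof. by move=> su; exact/derivableP/smooth_derivable. Qed.

Lemma smooth_partial i u : smooth u -> smooth (partial i u).
Proof. by move=> su s; have := su (rcons s i); rewrite foldr_rcons. Qed.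

Lemma partialE i u (du : E -> R) :
  (forall x, is_derive x (ei i) u (du x)) -> partial i u = du.
Proof. by move=> h; apply/funext => x; rewrite /partial derive_val. Qed.

Inductive lin_span (P : (E -> R) -> Prop) : (E -> R) -> Prop :=
| lin_span0 : lin_span P (fun=> 0)
| lin_spanD c u v : P u -> lin_span P v -> lin_span P (fun x => c * u x + v x).

Lemma lin_span1 (P : (E -> R) -> Prop) u : P u -> lin_span P u.
Proof.
move=> Pu; have := lin_spanD 1 Pu (lin_span0 P).
by congr lin_span; apply/funext => x; rewrite mul1r addr0.
Qed.

Lemma lin_span_add (P : (E -> R) -> Prop) u v :
  lin_span P u -> lin_span P v -> lin_span P (fun x => u x + v x).
Proof.
move=> Su Sv; elim: Su => [|c w z Pw _ ih].
  by move: Sv; congr lin_span; apply/funext => x; rewrite add0r.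
have := lin_spanD c Pw ih.
by congr lin_span; apply/funext => x; rewrite addrA.
Qed.

Lemma lin_span_scale (P : (E -> R) -> Prop) a u :
  lin_span P u -> lin_span P (fun x => a * u x).
Proof.
elim=> [|c w z Pw _ ih].
  have := lin_span0 P.
  by congr lin_span; apply/funext => x; rewrite mulr0.
have := lin_spanD (a * c) Pw ih.
by congr lin_span; apply/funext => x; rewrite mulrDr mulrA.
Qed.

Lemma is_derive_lin (f g : E -> R) (x v : E) (df dg c : R) :
  is_derive x v f df -> is_derive x v g dg ->
  is_derive x v (fun x => c * f x + g x) (c * df + dg).
Proof. by move=> hf hg; exact: (is_deriveD (is_deriveZ c hf) hg). Qed.

(** A coinduction principle: smoothness involves derivatives of every order, but if the first
    derivatives of a class of continuous functions stay in its linear span, then so do all iterated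
    ones. *)
Lemma smooth_coind (P : (E -> R) -> Prop) :
  (forall u, P u -> continuous u) ->
  (forall u i, P u -> exists2 w, lin_span P w &
     forall x, is_derive x (ei i) u (w x)) ->
  forall u, P u -> smooth u.
Proof.
move=> Pc Pd.
have Qc u : lin_span P u -> continuous u.
  elim=> [|c v w Pv _ ih] x; first exact: cst_continuous.
  apply: (@continuousD _ _ _ (fun x => c * v x) w); last exact: ih.
  by apply: continuousM; [exact: cst_continuous|exact: Pc].
have Qd u i : lin_span P u -> exists2 w, lin_span P w & forall x, is_derive x (ei i) u (w x).
  elim=> [|c v w Pv _ [dw Sdw hdw]].
    by exists (fun=> 0) => [|x]; [exact: lin_span0|exact: is_derive_cst].
  have [dv Sdv hdv] := Pd _ i Pv.
  exists (fun x => c * dv x + dw x); last by move=> x; exact: is_derive_lin.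
  by apply: lin_span_add => //; exact: lin_span_scale.
have Qs u s : lin_span P u -> lin_span P (foldr partial u s).
  move=> Qu; elim: s => //= i s ih; have [w Qw hw] := Qd _ i ih.
  by rewrite (partialE hw).
move=> u Pu s; have Qsu := Qs _ s (lin_span1 Pu); split; first exact: Qc.
by move=> i x; have [w _ hw] := Qd _ i Qsu; exact: (@ex_derive _ _ _ _ _ _ _ (hw x)).
Qed.

Lemma smooth_cst (c : R) : smooth (fun _ : E => c).
Proof.
apply: (@smooth_coind (fun u : E -> R => exists c : R, u = fun=> c)); last by exists c.
- by move=> _ [a ->] x; exact: cst_continuous.
- move=> _ i [a ->]; exists (fun=> 0); first exact: lin_span0.
  by move=> x; exact: is_derive_cst.
Qed.

Lemma smooth_lin c u v : smooth u -> smooth v -> smooth (fun x => c * u x + v x).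
Proof.
move=> su sv; apply: (@smooth_coind (fun w => exists c u v,
  [/\ smooth u, smooth v & w = fun x => c * u x + v x])); last by exists c, u, v.
- move=> _ [a [f [g [sf sg ->]]]] x.
  apply: (@continuousD _ _ _ (fun x => a * f x) g); last exact: smooth_continuous.
  by apply: continuousM; [exact: cst_continuous|exact: smooth_continuous].
- move=> _ i [a [f [g [sf sg ->]]]].
  exists (fun x => a * partial i f x + partial i g x).
    apply: lin_span1; exists a, (partial i f), (partial i g).
    exact: And3 (smooth_partial i sf) (smooth_partial i sg) erefl.
  by move=> x; apply: is_derive_lin; exact: smooth_is_derive.
Qed.

Lemma smoothD u v : smooth u -> smooth v -> smooth (fun x => u x + v x).
Proof.
move=> su sv; have := smooth_lin 1 su sv.
by congr smooth; apply/funext => x; rewrite mul1r.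
Qed.

Lemma smoothZ c u : smooth u -> smooth (fun x => c * u x).
Proof.
move=> su; have := smooth_lin c su (smooth_cst 0).
by congr smooth; apply/funext => x; rewrite addr0.
Qed.

Lemma smoothB u v : smooth u -> smooth v -> smooth (fun x => u x - v x).
Proof.
move=> su sv; have := smooth_lin (-1) sv su.
by congr smooth; apply/funext => x; rewrite mulN1r addrC.
Qed.

Lemma partialM i u v : smooth u -> smooth v ->
  partial i (fun x => u x * v x) = fun x => partial i u x * v x + u x * partial i v x.
Proof.
move=> su sv; apply: partialE => x.
have := is_deriveM (smooth_is_derive i x su) (smooth_is_derive i x sv).
by move/is_derive_eq; apply; rewrite addrC mulrC.
Qed.

Lemma smoothM u v : smooth u -> smooth v -> smooth (fun x => u x * v x).
Proof.
move=> su sv; apply: (@smooth_coind (fun w => exists u v,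
  [/\ smooth u, smooth v & w = fun x => u x * v x])); last by exists u, v.
- move=> _ [f [g [sf sg ->]]] x.
  by apply: continuousM; exact: smooth_continuous.
- move=> _ i [f [g [sf sg ->]]].
  exists (partial i (fun x => f x * g x)).
    rewrite partialM//; apply: lin_span_add; apply: lin_span1.
    + by exists (partial i f), g; exact: And3 (smooth_partial i sf) sg erefl.
    + by exists f, (partial i g); exact: And3 sf (smooth_partial i sg) erefl.
  move=> x; apply: derivableP; apply: (derivableM (f := f) (g := g));
    exact: smooth_derivable.
Qed.

Lemma is_derive_coord i j x :
  is_derive x (ei j) (fun x : E => x ord0 i) (i == j)%:R.
Proof.
apply/is_derive_cvgP; apply: cvg_near_cst; near=> h.
have h0 : h != 0 by near: h; exact: nbhs_dnbhs_neq.
by rewrite !mxE addrK eqxx/= /GRing.scale/= mulrA mulVf// mul1r.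
Unshelve. all: by end_near. Qed.

Lemma smooth_coord i : smooth (fun x : E => x ord0 i).
Proof.
apply: (@smooth_coind (fun u => u = (fun x : E => x ord0 i) \/ exists c, u = fun=> c)).
- by move=> _ [->|[c ->]]; [exact: coord_continuous|move=> x; exact: cst_continuous].
- move=> _ j [->|[c ->]].
    exists (fun=> (i == j)%:R); last exact: is_derive_coord.
    by apply: lin_span1; right; exists (i == j)%:R.
  by exists (fun=> 0) => [|x]; [exact: lin_span0|exact: is_derive_cst].
- by left.
Qed.

Lemma partial_coord i j : partial j (fun x : E => x ord0 i) = fun=> (i == j)%:R.
Proof. by apply: partialE => x; exact: is_derive_coord. Qed.

Lemma continuous_affine u (c : E) (t : R) : continuous u ->
  continuous (fun x : E => u (c + t *: x)).
Proof.
move=> cu x; apply: (@continuous_comp _ _ _ (fun x : E => c + t *: x) u); last exact: cu.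
apply: (@continuousD _ _ _ (fun _ : E => c) (fun x : E => t *: x)); first exact: cst_continuous.
exact: scaler_continuous.
Qed.

Lemma partial_affine i u (c : E) (t : R) : smooth u ->
  partial i (fun x : E => u (c + t *: x)) = fun x : E => t * partial i u (c + t *: x).
Proof.
by move=> su; apply: partialE => x; apply: is_derive_affine; exact: smooth_is_derive.
Qed.

Lemma smooth_affine u (c : E) (t : R) : smooth u -> smooth (fun x : E => u (c + t *: x)).
Proof.
move=> su; apply: (@smooth_coind (fun w => exists2 u, smooth u &
  w = fun x : E => u (c + t *: x))); last by exists u.
- by move=> _ [f sf ->]; apply: continuous_affine; exact: smooth_continuous.
- move=> _ i [f sf ->]; exists (fun x : E => t * partial i f (c + t *: x)).
    apply: lin_span_scale; apply: lin_span1.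
    by exists (partial i f); first exact: smooth_partial.
  by move=> x; apply: is_derive_affine; exact: smooth_is_derive.
Qed.

End smooth_calculus.

(** * A function that is flat at the origin *)

Section flat_function.
Context {R : realType}.

(* The span of these functions is closed under differentiation. *)
Definition flat n (s : R) : R := if 0 < s then s^-1 ^+ n * expR (- s^-1) else 0.

Lemma flat_le0 n (s : R) : s <= 0 -> flat n s = 0.
Proof. by rewrite /flat leNgt => /negbTE ->. Qed.

Lemma flat_gt0E n (s : R) : 0 < s -> flat n s = s^-1 ^+ n * expR (- s^-1).
Proof. by rewrite /flat => ->. Qed.

Lemma flat_ge0 n s : 0 <= flat n s.
Proof.
rewrite /flat; case: ifPn => // s0.
by rewrite mulr_ge0 ?expR_ge0// exprn_ge0// invr_ge0 ltW.
Qed.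

(** With y = 1/s this is the exponential bound y^(n+2) / (n+2)! <= exp y. A quadratic bound is what
    makes the difference quotient at the origin tend to zero. *)
Lemma flat_le_sqr n s : flat n s <= (n.+2)`!%:R * s ^+ 2.
Proof.
have F0 : 0 < (n.+2)`!%:R :> R by rewrite ltr0n fact_gt0.
rewrite /flat; case: ifPn => s0; last by rewrite mulr_ge0 ?sqr_ge0// ltW.
have y0 : 0 < s^-1 by rewrite invr_gt0.
have := expR_ge1Dxn n.+1 (ltW y0); set y := s^-1 in y0 * => h.
have -> : s = y^-1 by rewrite /y invrK.
rewrite expRN -(ler_pM2r (expR_gt0 y)) -mulrA mulVf ?gt_eqF ?expR_gt0// mulr1.
have {}h : y ^+ n.+2 / (n.+2)`!%:R <= expR y by apply: le_trans h; rewrite lerDr.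
move: h; rewrite ler_pdivrMr// => h.
rewrite -(ler_pM2r (exprn_gt0 2 y0)) -exprD addn2 (le_trans h)//.
apply: le_of_eq; field.
by rewrite gt_eqF.
Qed.

Lemma is_derive_inv (s : R) : s != 0 -> is_derive s 1 (fun y => y^-1) (- s^-1 ^+ 2).
Proof.
move=> s0; apply: DeriveDef; first exact: (@derivableV _ _ id).
by rewrite (@deriveV _ _ id)// derive_id [_ *: _]mulr1 exprVn.
Qed.

Lemma is_derive_flat n (s : R) :
  is_derive s 1 (flat n) (- n%:R * flat n.+1 s + flat n.+2 s).
Proof.
have [s0|s0|->] := ltgtP s 0.
- rewrite !flat_le0 ?(ltW s0)// mulr0 addr0.
  apply: (@near_eq_is_derive _ _ _ (fun=> 0)).
  near=> t; rewrite flat_le0//; apply: ltW; near: t; exact: lt_nbhsl.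
- rewrite !(flat_gt0E _ s0).
  apply: (@near_eq_is_derive _ _ _ ((fun y => y ^+ n * expR (- y)) \o (fun y => y^-1))).
    by near=> t; rewrite flat_gt0E//; near: t; exact: lt_nbhsr.
  set y := s^-1.
  have dN : is_derive y 1 (fun y => expR (- y)) (expR (- y) * -1).
    exact: (is_derive1_comp (is_derive_expR (- y)) (is_deriveNid y 1)).
  have dX : is_derive y 1 (fun y : R => y ^+ n) (n%:R *: y ^+ n.-1 *: 1).
    by apply: DeriveDef; [exact: exprn_derivable|exact: exp_derive].
  have := is_derive1_comp (g := fun y : R => y^-1) (is_deriveM dX dN)
    (is_derive_inv (lt0r_neq0 s0)).
  move/is_derive_eq; apply; rewrite -/y /GRing.scale/= !mulr1.
  case: n {dX} => [|n]; first by rewrite !expr0 !exprS expr0; ring.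
  by rewrite /= !exprS; ring.
- apply/is_derive_cvgP; rewrite !(@flat_le0 _ 0)// mulr0 addr0.
  apply/cvgr0Pnorm_lt => e e0.
  pose C : R := (n.+2)`!%:R + 1.
  have C0 : 0 < C by rewrite ltr_wpDl.
  near=> h.
  have h0 : h != 0 by near: h; exact: nbhs_dnbhs_neq.
  rewrite subr0 [_ *: 1]mulr1 addr0 normrZ normfV (ger0_norm (flat_ge0 _ _)).
  rewrite mulrC ltr_pdivrMr ?normr_gt0// (le_lt_trans (flat_le_sqr _ _))//.
  rewrite -(real_normK (num_real h)) expr2 mulrA ltr_pM2r ?normr_gt0//.
  apply: (@le_lt_trans _ _ (C * `|h|)); first by rewrite ler_wpM2r// lerDl.
  rewrite mulrC -ltr_pdivlMr//; near: h; apply: dnbhs0_lt; exact: divr_gt0.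
Unshelve. all: by end_near. Qed.

Lemma continuous_flat n : continuous (flat n : R -> R).
Proof.
move=> s; apply/differentiable_continuous; apply: (derivable1_diffP _ _).1.
exact: (@ex_derive _ _ _ _ _ _ _ (is_derive_flat n s)).
Qed.

Lemma flat0_gt0 s : 0 < s -> 0 < flat 0 s.
Proof. by move=> s0; rewrite /flat s0 expr0 mul1r expR_gt0. Qed.

Lemma flat0_le1 s : flat 0 s <= 1.
Proof.
rewrite /flat; case: ifPn => // s0.
by rewrite expr0 mul1r expR_le1 oppr_le0 invr_ge0 ltW.
Qed.

Lemma flat0_cvg1 s : 0 < s -> flat 0 (k.+1%:R * s) @[k --> \oo] --> (1 : R).
Proof.
move=> s0.
have -> : (fun k : nat => flat 0 (k.+1%:R * s)) = (fun k => expR (- (s^-1 * k.+1%:R^-1))).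
  apply/funext => k; rewrite /flat mulr_gt0// expr0 mul1r; congr (expR (- _)).
  by rewrite invfM mulrC.
have E1 : 1 = expR (- (s^-1 * 0)) by rewrite mulr0 oppr0 expR0.
rewrite [X in _ --> X]E1.
apply: cvg_comp; last exact: continuous_expR.
by apply: cvgN; apply: cvgM; [exact: cvg_cst|exact: cvg_harmonic].
Qed.

End flat_function.

(** * Test functions and the lemma of du Bois-Reymond *)

Section test_functions.
Context {R : realType} {d : nat}.
Local Notation E := 'rV[R]_d.
Local Notation ei i := (delta_mx ord0 i : E).
Implicit Types (u v w : E -> R) (i j : 'I_d).

Lemma smooth_flat n i (a b : R) : smooth (fun x : E => flat n (a * x ord0 i + b)).
Proof.
apply: (@smooth_coind _ _ (fun u => exists n, u = fun x : E => flat n (a * x ord0 i + b)));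
  last by exists n.
- move=> _ [m ->] x.
  apply: (@continuous_comp _ _ _ (fun x : E => a * x ord0 i + b) (flat m));
    last exact: continuous_flat.
  apply: (@continuousD _ _ _ (fun x : E => a * x ord0 i) (fun=> b));
    last exact: cst_continuous.
  by apply: continuousM; [exact: cst_continuous|exact: coord_continuous].
- move=> _ j [m ->].
  pose dl : R := a * (i == j)%:R.
  exists (fun x : E => dl * (- m%:R * flat m.+1 (a * x ord0 i + b)
                             + flat m.+2 (a * x ord0 i + b))).
    apply: lin_span_scale; apply: lin_spanD; first by exists m.+1.
    by apply: lin_span1; exists m.+2.
  move=> x; have := (is_derive_line (fun x : E => flat m (a * x ord0 i + b)) x (ei j) 0
    (dl * (- m%:R * flat m.+1 (a * x ord0 i + b) + flat m.+2 (a * x ord0 i + b)))).1.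
  rewrite scale0r addr0; apply; rewrite mulrC.
  apply: (@is_derive1_comp _ (flat m) (fun h : R => a * (x + h *: ei j) ord0 i + b)).
    by rewrite scale0r addr0; exact: is_derive_flat.
  have -> : (fun h : R => a * (x + h *: ei j) ord0 i + b) =
        (fun h => dl * h + (a * x ord0 i + b)).
    by apply/funext => h; rewrite !mxE eqxx/= /dl; ring.
    have := is_deriveD (is_deriveZ dl (is_derive_id (0 : R) 1))
      (is_derive_cst (a * x ord0 i + b) (0 : R) 1).
  by move/is_derive_eq; apply; rewrite [_ *: 1]mulr1 addr0.
Qed.

Lemma smooth_prod (I : Type) (s : seq I) (F : I -> E -> R) :
  (forall k, smooth (F k)) -> smooth (fun x => \prod_(k <- s) F k x).
Proof.
move=> sF; elim: s => [|k s ih].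
  by under eq_fun do rewrite big_nil; exact: smooth_cst.
by under eq_fun do rewrite big_cons; exact: (smoothM (sF k) ih).
Qed.

Lemma norm_delta_rV i : `|ei i| <= 1 :> R.
Proof.
rewrite [leLHS]/Num.norm/= mx_normrE; apply/bigmax_leP; split=> // -[k j] _ /=.
by rewrite mxE; case: (_ && _); rewrite ?normr1 ?normr0.
Qed.

Lemma smooth_MVT u i x (t : R) : smooth u -> 0 < t ->
  exists2 c, 0 < c < t & u (x + t *: ei i) - u x = t * partial i u (x + c *: ei i).
Proof.
move=> su t0.
have df (h : R) : is_derive h 1 (fun h : R => u (x + h *: ei i)) (partial i u (x + h *: ei i)).
  by apply/is_derive_line; exact: smooth_is_derive.
have [|c] := @MVT _ (fun h : R => u (x + h *: ei i))
    (fun h => partial i u (x + h *: ei i)) 0 t t0 (fun h _ => df h).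
  apply: continuous_subspaceT => h; apply/differentiable_continuous.
  apply: (derivable1_diffP _ _).1; exact: (@ex_derive _ _ _ _ _ _ _ (df h)).
by rewrite in_itv/= scale0r addr0 subr0 mulrC => ct e; exists c.
Qed.

(** Two uses of the mean value theorem: in direction [i] for the increment of [u] along direction
    [j], then in direction [j] for [partial i u]. The left-hand side is symmetric in [i] and [j]
    whereas the right-hand side is not yet known to be. *)
Lemma double_difference u i j x (t : R) : smooth u -> 0 < t ->
  exists2 y, `|y - x| <= 2 * t &
  u (x + t *: ei i + t *: ei j) - u (x + t *: ei i) - u (x + t *: ei j) + u x =
  t ^+ 2 * partial j (partial i u) y.
Proof.
move=> su t0.
have s1 : smooth (fun z => u (t *: ei j + 1 *: z)) by exact: smooth_affine.
have sg := smoothB s1 su.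
have [c1 /andP[c10 c1t] e1] := smooth_MVT i x sg t0.
have [c2 /andP[c20 c2t] e2] := smooth_MVT j (x + c1 *: ei i) (smooth_partial i su) t0.
exists (x + c1 *: ei i + c2 *: ei j).
  rewrite -[_ + c1 *: _ + _]addrA addrAC subrr add0r.
  apply: le_trans (ler_normD _ _) _.
  rewrite !normrZ (gtr0_norm c10) (gtr0_norm c20) mulr_natl mulr2n.
  apply: lerD; rewrite -[leRHS]mulr1; apply: ler_pM; rewrite ?norm_delta_rV//; exact: ltW.
have pE : partial i (fun z => u (t *: ei j + 1 *: z) - u z) =
    fun z => partial i u (t *: ei j + 1 *: z) - partial i u z.
  apply: partialE => z; apply: is_deriveB; last exact: smooth_is_derive.
  by rewrite -[partial i u _]mul1r; apply: is_derive_affine; exact: smooth_is_derive.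
have e1' : u (x + t *: ei i + t *: ei j) - u (x + t *: ei i) -
    (u (x + t *: ei j) - u x) =
    t * (partial i u (x + c1 *: ei i + t *: ei j) - partial i u (x + c1 *: ei i)).
  by move: e1; rewrite pE !scale1r !(addrC (t *: ei j)).
by rewrite expr2 -mulrA -e2 -e1'; ring.
Qed.

(** The limiting step of Schwarz's theorem: [f] and [g] stand for the two mixed derivatives, both of
    which take the value [D t / t ^+ 2] at points that tend to [x]. *)
Lemma eq_second_order_limit (f g : E -> R) (x : E) (D : R -> R) :
  continuous f -> continuous g ->
  (forall t, 0 < t -> exists2 y, `|y - x| <= 2 * t & D t = t ^+ 2 * f y) ->
  (forall t, 0 < t -> exists2 y, `|y - x| <= 2 * t & D t = t ^+ 2 * g y) ->
  f x = g x.
Proof.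
move=> cf cg Df Dg; apply/eqP; rewrite -subr_eq0 -normr_le0.
apply/ler_addgt0Pl => e e0; rewrite addr0.
have e2 : 0 < e / 2 by rewrite divr_gt0.
have /cvgr_dist_lt /(_ _ e2) /nbhs_ballP[r1 /= r10 h1] := cf x.
have /cvgr_dist_lt /(_ _ e2) /nbhs_ballP[r2 /= r20 h2] := cg x.
set m := Num.min r1 r2.
have m0 : 0 < m by rewrite lt_min r10.
pose t := m / 3.
have t0 : 0 < t by rewrite divr_gt0.
have tr y : `|y - x| <= 2 * t -> `|x - y| < m.
  by rewrite distrC => /le_lt_trans; apply; rewrite /t; lra.
have [y1 /tr + e1] := Df t t0; have [y2 /tr + e1'] := Dg t t0.
rewrite !lt_min => /andP[_ d2] /andP[d1 _].
have E12 : f y1 = g y2.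
  have t2 : t ^+ 2 != 0 by rewrite expf_neq0// gt_eqF.
  by apply: (mulfI t2); rewrite -e1 -e1'.
have := h1 y1; rewrite -ball_normE /= => /(_ d1) {}h1.
have := h2 y2; rewrite -ball_normE /= => /(_ d2) {}h2.
apply: le_trans (ler_distD (f y1) _ _) _.
by rewrite (splitr e) lerD//; [exact: ltW|rewrite E12 distrC; exact: ltW].
Qed.

Lemma partialC i j u : smooth u -> partial i (partial j u) = partial j (partial i u).
Proof.
move=> su; apply/funext => x.
apply: (@eq_second_order_limit _ _ x (fun t =>
  u (x + t *: ei i + t *: ei j) - u (x + t *: ei i) - u (x + t *: ei j) + u x)).
- exact: smooth_continuous (smooth_partial i (smooth_partial j su)).
- exact: smooth_continuous (smooth_partial j (smooth_partial i su)).
- move=> t t0; have [y yx e] := double_difference j i x su t0.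
  exists y; first exact: yx.
  rewrite -e (addrAC x); congr (_ + _); exact: addrAC.
- by move=> t t0; exact: double_difference.
Qed.

Local Notation leb := (@lebesgue_rV R d).
Implicit Types (phi : E -> R) (Om K : set E).

Lemma test_smooth Om phi : test_function Om phi -> smooth phi.
Proof. by case. Qed.

(** Any compact subset of [Om] outside which [phi] vanishes can replace the closed support; such a
    set is what sums, products and derivatives readily provide. *)
Lemma test_functionP Om phi : test_function Om phi <->
  smooth phi /\ exists K, [/\ compact K, K `<=` Om & forall x, ~ K x -> phi x = 0].
Proof.
split=> [[sphi [cK KOm]]|[sphi [K [cK KOm K0]]]].
  split=> //; exists (closure [set x | phi x != 0]); split=> // x Kx.
  apply/eqP; apply: contrapT => /negP x0; apply: Kx; exact: subset_closure.
have cl : closure [set x | phi x != 0] `<=` K.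
  have /closure_id -> : closed K by apply: compact_closed => //; exact: norm_hausdorff.
  by apply: closureS => x /= x0; apply: contrapT => /K0 /eqP; rewrite (negbTE x0).
split=> //; split; last exact: subset_trans cl KOm.
by apply: (subclosed_compact _ cK) => //; exact: closed_closure.
Qed.

Lemma test_function_supp Om phi K : smooth phi -> compact K -> K `<=` Om ->
  (forall x, ~ K x -> phi x = 0) -> test_function Om phi.
Proof. by move=> sphi cK KOm K0; apply/test_functionP; split=> //; exists K. Qed.

Lemma test_partial Om i phi : test_function Om phi -> test_function Om (partial i phi).
Proof.
move=> [sphi [cK KOm]]; apply: (test_function_supp (smooth_partial i sphi) cK KOm) => x Kx.
rewrite /partial (@near_eq_derive _ _ _ _ (fun=> 0)); first exact: derive_cst.
have : nbhs x (~` closure [set x | phi x != 0]).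
  by apply: open_nbhs_nbhs; split=> //; apply: closed_openC; exact: closed_closure.
apply: filterS => y Ky; apply/eqP; apply: contrapT => /negP y0.
by apply: Ky; exact: subset_closure.
Qed.

Lemma test_mul Om phi u : test_function Om phi -> smooth u ->
  test_function Om (fun x => phi x * u x).
Proof.
move=> /test_functionP[sphi [K [cK KOm K0]]] su.
apply: (test_function_supp (smoothM sphi su) cK KOm) => x /K0 ->; exact: mul0r.
Qed.

Lemma testZ Om c phi : test_function Om phi -> test_function Om (fun x => c * phi x).
Proof.
move=> /test_functionP[sphi [K [cK KOm K0]]].
apply: (test_function_supp (smoothZ c sphi) cK KOm) => x /K0 ->; exact: mulr0.
Qed.

Lemma testD Om phi psi : test_function Om phi -> test_function Om psi ->
  test_function Om (fun x => phi x + psi x).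
Proof.
move=> /test_functionP[sphi [K [cK KOm K0]]] /test_functionP[spsi [L [cL LOm L0]]].
apply: (test_function_supp (K := K `|` L) (smoothD sphi spsi)).
- exact: compactU.
- by move=> x []; [exact: KOm|exact: LOm].
- by move=> x /not_orP[Kx Lx]; rewrite K0// L0// addr0.
Qed.

Lemma test0 Om : test_function Om (fun=> 0).
Proof.
apply: (test_function_supp (K := set0) (smooth_cst 0)) => //; exact: compact0.
Qed.

Lemma test_setT Om phi : test_function Om phi -> test_function setT phi.
Proof.
by move=> /test_functionP[sphi [K [cK _ K0]]]; exact: (test_function_supp sphi cK).
Qed.

Lemma test_setTP phi (M : R) : smooth phi -> (forall x, M < `|x| -> phi x = 0) ->
  test_function setT phi.
Proof.
move=> sphi M0; apply: (test_function_supp (K := [set x | `|x| <= M]) sphi) => //.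
- apply: bounded_closed_compact.
    by exists M; split; [exact: num_real|move=> r Mr x /= xM; exact: le_trans xM (ltW Mr)].
  rewrite (_ : mkset _ = (fun x : E => `|x|) @^-1` [set y | y <= M])//.
  apply: preimage_closed; last exact: closed_le.
  by move=> x _; exact: norm_continuous.
- by move=> x /negP; rewrite -ltNge; exact: M0.
Qed.

Lemma test_bounds Om phi : test_function Om phi -> exists B M : R,
  [/\ 0 <= B, 0 <= M, forall x, `|phi x| <= B & forall x, M < `|x| -> phi x = 0].
Proof.
move=> /test_functionP[sphi [K [cK _ K0]]].
have /compact_bounded[B [_ hB]] : compact (phi @` K).
  apply: continuous_compact => //; apply: continuous_subspaceT.
  exact: smooth_continuous.
have /compact_bounded[M [_ hM]] := cK.
exists (`|B| + 1), (`|M| + 1); split; [by rewrite addr_ge0..| |].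
- move=> x; have [Kx|/K0 ->] := pselect (K x); last by rewrite normr0 addr_ge0.
  by apply: (hB (`|B| + 1)); [rewrite ltr_pwDr// ler_norm|exists x].
- move=> x Mx; apply: K0 => Kx; move: Mx; apply/negP; rewrite -leNgt.
  by apply: hM => //; rewrite ltr_pwDr// ler_norm.
Qed.

Lemma measurable_norm_ball (M : R) : measurable [set x : E | `|x| <= M].
Proof.
rewrite -[X in measurable X]setTI.
apply: (measurable_fun_le (f := fun x : E => `|x|) (g := fun=> M)) => //.
by apply: continuous_measurable_rV; exact: norm_continuous.
Qed.

Lemma lebesgue_norm_ball (M : R) : (leb [set x : E | (`|x| <= M)%R] < +oo)%E.
Proof.
apply: lebesgue_rV_bounded; first exact: measurable_norm_ball.
by exists M; split; [exact: num_real|move=> r Mr x /= xM; exact: le_trans xM (ltW Mr)].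
Qed.

Lemma integrable_bounded_supp (f : E -> R) (B M : R) : measurable_fun setT f ->
  (forall x, `|f x| <= B) -> (forall x, M < `|x| -> f x = 0) ->
  leb.-integrable setT (EFin \o f).
Proof.
move=> mf fB f0; pose A : set E := [set x | `|x| <= M].
have mA : measurable A by exact: measurable_norm_ball.
have Aoo : (leb A < +oo)%E by exact: lebesgue_norm_ball.
have -> : EFin \o f = (EFin \o f) \_ A.
  apply/funext => x; rewrite patchE; case: ifPn => // /negP xA /=.
  by rewrite f0// ltNge; apply/negP => h; apply: xA; rewrite inE.
apply/(integrable_mkcond _ mA)/measurable_bounded_integrable => //.
  exact: measurable_funTS.
by exists B; split; [exact: num_real|move=> r Br x _ /=; exact: le_trans (fB x) (ltW Br)].
Qed.

Lemma test_measurable Om phi D : test_function Om phi -> measurable_fun D phi.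
Proof.
move=> [sphi _]; apply: measurable_funTS; apply: continuous_measurable_rV.
exact: smooth_continuous.
Qed.

Lemma test_integrable Om phi : test_function Om phi -> leb.-integrable setT (EFin \o phi).
Proof.
move=> tphi; have [B [M [_ _ hB hM]]] := test_bounds tphi.
by apply: integrable_bounded_supp hB hM; exact: test_measurable tphi.
Qed.

Lemma Rintegral_supp Om (f : E -> R) : (forall x, ~ Om x -> f x = 0) ->
  \int[leb]_(x in Om) f x = \int[leb]_x f x.
Proof.
move=> f0; rewrite Rintegral_mkcond; apply: eq_Rintegral => x _.
rewrite patchE; case: ifPn => // /negP xOm; rewrite f0// => h; apply: xOm.
by rewrite inE.
Qed.

Lemma test_affine phi (c : E) (t : R) : 0 < t -> test_function setT phi ->
  test_function setT (fun x => phi (c + t *: x)).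
Proof.
move=> t0 tphi; have [_ [M [_ M0 _ hM]]] := test_bounds tphi.
apply: (@test_setTP _ ((M + `|c|) / t) (smooth_affine c t (test_smooth tphi))) => x.
rewrite ltr_pdivrMr// => Mx; apply: hM; rewrite addrC.
apply: lt_le_trans (lerB_normD _ _).
by rewrite ltrBrDr normrZ gtr0_norm// mulrC.
Qed.

Lemma test_translate phi (c : E) : test_function setT phi ->
  test_function setT (fun x => phi (x + c)).
Proof.
move=> /(test_affine c ltr01); congr test_function.
by apply/funext => x; rewrite scale1r addrC.
Qed.

(** Domination for difference quotients: the mean value theorem bounds them by the supremum of the
    derivative, and a step of length at most 1 enlarges the radius of the support by at most 1. *)
Lemma test_diff_quot i phi : test_function setT phi -> exists B M : R,
  forall t x, 0 < t <= 1 ->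
    `|t^-1 * (phi (x + t *: ei i) - phi x)| <= B /\
    (M < `|x| -> t^-1 * (phi (x + t *: ei i) - phi x) = 0).
Proof.
move=> tphi; have [_ [M [_ M0 _ hM]]] := test_bounds tphi.
have [B [_ [B0 _ hB _]]] := test_bounds (test_partial i tphi).
exists B, (M + 1) => t x /andP[t0 t1]; split.
  have [c _ ->] := smooth_MVT i x (test_smooth tphi) t0.
  by rewrite mulrA mulVf ?gt_eqF// mul1r.
move=> Mx; have Mx1 : M < `|x| by apply: lt_trans Mx; rewrite ltrDl.
rewrite (hM x Mx1) hM ?subrr ?mulr0//; apply: lt_le_trans (lerB_normD _ _).
rewrite ltrBrDr (le_lt_trans _ Mx)// lerD2l normrZ gtr0_norm//.
by rewrite -[leRHS]mulr1 ler_pM ?norm_delta_rV// ltW.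
Qed.

Lemma cvg_harmonic_dnbhs : (fun k => k.+1%:R^-1 : R) @ \oo --> 0^'.
Proof.
move=> A /= hA; have [N _ hN] := @cvg_harmonic R _ hA; exists N => // k /hN /= h; apply: h.
by rewrite invr_eq0 pnatr_eq0.
Qed.

Lemma smooth_diff_quot_cvg i u x : smooth u ->
  k.+1%:R^-1^-1 * (u (x + k.+1%:R^-1 *: ei i) - u x) @[k --> \oo] --> partial i u x.
Proof.
move=> su; have /is_derive_cvgP H := smooth_is_derive i x su.
rewrite (_ : (fun k => _) = (fun h => h^-1 *: (u (h *: ei i + x) - u x)) \o
    (fun k => k.+1%:R^-1)).
  exact: cvg_comp cvg_harmonic_dnbhs H.
by apply/funext => k /=; rewrite [x + _]addrC.
Qed.

Lemma bounded_convergence (f_ : nat -> E -> R) (f : E -> R) (B M : R) :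
  (forall k, measurable_fun setT (f_ k)) -> measurable_fun setT f ->
  (forall x, f_ ^~ x @ \oo --> f x) ->
  (forall k x, `|f_ k x| <= B) -> (forall k x, M < `|x| -> f_ k x = 0) ->
  \int[leb]_x f_ k x @[k --> \oo] --> \int[leb]_x f x.
Proof.
move=> mf_ mf cf hB hM.
pose g (x : E) : R := if `|x| <= M then B else 0.
have g0 k x : `|f_ k x| <= g x.
  by rewrite /g; case: (leP `|x| M) => [_|h]; [exact: hB|rewrite hM// normr0].
have mg : measurable_fun setT g.
  apply: measurable_fun_if => //; [|exact: measurable_cst..].
  apply: measurable_fun_ler => //.
  by apply: continuous_measurable_rV; exact: norm_continuous.
have ig : leb.-integrable setT (EFin \o g).
  apply: (@integrable_bounded_supp g `|B| M mg).
    by move=> x; rewrite /g; case: ifP; rewrite ?normr0.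
  by move=> x; rewrite /g ltNge => /negbTE ->.
have [//|//||//| |intf _ h] := @dominated_convergence _ _ _ leb setT measurableT
    (fun k x => (f_ k x)%:E) (EFin \o f) (EFin \o g).
- by move=> k; apply/measurable_EFinP.
- exact/measurable_EFinP.
- by apply: aeW => x _; apply: cvg_EFin; [exact: nearW|exact: cf].
- by apply: aeW => x k _; rewrite lee_fin.
by move: h; rewrite -(fineK (integrable_fin_num measurableT intf)) => /fine_cvg.
Qed.

(** Translation invariance makes every difference quotient integrate to zero, and bounded
    convergence passes this on to the derivative. All integration by parts rests on it. *)
Lemma integral_partial0 i phi : test_function setT phi -> \int[leb]_x partial i phi x = 0.
Proof.
move=> tphi; have sphi := test_smooth tphi.
have mphi : measurable_fun setT phi := test_measurable tphi.
have iphi := test_integrable tphi.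
have [B [M hBM]] := test_diff_quot i tphi.
have k01 k : 0 < (k.+1%:R^-1 : R) <= 1.
  by rewrite invr_gt0 ltr0n/= invf_le1 ?ltr0n// ler1n.
pose q k x := k.+1%:R^-1^-1 * (phi (x + k.+1%:R^-1 *: ei i) - phi x).
have mphik k : measurable_fun setT (fun x : E => phi (x + k.+1%:R^-1 *: ei i)).
  by apply: measurableT_comp => //; exact: measurable_rV_addr.
have mq k : measurable_fun setT (q k).
  by apply: measurable_funM; [exact: measurable_cst|exact: measurable_funB].
have H := @bounded_convergence q (partial i phi) B M mq (test_measurable (test_partial i tphi))
  (fun x => @smooth_diff_quot_cvg i _ x sphi) (fun k (x : E) => (@hBM _ x (k01 k)).1)
  (fun k (x : E) => (@hBM _ x (k01 k)).2).
have q0 k : \int[leb]_x q k x = 0.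
  have ik : leb.-integrable setT (EFin \o (fun x : E => phi (x + k.+1%:R^-1 *: ei i))).
    exact: test_integrable (test_translate _ tphi).
  rewrite RintegralZl//; last exact: (integrableB measurableT ik iphi).
  rewrite RintegralB// [X in X - _](_ : _ = \int[leb]_x phi x) ?subrr ?mulr0//.
  congr fine; apply: (integral_rV_translate (k.+1%:R^-1 *: ei i) (f := EFin \o phi)).
  exact/measurable_EFinP.
have E0 : (fun k => \int[leb]_x q k x) = (fun=> 0) by apply/funext.
rewrite E0 in H; apply: esym; apply: (cvg_unique _ _ H) => //.
exact: cvg_cst.
Qed.

Implicit Types (a b x : E) (g : E -> R).

Definition obox a b : set E := [set x | forall i, a ord0 i < x ord0 i < b ord0 i].
Definition cbox a b : set E := [set x | forall i, a ord0 i <= x ord0 i <= b ord0 i].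

Lemma sub_obox_cbox a b : obox a b `<=` cbox a b.
Proof. by move=> x h i; have /andP[/ltW -> /ltW ->] := h i. Qed.

Lemma compact_cbox a b : compact (cbox a b).
Proof.
have -> : cbox a b = [set x | forall i, `[a ord0 i, b ord0 i]%classic (x ord0 i)].
  by apply/seteqP; split => x h i; have := h i; rewrite /= in_itv.
apply: (@rV_compact R d (fun i => `[a ord0 i, b ord0 i]%classic)) => i.
exact: segment_compact.
Qed.

Lemma measurable_cbox a b : measurable (cbox a b).
Proof.
apply: (measurable_rV_box (P := fun i => [set t | a ord0 i <= t <= b ord0 i])) => i.
rewrite (_ : mkset _ = `[a ord0 i, b ord0 i]%classic)//.
Qed.

Lemma measurable_obox a b : measurable (obox a b).
Proof.
apply: (measurable_rV_box (P := fun i => [set t | a ord0 i < t < b ord0 i])) => i.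
rewrite (_ : mkset _ = `]a ord0 i, b ord0 i[%classic)//.
Qed.

(** A smooth approximation of the indicator of [obox a b]: the factors exp(-1/s) are steepened by
    [k.+1] and tend to 1 inside. The arguments are written as affine functions of a coordinate to
    fit [smooth_flat]. *)
Definition box_bump a b (k : nat) x : R := \prod_i
  (flat 0 (k.+1%:R * x ord0 i + - (k.+1%:R * a ord0 i)) *
   flat 0 (- k.+1%:R * x ord0 i + k.+1%:R * b ord0 i)).

Lemma smooth_bump a b k : smooth (box_bump a b k).
Proof. by apply: smooth_prod => i; apply: smoothM; exact: smooth_flat. Qed.

Lemma bump_itv a b k x : 0 <= box_bump a b k x <= 1.
Proof.
rewrite /box_bump; elim/big_ind : _ => [|u v /andP[u0 u1] /andP[v0 v1]|i _].
- by rewrite ler01 lexx.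
- by rewrite mulr_ge0//= -[leRHS]mulr1 ler_pM.
- by rewrite mulr_ge0 ?flat_ge0//= -[leRHS]mulr1 ler_pM ?flat_ge0 ?flat0_le1.
Qed.

Lemma bump_eq0 a b k x : ~ obox a b x -> box_bump a b k x = 0.
Proof.
move=> /existsNP[i /negP]; rewrite negb_and -!leNgt => h.
rewrite /box_bump (bigD1 i)//=; case/orP: h => h.
  rewrite (@flat_le0 _ 0 (_ + - _)) ?mul0r//.
  by rewrite subr_le0 ler_pM2l// ltr0n.
rewrite (@flat_le0 _ 0 (- _ * _ + _)) ?mulr0 ?mul0r//.
by rewrite mulNr addrC subr_le0 ler_pM2l// ltr0n.
Qed.

Lemma bump_gt0 a b k x : obox a b x -> 0 < box_bump a b k x.
Proof.
move=> h; apply: prodr_gt0 => i _; have /andP[h1 h2] := h i.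
by rewrite mulr_gt0// flat0_gt0// ?mulNr ?[- _ + _]addrC subr_gt0 ltr_pM2l// ltr0n.
Qed.

Lemma bump_cvg1 a b x : obox a b x -> box_bump a b k x @[k --> \oo] --> (1 : R).
Proof.
move=> h; rewrite /box_bump; elim: (index_enum _) => [|i s ih].
  by under eq_fun do rewrite big_nil; exact: cvg_cst.
under eq_fun do rewrite big_cons.
have /andP[h1 h2] := h i.
rewrite (_ : nbhs (1 : R) = nbhs (1 * 1 * 1 : R)); last by rewrite !mulr1.
apply: cvgM => //; apply: cvgM.
- under eq_fun do rewrite -mulrBr.
  by apply: flat0_cvg1; rewrite subr_gt0.
- under eq_fun do rewrite mulNr addrC -mulrBr.
  by apply: flat0_cvg1; rewrite subr_gt0.
Qed.

Lemma test_bump Om a b k : cbox a b `<=` Om -> test_function Om (box_bump a b k).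
Proof.
move=> abOm; apply: (test_function_supp (smooth_bump a b k) (compact_cbox (a:=a) (b:=b)) abOm).
by move=> x abx; apply: bump_eq0 => /sub_obox_cbox.
Qed.

(** The bumps tend to the indicator of the open box and are supported in the compact closed box, on
    which the integrable function |g| dominates. *)
Lemma integral_obox_eq0 Om g a b : loc_integrable Om g ->
  (forall phi, test_function Om phi -> \int[leb]_(x in Om) (g x * phi x) = 0) ->
  cbox a b `<=` Om -> (\int[leb]_(x in obox a b) (g x)%:E = 0)%E.
Proof.
move=> [mg ig] g0 abOm.
have icb := ig _ (compact_cbox (a:=a) (b:=b)) abOm.
have mcb := measurable_cbox a b.
have mgcb : measurable_fun (cbox a b) g by apply/measurable_EFinP; exact: measurable_int icb.
have mob := measurable_obox a b.
have [|||//||iob _ cv] := @dominated_convergence _ _ _ leb (cbox a b) mcb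
    (fun k x => (g x * box_bump a b k x)%:E) ((EFin \o g) \_ (obox a b)) (fun x => `|g x|%:E).
- move=> k; apply/measurable_EFinP; apply: measurable_funM => //.
  exact: test_measurable (test_bump k abOm).
- by apply: (measurable_restrict _ mob mcb).1; apply: measurable_funS (measurable_int _ icb).
- apply: aeW => x _; rewrite patchE; case: ifPn => [|/negP] xab.
    apply: cvg_EFin; first exact: nearW.
    rewrite -[X in _ --> X]mulr1; apply: cvgM; first exact: cvg_cst.
    by apply: bump_cvg1; rewrite inE in xab.
  rewrite (_ : (fun k => _) = (fun=> 0%E)); first exact: cvg_cst.
  apply/funext => k; rewrite bump_eq0 ?mulr0// => h; apply: xab; rewrite inE//.
- exact: (integrable_norm icb).
- apply: aeW => x k _; rewrite lee_fin normrM.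
  have /andP[b0 b1] := bump_itv a b k x.
  by rewrite -[leRHS]mulr1 ler_wpM2l// ger0_norm.
have E0 k : (\int[leb]_(x in cbox a b) (g x * box_bump a b k x)%:E = 0)%E.
  have := g0 _ (test_bump k abOm); rewrite /Rintegral.
  have -> : (\int[leb]_(x in Om) (g x * box_bump a b k x)%:E =
    \int[leb]_(x in cbox a b) (g x * box_bump a b k x)%:E)%E.
    rewrite integral_mkcond [RHS]integral_mkcond; apply: eq_integral => x _.
    rewrite !patchE; case: ifPn => [xOm|/negP xOm]; case: ifPn => [xab|/negP xab] //.
      rewrite bump_eq0 ?mulr0// => /sub_obox_cbox h; apply: xab; rewrite inE//.
    by rewrite bump_eq0 ?mulr0// => /sub_obox_cbox h; apply: xOm; rewrite inE; exact: abOm.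
  (* [Rintegral] takes [fine] of the integral, which also sends infinite values to 0; integrability
     excludes them. *)
  move=> h; rewrite -[LHS]fineK ?h//; apply: integrable_fin_num => //.
  apply: (le_integrable mcb _ _ icb).
    apply/measurable_EFinP; apply: measurable_funM => //.
    exact: test_measurable (test_bump k abOm).
  move=> x _ /=; rewrite lee_fin normrM; have /andP[b0 b1] := bump_itv a b k x.
  by rewrite -[leRHS]mulr1 ler_wpM2l// ger0_norm.
have : (\int[leb]_(x in cbox a b) ((EFin \o g) \_ (obox a b)) x = 0)%E.
  apply: esym; apply: (cvg_unique _ _ cv) => //.
  by rewrite (_ : [sequence _]_n = (fun=> 0%E)); [exact: cvg_cst|apply/funext => k; exact: E0].
rewrite -integral_mkcondr (setIidr (@sub_obox_cbox a b))//.
Qed.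

Definition oboxes : set (set E) := [set A | exists a b, A = obox a b].

Lemma oboxI a b a' b' : obox a b `&` obox a' b' =
  obox (\row_i Num.max (a ord0 i) (a' ord0 i)) (\row_i Num.min (b ord0 i) (b' ord0 i)).
Proof.
apply/seteqP; split=> x.
  move=> [h h'] i; have /andP[p q] := h i; have /andP[p' q'] := h' i.
  by rewrite !mxE gt_max lt_min p p' q q'.
by move=> h; split => i; have := h i; rewrite !mxE gt_max lt_min;
  move=> /andP[/andP[p p'] /andP[q q']]; apply/andP.
Qed.

(** A slab in one coordinate is the increasing union of boxes cut off at [k] in the other
    coordinates. *)
Lemma measurable_oboxesE : @measurable _ E = <<s oboxes >>.
Proof.
apply/seteqP; split; last first.
  apply: smallest_sub; first exact: sigma_algebra_measurable.
  by move=> _ [a [b ->]]; exact: measurable_obox.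
apply: smallest_sub; first exact: smallest_sigma_algebra.
rewrite -bigcup_seq; apply: bigcup_sub => i _ _ [B mB <-].
have := @measurability _ _ (g_sigma_algebraType oboxes) (measurableTypeR R) setT
  (rV_coord i) _ (RGenOpens.measurableE R).
apply => //.
move=> _ [_ [p [q ->]] <-]; rewrite setTI.
rewrite (_ : _ @^-1` _ = \bigcup_k obox (\row_j if j == i then p else - k%:R)
   (\row_j if j == i then q else k%:R)).
  apply: bigcup_measurable => k _; apply: sub_sigma_algebra.
  by do 2 eexists; reflexivity.
apply/seteqP; split=> x /=.
  rewrite in_itv/= => h; exists (Num.truncn `|x|).+1 => //= j; rewrite !mxE.
  case: eqVneq => [->//|_]; rewrite -ltr_norml.
  by apply: le_lt_trans (rV_coord_norm _ _) _; rewrite truncnS_gt.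
by move=> [k _ /(_ i)]; rewrite !mxE eqxx in_itv.
Qed.

(** Boxes are stable under intersection, so Dynkin's theorem extends the vanishing of the integral
    of [g] from boxes to all measurable subsets of the given box, which forces [g] to vanish almost
    everywhere there. *)
Lemma ae_eq0_obox Om g a b : loc_integrable Om g ->
  (forall phi, test_function Om phi -> \int[leb]_(x in Om) (g x * phi x) = 0) ->
  cbox a b `<=` Om -> ae_eq leb (obox a b) (EFin \o g) (cst 0%E).
Proof.
move=> lg g0 abOm.
have mob := measurable_obox a b.
have iob : leb.-integrable (obox a b) (EFin \o g).
  apply: (@integrableS _ _ _ leb (cbox a b)) => //.
  - exact: measurable_cbox.
  - exact: sub_obox_cbox.
  - by apply: lg.2 => //; exact: compact_cbox.
pose D : set (set E) := [set A | measurable A /\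
   (\int[leb]_(x in obox a b `&` A) (g x)%:E = 0)%E].
have dD : dynkin D.
  split.
  - split; first exact: measurableT.
    by rewrite setIT; exact: integral_obox_eq0 lg g0 abOm.
  - move=> A [mA A0]; split; first exact: measurableC.
    have : (\int[leb]_(x in obox a b) (g x)%:E = 0)%E by exact: integral_obox_eq0 lg g0 abOm.
    rewrite -{1}(setIT (obox a b)) -(setUv A) setIUr integral_setU.
    + by rewrite A0 add0e.
    + exact: measurableI.
    + by apply: measurableI => //; exact: measurableC.
    + by rewrite -setIUr setUv setIT; exact: measurable_int iob.
    + by apply/disj_setPS => x [[_ ?] [_ ?]].
  - move=> F tF DF; split; first by apply: bigcup_measurable => k _; have [] := DF k.
    rewrite setI_bigcupr integral_bigcup.
    + by rewrite eseries0// => k _ _; have [] := DF k.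
    + exact: trivIset_setIl.
    + by move=> k; apply: measurableI => //; have [] := DF k.
    + apply: integrableS iob => //.
        by apply: bigcup_measurable => k _; apply: measurableI => //; have [] := DF k.
      by apply: bigcup_sub => k _; exact: subIsetl.
have oD : oboxes `<=` D.
  move=> _ [a' [b' ->]]; split; first exact: measurable_obox.
  rewrite oboxI; apply: integral_obox_eq0 lg g0 _ => x h; apply: abOm => i.
  by have := h i; rewrite !mxE ge_max le_min => /andP[/andP[p _] /andP[q _]]; apply/andP.
have sD : @measurable _ E `<=` D.
  rewrite measurable_oboxesE -setI_closed_g_dynkin_g_sigma_algebra.
    exact: smallest_sub.
  by move=> _ _ [a1 [b1 ->]] [a2 [b2 ->]]; rewrite oboxI; do 2 eexists; reflexivity.
apply: integral_ae_eq => //.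
move=> A Aab mA; rewrite integral0 -(setIidr Aab).
by have [] := sD _ mA.
Qed.

(** Countably many rational cubes with closure in [Om] cover it, so the exceptional set is a
    countable union of null sets. [unpickle] enumerates them, indices that code no cube giving the
    empty set. *)
Lemma du_bois_reymond Om g : open Om -> loc_integrable Om g ->
  (forall phi, test_function Om phi -> \int[leb]_(x in Om) (g x * phi x) = 0) ->
  ae_eq leb Om g (cst 0).
Proof.
move=> oOm lg g0.
pose ab (p : 'rV[rat]_d * nat) : E * E :=
  (map_mx ratr p.1 - const_mx p.2.+1%:R^-1, map_mx ratr p.1 + const_mx p.2.+1%:R^-1).
have N p : leb.-negligible (if `[< cbox (ab p).1 (ab p).2 `<=` Om >] then
    obox (ab p).1 (ab p).2 `&` [set x | g x != 0] else set0).
  case: asboolP => [h|_]; last exact: negligible_set0.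
  have := ae_eq0_obox lg g0 h; apply: negligibleS => x [/= xab /eqP gx] e.
  by apply: gx; have [] := e xab.
pose F p : set E := if `[< cbox (ab p).1 (ab p).2 `<=` Om >] then
    obox (ab p).1 (ab p).2 `&` [set x | g x != 0] else set0.
have : leb.-negligible (\bigcup_n (if unpickle n is Some p then F p else set0)).
  apply: negligible_bigcup => n.
  by case: (unpickle n) => [p|]; [exact: N|exact: negligible_set0].
apply: negligibleS.
move=> x /= /not_implyP[Omx gx].
have [p [xp pOm]] := open_rat_box oOm Omx.
have abE y i : (`|y ord0 i - ratr (p.1 ord0 i)| < p.2.+1%:R^-1) =
    ((ab p).1 ord0 i < y ord0 i < (ab p).2 ord0 i).
  by rewrite ltr_distl !mxE.
have abE' y i : (`|y ord0 i - ratr (p.1 ord0 i)| <= p.2.+1%:R^-1) =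
    ((ab p).1 ord0 i <= y ord0 i <= (ab p).2 ord0 i).
  by rewrite ler_distl !mxE.
exists (pickle p) => //; rewrite pickleK /F; case: asboolP => [_|]; last first.
  by case=> y hy; apply: pOm => i; rewrite abE'; exact: hy.
by split=> [i|]; [rewrite -abE|exact/eqP].
Qed.

End test_functions.

(** * Sobolev spaces and the elasticity form *)

Lemma l2norm_le d (T : measurableType d) (R : realType) (mu : {measure set T -> \bar R})
    (D : set T) (mD : measurable D) (u v : T -> R) (c : R) : 0 <= c ->
  sqint mu D u -> sqint mu D v -> (forall x, D x -> `|u x| <= c * `|v x|) ->
  l2norm mu D u <= c * l2norm mu D v.
Proof.
move=> c0 hu hv uv.
rewrite -ler_sqr ?nnegrE ?mulr_ge0 ?l2norm_ge0// exprMn !sqr_l2norm.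
rewrite !dotpE -RintegralZl//; last exact: sqintM.
apply: le_Rintegral => //; first exact: sqintM.
  exact: (@integrableZl _ _ _ mu D mD (c ^+ 2) _ (sqintM mD hv hv)).
move=> x Dx; have cv := le_trans (normr_ge0 _) (uv _ Dx).
rewrite -!expr2 -(real_normK (num_real (u x))) -(real_normK (num_real (v x))) -exprMn.
by rewrite ler_sqr// uv.
Qed.

Lemma eq0_of_le_small (R : realFieldType) (X C : R) : 0 <= C ->
  (forall e, 0 < e -> `|X| <= C * e) -> X = 0.
Proof.
move=> C0 h; apply/eqP; rewrite -normr_le0; apply/ler_addgt0Pl => e e0; rewrite addr0.
have C1 : 0 < C + 1 by rewrite ltr_wpDl.
apply: le_trans (h (e / (C + 1)) (divr_gt0 e0 C1)) _.
by rewrite mulrCA ler_piMr ?(ltW e0)// ler_pdivrMr// mul1r lerDl.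
Qed.

(** * Riesz representation for a semi-inner product *)

Section semi_inner_product.
Context {R : realType} {V : Type}.
Variables (W : V -> Prop) (lin : R -> V -> V -> V) (q : V -> V -> R).
Hypothesis W_lin : forall a u v, W u -> W v -> W (lin a u v).
Hypothesis qC : forall u v, W u -> W v -> q u v = q v u.
Hypothesis q_lin : forall a u v w, W u -> W v -> W w ->
  q (lin a u v) w = a * q u w + q v w.
Hypothesis q_ge0 : forall u, W u -> 0 <= q u u.
Implicit Types (u v w : V) (a : R).

(** [lin a u v] stands for a u + v. No vector space laws are asked of it and [q] may have null
    vectors, so the results apply to sets of functions such as [vH10] with forms that do not see
    null sets. *)
Definition seminorm u : R := Num.sqrt (q u u).
Local Notation n := seminorm.

Lemma seminorm_ge0 u : 0 <= n u. Proof. exact: sqrtr_ge0. Qed.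

Lemma sqr_seminorm u : W u -> n u ^+ 2 = q u u.
Proof. by move=> hu; rewrite sqr_sqrtr// q_ge0. Qed.

Lemma q_linr a u v w : W u -> W v -> W w -> q w (lin a u v) = a * q w u + q w v.
Proof.
move=> hu hv hw; have hl := W_lin a hu hv.
by rewrite (qC hw hl) q_lin// (qC hu hw) (qC hv hw).
Qed.

Lemma q_lin2 a u v : W u -> W v ->
  q (lin a u v) (lin a u v) = a ^+ 2 * q u u + 2 * a * q u v + q v v.
Proof.
move=> hu hv; have hl := W_lin a hu hv.
rewrite q_lin// !q_linr// (qC hv hu); ring.
Qed.

Lemma semi_cauchy_schwarz u v : W u -> W v -> `|q u v| <= n u * n v.
Proof.
move=> hu hv; rewrite -ler_sqr ?nnegrE ?mulr_ge0 ?seminorm_ge0//.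
rewrite real_normK ?num_real// exprMn !sqr_seminorm//.
have p s : 0 <= s ^+ 2 * q u u + 2 * s * q u v + q v v.
  by rewrite -q_lin2//; apply: q_ge0; exact: W_lin.
have := q_ge0 hu; have := q_ge0 hv; move: p.
move: (q u u) (q u v) (q v v) => x y z p z0; rewrite le_eqVlt => /orP[/eqP x0|x0].
  have [->|y0] := eqVneq y 0; first by rewrite expr0n mulr_ge0// -x0.
  have := p (- (z + 1) / (2 * y)); rewrite -x0 mulr0 add0r.
  have -> : 2 * (- (z + 1) / (2 * y)) * y = - (z + 1) by field.
  lra.
have := mulr_ge0 (p (- y / x)) (ltW x0).
have -> : ((- y / x) ^+ 2 * x + 2 * (- y / x) * y + z) * x = x * z - y ^+ 2.
  by field; rewrite gt_eqF.
by rewrite subr_ge0.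
Qed.

Lemma seminorm_lin a u v : W u -> W v -> n (lin a u v) <= `|a| * n u + n v.
Proof.
move=> hu hv; have hl := W_lin a hu hv.
rewrite -ler_sqr ?nnegrE ?addr_ge0 ?mulr_ge0 ?seminorm_ge0//.
rewrite sqr_seminorm// q_lin2// sqrrD exprMn !sqr_seminorm// real_normK ?num_real//.
rewrite lerD2r lerD2l; have cs := semi_cauchy_schwarz hu hv.
apply: le_trans (ler_norm _) _.
rewrite !normrM (ger0_norm (ler0n _ 2)) -mulrA mulr_natl lerMn2r -mulrA.
by rewrite ler_wpM2l.
Qed.

Hypothesis complete : forall v_ : nat -> V, (forall k, W (v_ k)) ->
  (forall e, 0 < e -> exists N, forall j k, (N <= j)%N -> (N <= k)%N ->
     n (lin (-1) (v_ j) (v_ k)) < e) ->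
  exists2 w, W w & forall e, 0 < e -> exists N, forall k, (N <= k)%N ->
    n (lin (-1) w (v_ k)) < e.

Variables (l : V -> R) (K : R) (u0 : V).
Hypothesis Wu0 : W u0.
Hypothesis l_lin : forall a u v, W u -> W v -> l (lin a u v) = a * l u + l v.
Hypothesis l_bounded : forall u, W u -> `|l u| <= K * n u.

(* A minimizing sequence of [v |-> q v v - 2 l v] is Cauchy by the parallelogram
   identity, and its limit satisfies the Euler equation. *)
Theorem riesz_representation : exists2 w, W w & forall v, W v -> q w v = l v.
Proof.
pose J v := q v v - 2 * l v.
have J_lin a u v : W u -> W v ->
    J (lin a u v) = J v + (a ^+ 2 * q u u + 2 * a * (q u v - l u)).
  by move=> hu hv; rewrite /J q_lin2// l_lin//; ring.
(* J v >= |v|^2 - 2 K |v| = (|v| - K)^2 - K^2. *)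
have J_lb v : W v -> - K ^+ 2 <= J v.
  move=> hv; have := l_bounded hv; rewrite /J -sqr_seminorm// ler_norml => /andP[_].
  move: (n v) (l v) => x y h; have := sqr_ge0 (x - K); nra.
pose S := [set J v | v in [set v | W v]].
have S0 : S !=set0 by exists (J u0), u0.
have lS : has_lbound S by exists (- K ^+ 2) => _ [v hv <-]; exact: J_lb.
set m := inf S.
have mJ v : W v -> m <= J v by move=> hv; apply: ge_inf => //; exists v.
have /choice[v_ hv_] : forall k, exists v, W v /\ J v < m + k.+1%:R^-1.
  move=> k; have [|_ [v hv <-] h] := @inf_adherent _ S k.+1%:R^-1 _ (conj S0 lS).
    by rewrite invr_gt0.
  by exists v.
have Wv k : W (v_ k) by have [] := hv_ k.
have Jv k : J (v_ k) < m + k.+1%:R^-1 by have [] := hv_ k.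
have arch (e : R) : 0 < e -> exists N : nat, forall k, (N <= k)%N -> k.+1%:R^-1 < e.
  move=> e0; exists (Num.truncn e^-1) => k Nk.
  rewrite invf_plt ?posrE// (lt_le_trans (truncnS_gt _))// ler_nat//.
have cauchy : forall e, 0 < e -> exists N, forall j k, (N <= j)%N -> (N <= k)%N ->
     n (lin (-1) (v_ j) (v_ k)) < e.
  move=> e e0; have [|N hN] := arch (e ^+ 2 / 4); first by rewrite divr_gt0// exprn_gt0.
  exists N => j k Nj Nk; have hW := W_lin (-1) (Wv j) (Wv k).
  rewrite -ltr_sqr ?nnegrE ?seminorm_ge0 ?(ltW e0)// sqr_seminorm//.
  (* The midpoint of [v_ j] and [v_ k], expressed by [lin] alone: half of [v_ k] is (-1/2) [v_ k]
     plus [v_ k]. The value of [J] there is at least the infimum, so the squared distance is at most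
     2 (1/(j+1) + 1/(k+1)), whence the threshold e^2 / 4. *)
  have hm := W_lin (- 2^-1) (Wv k) (Wv k).
  have := mJ _ (W_lin 2^-1 (Wv j) hm).
  rewrite J_lin// J_lin// q_linr// q_lin2//.
  have := Jv j; have := Jv k; have := hN _ Nj; have := hN _ Nk.
  rewrite /J; move: (k.+1%:R^-1) (j.+1%:R^-1) => ak aj; lra.
have [w Ww hw] := complete Wv cauchy.
exists w => // v hv; apply/eqP; rewrite -subr_eq0; apply/eqP.
apply: (@eq0_of_le_small _ _ (n v + 1)); first by rewrite addr_ge0// seminorm_ge0.
move=> e e0; have [N1 hN1] := hw _ e0.
have Q1 : 0 < q v v + 1 by rewrite ltr_wpDl// q_ge0.
have [|N2 hN2] := arch (e ^+ 2 / (q v v + 1)).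
  by rewrite divr_gt0// exprn_gt0.
set k := maxn N1 N2.
have d1 := hN1 k (leq_maxl _ _); have d2 := hN2 k (leq_maxr _ _).
have hk : `|q v (v_ k) - l v| <= e.
  rewrite -ler_sqr ?nnegrE ?(ltW e0)// real_normK ?num_real//.
  (* Moving from [v_ k] by [- (t * x)] along [v] lowers [J] by at least t x^2, while [J (v_ k)]
     exceeds the infimum by less than 1/(k+1). The 1 added to [q v v] keeps the step finite for null
     vectors. *)
  set x := _ - l v; pose t := (q v v + 1)^-1.
  have := mJ _ (W_lin (- (t * x)) hv (Wv k)); rewrite J_lin// -/x => h1.
  have t0 : 0 < t by rewrite invr_gt0.
  have tQ : t * (q v v + 1) = 1 by rewrite mulVf// gt_eqF.
  have : t * x ^+ 2 <= k.+1%:R^-1.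
    have := Jv k; move: h1; rewrite sqrrN exprMn => h1 h2.
    have e3 : t ^+ 2 * x ^+ 2 * q v v = t * x ^+ 2 - t ^+ 2 * x ^+ 2.
      transitivity (t * x ^+ 2 * (t * (q v v + 1)) - t ^+ 2 * x ^+ 2); first by ring.
      by rewrite tQ mulr1.
    have e4 : 0 <= t ^+ 2 * x ^+ 2 by rewrite mulr_ge0 ?sqr_ge0.
    have e5 : 2 * (- (t * x)) * x = - 2 * (t * x ^+ 2) by ring.
    move: h1 h2 e4; rewrite e3 e5.
    move: (J (v_ k)) (t * x ^+ 2) (t ^+ 2 * x ^+ 2) k.+1%:R^-1 => A P Q r; lra.
  move=> /le_lt_trans/(_ d2); rewrite ltr_pdivlMr// mulrAC tQ mul1r; exact: ltW.
have hd : `|q (lin (-1) w (v_ k)) v| <= n v * e.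
  apply: le_trans (semi_cauchy_schwarz (W_lin _ Ww (Wv k)) hv) _.
  by rewrite mulrC ler_wpM2l ?seminorm_ge0// ltW.
have -> : q w v - l v = (q v (v_ k) - l v) - q (lin (-1) w (v_ k)) v.
  by rewrite q_lin// (qC hv (Wv k)); ring.
apply: le_trans (ler_normB _ _) _; rewrite mulrDl mul1r addrC.
exact: lerD.
Qed.

End semi_inner_product.

Lemma sqrt_sum_sqr_le (R : realType) (I : finType) (x : I -> R) : (forall i, 0 <= x i) ->
  Num.sqrt (\sum_i x i ^+ 2) <= \sum_i x i.
Proof.
move=> x0; have S0 : 0 <= \sum_i x i by exact: sumr_ge0.
rewrite -[leRHS]ger0_norm// -sqrtr_sqr ler_sqrt ?sqr_ge0// [leRHS]expr2 mulr_suml.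
apply: ler_sum => i _; rewrite expr2 ler_wpM2l// (bigD1 i)//= lerDl.
exact: sumr_ge0.
Qed.

Lemma le_sqrt_sum_sqr (R : realType) (I : finType) (x : I -> R) i : 0 <= x i ->
  x i <= Num.sqrt (\sum_i x i ^+ 2).
Proof.
move=> x0; rewrite -[leLHS]ger0_norm// -sqrtr_sqr ler_sqrt; last first.
  by apply: sumr_ge0 => j _; exact: sqr_ge0.
by rewrite (bigD1 i)//= lerDl; apply: sumr_ge0 => j _; exact: sqr_ge0.
Qed.

Lemma Rintegral_sum d (T : measurableType d) (R : realType)
    (mu : {measure set T -> \bar R}) (D : set T) (mD : measurable D) (I : Type)
    (s : seq I) (f : I -> T -> R) : (forall i, mu.-integrable D (EFin \o f i)) ->
  \int[mu]_(x in D) (\sum_(i <- s) f i x) = \sum_(i <- s) \int[mu]_(x in D) f i x.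
Proof.
move=> hf; elim: s => [|i s IH].
  rewrite big_nil -[RHS](Rintegral_zero mu D); apply: eq_Rintegral => x _.
  by rewrite big_nil.
rewrite big_cons -IH -RintegralD//.
  by apply: eq_Rintegral => x _; rewrite big_cons.
rewrite (_ : _ \o _ = fun x => (\sum_(i <- s) (f i x)%:E)%E).
  by apply: (integrable_sum mD) => i0 _; exact: hf.
by apply/funext => x /=; rewrite sumEFin.
Qed.

Lemma sum_ord_const (R : realType) d (x : R) : \sum_(i < d) x = d%:R * x.
Proof. by rewrite sumr_const card_ord mulr_natl. Qed.

Lemma double_sum_const (R : realType) d (c : R) :
  \sum_(i < d) \sum_(j < d) c = d%:R ^+ 2 * c.
Proof. by rewrite !sum_ord_const mulrA expr2. Qed.

Lemma l2norm_sum d (T : measurableType d) (R : realType) (mu : {measure set T -> \bar R})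
    (D : set T) (mD : measurable D) I (s : seq I) (F : I -> T -> R) :
  (forall i, sqint mu D (F i)) ->
  l2norm mu D (fun x => \sum_(i <- s) F i x) <= \sum_(i <- s) l2norm mu D (F i).
Proof.
move=> hF; elim: s => [|i s IH].
  have -> : (fun x => \sum_(i <- [::]) F i x) = fun=> 0.
    by apply/funext => x; rewrite big_nil.
  by rewrite l2norm0 big_nil.
rewrite big_cons; apply: le_trans (lerD (lexx _) IH).
have := l2normD mD (hF i) (sqint_sum mD s hF).
by congr (_ <= _); congr l2norm; apply/funext => x; rewrite big_cons.
Qed.

Lemma integrable_sumR d (T : measurableType d) (R : realType)
    (mu : {measure set T -> \bar R}) (D : set T) (mD : measurable D) I (s : seq I)
    (F : I -> T -> R) : (forall i, mu.-integrable D (EFin \o F i)) ->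
  mu.-integrable D (EFin \o (fun x => \sum_(i <- s) F i x)).
Proof.
move=> hF; rewrite (_ : _ \o _ = fun x => (\sum_(i <- s) (F i x)%:E)%E).
  by apply: (integrable_sum mD) => i _; exact: hF.
by apply/funext => x /=; rewrite sumEFin.
Qed.

(** * Products with a bounded nonnegative weight *)

Section weighted_dot.
Context d (T : measurableType d) (R : realType).
Variables (mu : {measure set T -> \bar R}) (D : set T).
Hypothesis mD : measurable D.
Variables (w : T -> R) (m c : R).
Hypothesis mw : measurable_fun D w.
Hypothesis m0 : 0 <= m.
Hypothesis wmc : forall x, D x -> m <= w x <= c.
Implicit Types (u v : T -> R).

Lemma sqint_weight v : sqint mu D v -> sqint mu D (fun x => w x * v x).
Proof.
move=> hv; apply: (sqint_bounded mD (v := v) (c := c)) => //.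
  by apply: measurable_funM => //; case: hv.
move=> x /wmc /andP[mx xc]; rewrite normrM ler_wpM2r//.
by rewrite ger0_norm// (le_trans m0).
Qed.

Lemma dotp_weightC u v :
  dotp mu D u (fun x => w x * v x) = dotp mu D v (fun x => w x * u x).
Proof. by rewrite !dotpE; apply: eq_Rintegral => x _; rewrite mulrCA mulrA mulrC mulrA. Qed.

Lemma dotp_weight_le v : sqint mu D v ->
  dotp mu D v (fun x => w x * v x) <= c * dotp mu D v v.
Proof.
move=> hv; rewrite -dotpZr// !dotpE; apply: le_Rintegral => //.
- exact: (sqintM mD hv (sqint_weight hv)).
- exact: (sqintM mD hv (sqintZ mD c hv)).
- move=> x /wmc /andP[_ h]; have := sqr_ge0 (v x); move: (v x) (w x) h => a b; nra.
Qed.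

Lemma le_dotp_weight v : sqint mu D v ->
  m * dotp mu D v v <= dotp mu D v (fun x => w x * v x).
Proof.
move=> hv; rewrite -dotpZr// !dotpE; apply: le_Rintegral => //.
- exact: (sqintM mD hv (sqintZ mD m hv)).
- exact: (sqintM mD hv (sqint_weight hv)).
- move=> x /wmc /andP[h _]; have := sqr_ge0 (v x); move: (v x) (w x) h => a b; nra.
Qed.

End weighted_dot.

Lemma compact_measurable_rV (R : realType) n (K : set 'rV[R]_n) :
  compact K -> measurable K.
Proof.
move=> cK; rewrite -[K]setCK; apply: measurableC; apply: open_measurable_rV.
by apply: closed_openC; apply: compact_closed => //; exact: norm_hausdorff.
Qed.

(** Sealed like [dotp], so that conversion does not look inside the choice made by [wderiv]. *)
HB.lock Definition wD {R : realType} {d : nat} (Om : set 'rV[R]_d) (i : 'I_d)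
  (u : 'rV[R]_d -> R) : 'rV[R]_d -> R := wderiv Om (mi_unit i) u.
Canonical locked_wD := Unlockable wD.unlock.

(** * First-order Sobolev spaces, Korn's inequality and the elasticity form *)

Section elasticity.
Context {R : realType} {d : nat}.
Local Notation E := 'rV[R]_d.
Local Notation leb := (@lebesgue_rV R d).
Variable Om : set E.
Hypothesis oOm : open Om.
Hypothesis bOm : bounded_set Om.
Implicit Types (u v w g phi : E -> R) (i j : 'I_d) (a : 'I_d -> nat) (F G H : E -> E).
Local Notation L2 := (sqint leb Om).
Local Notation ip := (dotp leb Om).
Local Notation nrm := (l2norm leb Om).
Local Notation D := (wD Om).
Local Notation hn := (Hnorm 1 Om).
Local Notation vN := (vH_norm 1 Om).
Local Notation vn := (vL2_norm Om).
Local Notation comp := Defs.comp.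

Let mOm : measurable Om := open_measurable_rV oOm.

Lemma wDE i u : D i u = wderiv Om (mi_unit i) u.
Proof. by rewrite unlock. Qed.

Lemma Lnorm2E u : 'N[leb]_2%:E[EFin \o (u \_ Om)]%E =
  sqrte (\int[leb]_(x in Om) (u x ^+ 2)%:E)%E.
Proof.
rewrite unlock poweR12_sqrt; last by apply: integral_ge0 => x _; exact: poweR_ge0.
congr sqrte; rewrite [RHS]integral_mkcond; apply: eq_integral => x _ /=.
rewrite powR_mulrn// real_normK ?num_real//.
by rewrite !patchE; case: ifP; rewrite ?expr0n.
Qed.

Lemma Lp_space2P u : Lp_space 2%:E Om u <-> L2 u.
Proof.
split=> [/= /andP[mu_ fu]|[mu_ iu]].
  have {}mu_ : measurable_fun Om u.
    by apply/(measurable_restrictT _ mOm); move: mu_; rewrite inE.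
  split=> //; apply/integrableP; split.
    by apply/measurable_EFinP; exact: measurable_funX.
  have -> : (\int[leb]_(x in Om) `|(EFin \o (fun x => u x ^+ 2)%R) x| =
      \int[leb]_(x in Om) (u x ^+ 2)%:E)%E.
    by apply: eq_integral => x _ /=; rewrite ger0_norm// sqr_ge0.
  move: fu; rewrite inE /= /finite_norm Lnorm2E.
  by case: (\int[leb]_(x in Om) _)%E => //= r _; rewrite ltry.
apply/andP; split; first by rewrite inE; apply/(measurable_restrictT _ mOm).
rewrite inE /= /finite_norm Lnorm2E.
by rewrite -(fineK (integrable_fin_num mOm iu)) ltry.
Qed.

Lemma Lp_norm2E u : L2 u -> Lp_norm 2%:E Om u = nrm u.
Proof.
move=> hu; rewrite /Lp_norm Lnorm2E integral_sqr//= sqrtr_sqr ger0_norm//.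
exact: l2norm_ge0.
Qed.

Let Omoo : (leb Om < +oo)%E := lebesgue_rV_bounded mOm bOm.

(** [Om] has finite measure and |u| <= 1 + u^2. *)
Lemma sqint_integrable u : L2 u -> leb.-integrable Om (EFin \o u).
Proof.
move=> [mu_ iu].
apply: (@le_integrable _ _ _ leb Om mOm _ (fun x => (1%:E + (u x ^+ 2)%:E)%E)).
- exact/measurable_EFinP.
- move=> x Omx /=; rewrite lee_fin [leRHS]ger0_norm ?addr_ge0 ?sqr_ge0//.
  rewrite ler_norml; apply/andP; split; nra.
- apply: (@integrableD _ _ _ leb Om mOm (cst 1%:E) (fun x => (u x ^+ 2)%:E)) => //.
  apply: (@measurable_bounded_integrable _ _ _ leb (cst 1) Om mOm Omoo) => //.
  by exists 1; split; [exact: num_real|move=> r r1 x _ /=; rewrite normr1 ltW].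
Qed.

Lemma sqint_loc_integrable u : L2 u -> loc_integrable Om u.
Proof.
move=> hu; split; first exact: sqint_measurable hu.
move=> K cK KOm; apply: integrableS (sqint_integrable hu) => //.
exact: compact_measurable_rV.
Qed.

Lemma loc_integrable_lin c u v : loc_integrable Om u -> loc_integrable Om v ->
  loc_integrable Om (fun x => c * u x + v x).
Proof.
move=> [mu_ iu] [mv iv]; split.
  by apply: measurable_funD => //; apply: measurable_funM => //; exact: measurable_cst.
move=> K cK KOm; have mK := compact_measurable_rV cK.
exact: (@integrableD _ _ _ leb K mK _ _ (integrableZl mK c (iu _ cK KOm)) (iv _ cK KOm)).
Qed.

Lemma loc_integrable_test g phi : loc_integrable Om g -> test_function Om phi ->
  leb.-integrable Om (EFin \o (fun x => g x * phi x)).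
Proof.
move=> [mg ig] tphi; have [B [_ [_ _ hB _]]] := test_bounds tphi.
have /test_functionP[_ [K [cK KOm K0]]] := tphi.
have mK := compact_measurable_rV cK.
apply/(integrable_mkcond _ mOm).
have -> : (EFin \o (fun x => g x * phi x)) \_ Om = (EFin \o (fun x => g x * phi x)) \_ K.
  apply/funext => x; rewrite !patchE.
  case: ifPn => xOm; case: ifPn => xK //=.
    by rewrite K0 ?mulr0// => h; move/negP: xK; apply; rewrite inE.
  by move/negP: xOm; case; rewrite inE; apply: KOm; rewrite inE in xK.
apply/(integrable_mkcond _ mK).
apply: (@le_integrable _ _ _ leb K mK _ (fun x => (B%:E * (g x)%:E)%E)).
- apply/measurable_EFinP; apply: measurable_funM; first exact: measurable_funS mg.
  exact: test_measurable tphi.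
- move=> x Kx /=; rewrite lee_fin !normrM mulrC ler_wpM2r//.
  exact: le_trans (hB x) (ler_norm _).
- exact: (@integrableZl _ _ _ leb K mK B _ (ig _ cK KOm)).
Qed.

(** The difference of two weak derivatives is orthogonal to all test functions. This uniqueness is
    what allows [wderiv], a mere choice of representative, to be traded for any weak derivative at
    hand. *)
Lemma weak_derivative_ae_eq a u g g' : weak_derivative Om a u g ->
  weak_derivative Om a u g' -> ae_eq leb Om g g'.
Proof.
move=> [_ lg hg] [_ lg' hg'].
have l : loc_integrable Om (fun x => -1 * g' x + g x) by exact: loc_integrable_lin.
have : ae_eq leb Om (fun x => -1 * g' x + g x) (cst 0).
  apply: du_bois_reymond => // phi tphi.
  under eq_Rintegral do rewrite mulN1r mulrDl mulNr addrC.
  rewrite RintegralB//; [|exact: loc_integrable_test..].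
  have := hg _ tphi; rewrite (hg' _ tphi) => /mulfI ->; first by rewrite subrr.
  by rewrite expf_neq0// oppr_eq0 oner_eq0.
apply: filterS => x /= h /h.
by rewrite mulN1r addrC => /eqP; rewrite subr_eq0 => /eqP.
Qed.

Lemma wderivP a u g : weak_derivative Om a u g ->
  weak_derivative Om a u (wderiv Om a u).
Proof. by move=> h; rewrite /wderiv; case: xgetP => [y _//|/(_ g)]. Qed.

Lemma wderiv_ae_eq a u g : weak_derivative Om a u g -> ae_eq leb Om (wderiv Om a u) g.
Proof. by move=> h; exact: weak_derivative_ae_eq (wderivP h) h. Qed.

(** Spells a multi-index as a word in the directions, so that [mi_partial] becomes one fold of
    first-order derivatives, open to induction on the word. *)
Definition mi_seq a : seq 'I_d := flatten [seq nseq (a i) i | i <- enum 'I_d].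

Lemma mi_partialE a u : mi_partial a u = foldr (@partial R d) u (mi_seq a).
Proof.
rewrite /mi_partial /mi_seq; elim: (enum 'I_d) => //= i s ->.
by rewrite foldr_cat; elim: (a i) => //= n ->.
Qed.

Lemma size_mi_seq a : size (mi_seq a) = mi_order a.
Proof.
rewrite /mi_seq size_flatten /shape -map_comp sumnE big_map /mi_order big_enum /=.
by apply: eq_bigr => i _; rewrite size_nseq.
Qed.

Lemma test_foldr_partial O s phi : test_function O phi ->
  test_function O (foldr (@partial R d) phi s).
Proof. by move=> tphi; elim: s => //= i s; exact: test_partial. Qed.

Lemma test_mi_partial O a phi : test_function O phi -> test_function O (mi_partial a phi).
Proof. by rewrite mi_partialE; exact: test_foldr_partial. Qed.

Lemma mi_order0 : mi_order (fun _ : 'I_d => 0%N) = 0%N.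
Proof. by rewrite /mi_order big1. Qed.

Lemma mi_order_unit i : mi_order (mi_unit i) = 1%N.
Proof.
rewrite /mi_order (bigD1 i)//= /mi_unit eqxx big1// => j ji.
by rewrite (negbTE ji).
Qed.

Lemma mi_order_le1 a : (mi_order a <= 1)%N ->
  a = (fun=> 0%N) \/ exists i, a = mi_unit i.
Proof.
move=> h; have [z|/existsNP[i /eqP ai]] := pselect (forall i, a i = 0%N).
  by left; apply/funext.
right; exists i; apply/funext => j; rewrite /mi_unit.
move: h; rewrite /mi_order (bigD1 i)//=; case: eqVneq => [->|ji].
  by case: (a i) ai => // -[].
rewrite (bigD1 j)//=; case: (a i) ai => // n _; case: (a j) => // m.
by rewrite !addSn addnS.
Qed.

Lemma mi_partial0 u : mi_partial (fun=> 0%N) u = u.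
Proof.
rewrite mi_partialE (_ : mi_seq _ = [::])//; apply: size0nil.
by rewrite size_mi_seq mi_order0.
Qed.

Lemma mi_partial_unit i u : mi_partial (mi_unit i) u = partial i u.
Proof.
rewrite mi_partialE (_ : mi_seq _ = [:: i])//.
rewrite /mi_seq.
have : uniq (enum 'I_d) by exact: enum_uniq.
have : i \in enum 'I_d by rewrite mem_enum.
elim: (enum 'I_d) => //= j s ih; rewrite inE => + /andP[js us].
case: (eqVneq i j) => [ij _|ij /= h]; last first.
  by rewrite {1}/mi_unit eq_sym (negbTE ij) /= ih.
subst j; rewrite {1}/mi_unit eqxx /=; congr (_ :: _).
have -> : [seq nseq (mi_unit i k) k | k <- s] = [seq [::] | k <- s].
  apply/eq_in_map => k ks; rewrite /mi_unit; case: eqVneq => // ki.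
  by rewrite -ki ks in js.
by elim: (s).
Qed.

Lemma weak_derivative_lin a c u v g h : weak_derivative Om a u g ->
  weak_derivative Om a v h ->
  weak_derivative Om a (fun x => c * u x + v x) (fun x => c * g x + h x).
Proof.
move=> [lu lg hg] [lv lh hh]; split; [exact: loc_integrable_lin..|move=> phi tphi].
have tm : test_function Om (mi_partial a phi) by exact: test_mi_partial.
have lin w z eta : loc_integrable Om w -> loc_integrable Om z -> test_function Om eta ->
   \int[leb]_(x in Om) ((c * w x + z x) * eta x) =
   c * \int[leb]_(x in Om) (w x * eta x) + \int[leb]_(x in Om) (z x * eta x).
  move=> lw lz te; under eq_Rintegral do rewrite mulrDl -mulrA.
  rewrite RintegralD//.
  - by rewrite RintegralZl//; exact: loc_integrable_test.
  - by apply: (@integrableZl _ _ _ leb Om mOm c _ (loc_integrable_test lw te)).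
  - exact: loc_integrable_test.
by rewrite !lin// hg// hh//; ring.
Qed.

Lemma weak_derivative0 u : loc_integrable Om u -> weak_derivative Om (fun=> 0%N) u u.
Proof.
move=> lu; split=> // phi tphi; rewrite mi_order0 expr0 mul1r.
by apply: eq_Rintegral => x _; rewrite mi_partial0.
Qed.

Lemma test_ibp i phi u : test_function setT phi -> smooth u ->
  \int[leb]_x (phi x * partial i u x) = - \int[leb]_x (partial i phi x * u x).
Proof.
move=> tphi su; have sphi := test_smooth tphi.
apply/eqP; rewrite -addr_eq0 addrC -RintegralD//.
- rewrite -(integral_partial0 i (test_mul tphi su)) partialM//.
- exact: test_integrable (test_mul (test_partial i tphi) su).
- exact: test_integrable (test_mul tphi (smooth_partial i su)).
Qed.

Lemma test_not_in O phi x : test_function O phi -> ~ O x -> phi x = 0.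
Proof.
move=> /test_functionP[_ [K [_ KO K0]]] Ox; apply: K0 => /KO; exact: Ox.
Qed.

Lemma test_weak_derivative i phi : test_function Om phi ->
  weak_derivative Om (mi_unit i) phi (partial i phi).
Proof.
have lt eta : test_function Om eta -> loc_integrable Om eta.
  move=> te; split; first exact: test_measurable te.
  move=> K cK KOm; apply: integrableS (test_integrable (test_setT te)) => //.
  exact: compact_measurable_rV.
move=> tphi; split; [exact: lt|exact/lt/test_partial|move=> eta teta].
rewrite mi_order_unit expr1 mulN1r mi_partial_unit.
rewrite (Rintegral_supp (Om := Om)); last first.
  by move=> x Ox; rewrite (test_not_in tphi Ox) mul0r.
rewrite (Rintegral_supp (Om := Om)); last first.
  by move=> x Ox; rewrite (test_not_in teta Ox) mulr0.
by apply: test_ibp; [exact: test_setT tphi|exact: test_smooth teta].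
Qed.

Lemma test_sqint phi : test_function Om phi -> L2 phi.
Proof.
move=> tphi; split; first exact: test_measurable tphi.
apply: integrableS (test_integrable (test_mul (test_setT tphi) (test_smooth tphi))) => //.
Qed.

Definition H1 : set (E -> R) := sobolev_space 1 2%:E Om.

(** Multi-indices of order at most 1 are zero and the units. That [u] itself is in L^2 is read off
    at index zero, where [u] is its own weak derivative up to a null set. *)
Lemma H1P u : H1 u <-> L2 u /\ forall i, weak_derivative Om (mi_unit i) u (D i u) /\ L2 (D i u).
Proof.
split=> [h1|[hu hD] a /mi_order_le1[->|[i ->]]]; last 2 first.
- exists u; last exact/Lp_space2P.
  exact/weak_derivative0/sqint_loc_integrable.
- by have [wi /Lp_space2P li] := hD i; exists (D i u).
have key a : (mi_order a <= 1)%N ->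
    weak_derivative Om a u (wderiv Om a u) /\ L2 (wderiv Om a u).
  move=> /h1[g wg /Lp_space2P lg]; have w := wderivP wg; split=> //.
  apply: (sqint_ae_eq mOm _ _ lg); last exact: ae_eq_sym (wderiv_ae_eq wg).
  by have [_ [m _] _] := w.
split=> [|i]; last by rewrite wDE; apply: key; rewrite mi_order_unit.
have [[lu lw hw] l0] : weak_derivative Om (fun=> 0%N) u (wderiv Om (fun=> 0%N) u) /\
    L2 (wderiv Om (fun=> 0%N) u) by apply: key; rewrite mi_order0.
apply: (sqint_ae_eq mOm lu.1 _ l0).
exact: weak_derivative_ae_eq (And3 lu lw hw) (weak_derivative0 lu).
Qed.

Lemma H1_sqint u : H1 u -> L2 u. Proof. by move=> /H1P[]. Qed.

Lemma H1_sqintD u i : H1 u -> L2 (D i u).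
Proof. by move=> /H1P[_ /(_ i)[]]. Qed.

Lemma H1_weakD u i : H1 u -> weak_derivative Om (mi_unit i) u (D i u).
Proof. by move=> /H1P[_ /(_ i)[]]. Qed.

Lemma wderiv0_ae_eq u : loc_integrable Om u -> ae_eq leb Om (wderiv Om (fun=> 0%N) u) u.
Proof. by move=> lu; exact/wderiv_ae_eq/weak_derivative0. Qed.

Lemma H1_intro u (g : 'I_d -> E -> R) : L2 u ->
  (forall i, weak_derivative Om (mi_unit i) u (g i)) -> (forall i, L2 (g i)) -> H1 u.
Proof.
move=> hu hg lg a /mi_order_le1[->|[i ->]].
- exists u; last exact/Lp_space2P.
  exact/weak_derivative0/sqint_loc_integrable.
- by exists (g i) => //; exact/Lp_space2P.
Qed.

Lemma H1_lin c u v : H1 u -> H1 v -> H1 (fun x => c * u x + v x).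
Proof.
move=> hu hv; apply: (@H1_intro _ (fun i x => c * D i u x + D i v x)).
- by apply: sqintD => //; [apply: sqintZ => //|]; exact: H1_sqint.
- by move=> i; apply: weak_derivative_lin; exact: H1_weakD.
- by move=> i; apply: sqintD => //; [apply: sqintZ => //|]; exact: H1_sqintD.
Qed.

Lemma wderiv_lin c u v i : H1 u -> H1 v ->
  ae_eq leb Om (D i (fun x => c * u x + v x)) (fun x => c * D i u x + D i v x).
Proof.
move=> hu hv; rewrite (wDE i (fun x => c * u x + v x)).
by apply/wderiv_ae_eq/weak_derivative_lin; exact: H1_weakD.
Qed.

Lemma test_H1 phi : test_function Om phi -> H1 phi.
Proof.
move=> tphi; apply: (@H1_intro _ (fun i => partial i phi)).
- exact: test_sqint.
- by move=> i; exact: test_weak_derivative.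
- by move=> i; exact/test_sqint/test_partial.
Qed.

Lemma wderiv_test phi i : test_function Om phi -> ae_eq leb Om (D i phi) (partial i phi).
Proof. by move=> tphi; rewrite wDE; exact/wderiv_ae_eq/test_weak_derivative. Qed.

(** Among tuples of exponents 0 or 1, those of order at most 1 are zero and the unit vectors; [pick]
    recovers the direction of a unit vector and so inverts [h]. *)
Lemma mi_of_order_le1 (F : ('I_d -> nat) -> R) :
  \sum_(a : {ffun 'I_d -> 'I_2} | (mi_order (mi_of a) <= 1)%N) F (mi_of a) =
  F (fun=> 0%N) + \sum_i F (mi_unit i).
Proof.
have z : mi_of [ffun=> ord0 : 'I_2] = (fun _ : 'I_d => 0%N).
  by apply/funext => i; rewrite /mi_of ffunE.
pose h i : {ffun 'I_d -> 'I_2} := [ffun j => inord (j == i)].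
have hE i : mi_of (h i) = mi_unit i.
  by apply/funext => j; rewrite /mi_of ffunE inordK// /mi_unit; case: eqP.
rewrite (bigD1 [ffun=> ord0])/=; last by rewrite z mi_order0.
rewrite z; congr (_ + _).
rewrite (reindex_omap h (fun b : {ffun _ -> _} => [pick i | b i != ord0])).
  apply: eq_big => [i|i _]; last by rewrite hE.
  rewrite hE mi_order_unit /=; apply/esym.
  case: pickP => [k|/(_ i)]; last first.
    by rewrite ffunE eqxx -val_eqE /= inordK.
  rewrite ffunE -val_eqE /= inordK; last by case: eqP.
  case: (eqVneq k i) => [->|//] _.
  rewrite eqxx andbT; apply/esym/eqP => /ffunP/(_ i)/(congr1 val).
  by rewrite !ffunE eqxx /= inordK.
move=> a /andP[/mi_order_le1[a0|[i ai]] anz].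
  case/eqP: anz; apply/ffunP => i; rewrite ffunE; apply/val_inj => /=.
  exact: (congr1 (fun f => f i) a0).
have av k : (a k : nat) = (k == i) := congr1 (fun f => f k) ai.
case: pickP => [k|/(_ i)] /=; rewrite -val_eqE /= av.
  case: (eqVneq k i) => // -> _; congr Some; apply/ffunP => j; rewrite ffunE; apply/val_inj => /=.
  by rewrite inordK ?av//; case: eqP.
by rewrite eqxx.
Qed.

Lemma sqr_Hnorm1 u : H1 u -> hn u ^+ 2 = nrm u ^+ 2 + \sum_i nrm (D i u) ^+ 2.
Proof.
move=> hu; rewrite /Hnorm sqr_sqrtr; last by apply: sumr_ge0 => a _; exact: sqr_ge0.
rewrite (mi_of_order_le1 (fun a => Lp_norm 2%:E Om (wderiv Om a u) ^+ 2)).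
have lu := sqint_loc_integrable (H1_sqint hu).
have w0 := wderiv0_ae_eq lu.
congr (_ ^+ 2 + _).
  have mw : measurable_fun Om (wderiv Om (fun=> 0%N) u).
    by have [_ [m _] _] := wderivP (weak_derivative0 lu).
  rewrite Lp_norm2E//; first exact: l2norm_ae_eq mw lu.1 w0.
  exact: (sqint_ae_eq mOm mw (ae_eq_sym w0) (H1_sqint hu)).
by apply: eq_bigr => i _; rewrite -wDE Lp_norm2E//; exact: H1_sqintD.
Qed.

Lemma Hnorm_ge0 k u : 0 <= Hnorm k Om u.
Proof. exact: sqrtr_ge0. Qed.

Lemma l2norm_le_Hnorm1 u : H1 u -> nrm u <= hn u.
Proof.
move=> hu; rewrite -ler_sqr ?nnegrE ?l2norm_ge0 ?Hnorm_ge0// sqr_Hnorm1//.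
by rewrite lerDl sumr_ge0// => i _; rewrite sqr_ge0.
Qed.

Lemma l2normD_le_Hnorm1 u i : H1 u -> nrm (D i u) <= hn u.
Proof.
move=> hu; rewrite -ler_sqr ?nnegrE ?l2norm_ge0 ?Hnorm_ge0// sqr_Hnorm1//.
rewrite (bigD1 i)//= addrCA lerDl addr_ge0 ?sqr_ge0//.
by rewrite sumr_ge0// => j _; rewrite sqr_ge0.
Qed.

Lemma H1B u v : H1 u -> H1 v -> H1 (u \- v).
Proof.
move=> hu hv; have := H1_lin (-1) hv hu.
by congr sobolev_space; apply/funext => x; rewrite mulN1r addrC.
Qed.

Lemma wderivB u v i : H1 u -> H1 v ->
  ae_eq leb Om (D i (u \- v)) (fun x => D i u x - D i v x).
Proof.
move=> hu hv; have := wderiv_lin (-1) i hv hu.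
rewrite (_ : (fun x => -1 * v x + u x) = u \- v).
  by apply: filterS => x h /h ->; rewrite mulN1r addrC.
by apply/funext => x; rewrite mulN1r addrC.
Qed.

(** Write phi^2 as phi^2 times the derivative of x_i and integrate by parts: |phi|^2 = -2 int x_i
    phi D_i phi. Then |x_i| <= M, Cauchy-Schwarz, and one factor |phi| cancels. *)
Lemma poincare_test i phi (M : R) : 0 <= M -> (forall x, Om x -> `|x| <= M) ->
  test_function Om phi -> nrm phi <= 2 * M * nrm (partial i phi).
Proof.
move=> M0 OmM tphi; have sphi := test_smooth tphi.
have tT := test_setT tphi; have tphi2 := test_mul tT sphi.
have h := test_ibp i tphi2 (smooth_coord i).
have l2 := test_sqint tphi; have l2p := test_sqint (test_partial i tphi).
have l2x : L2 (fun x => x ord0 i * phi x).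
  apply: (test_sqint); have := test_mul tphi (smooth_coord i).
  by congr test_function; apply/funext => x; rewrite mulrC.
have e1 : ip phi phi = - (2 * ip (fun x => x ord0 i * phi x) (partial i phi)).
  rewrite !dotpE Rintegral_supp; last first.
    by move=> x /(test_not_in tphi) ->; rewrite mul0r.
  rewrite (Rintegral_supp (Om := Om)); last first.
    by move=> x /(test_not_in tphi) ->; rewrite mulr0 mul0r.
  move: h; rewrite partial_coord eqxx /=; under eq_Rintegral do rewrite mulr1.
  move=> ->; congr (- _); rewrite -RintegralZl//.
    by apply: eq_Rintegral => x _; rewrite partialM//; ring.
  have := test_integrable (test_mul (test_mul tT (smooth_partial i sphi)) (smooth_coord i)).
  by apply: eq_integrable => // x _ /=; congr EFin; ring.
have b : nrm phi ^+ 2 <= (2 * M * nrm (partial i phi)) * nrm phi.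
  rewrite sqr_l2norm e1 -mulrN (_ : 2 * M * _ * _ = 2 * ((M * nrm phi) * nrm (partial i phi)));
    last by ring.
  rewrite ler_pM2l// (le_trans (ler_norm _))// normrN.
  apply: le_trans (cauchy_schwarz mOm l2x l2p) _.
  rewrite ler_wpM2r ?l2norm_ge0//; apply: l2norm_le => // x Omx.
  by rewrite normrM ler_wpM2r// (le_trans (rV_coord_norm _ _))// OmM.
have := l2norm_ge0 leb Om phi; rewrite le_eqVlt => /orP[/eqP <-|p0].
  by rewrite !mulr_ge0 ?l2norm_ge0.
by rewrite -(ler_pM2r p0) -expr2.
Qed.

Lemma poincare i u (M : R) : 0 <= M -> (forall x, Om x -> `|x| <= M) ->
  H10 Om u -> nrm u <= 2 * M * nrm (D i u).
Proof.
move=> M0 OmM [hu hap]; apply/ler_addgt0Pl => e e0.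
(* The approximation error enters once when [u] is replaced by [phi], and once more, multiplied by 2
   M, when the derivative of [phi] is replaced by that of [u]. *)
pose C : R := 1 + 2 * M.
have C0 : 0 < C by rewrite ltr_pwDl// mulr_ge0.
have [phi tphi hphi] := hap (e / C) (divr_gt0 e0 C0).
have hp := test_H1 tphi; have hup := H1B hu hp.
have lu := H1_sqint hu; have lp := H1_sqint hp.
have lDu := H1_sqintD i hu; have lDp := H1_sqintD i hp.
have lpp := test_sqint (test_partial i tphi).
have t1 : nrm u <= nrm phi + hn (u \- phi).
  apply: le_trans (lerD (lexx (nrm phi)) (l2norm_le_Hnorm1 hup)).
  have := l2normD mOm lp (sqintB mOm lu lp).
  by congr (_ <= _); congr l2norm; apply/funext => x; rewrite addrC subrK.
have t2 : nrm (partial i phi) <= nrm (D i u) + hn (u \- phi).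
  apply: le_trans (lerD (lexx (nrm (D i u))) (l2normD_le_Hnorm1 i hup)).
  have -> : nrm (partial i phi) = nrm (D i phi).
    apply: (l2norm_ae_eq mOm); [exact: lpp.1|exact: lDp.1|].
    apply: ae_eq_sym; exact: (wderiv_test).
  have -> : nrm (D i (u \- phi)) = nrm (fun x => D i u x - D i phi x).
    apply: (l2norm_ae_eq mOm); [exact: (H1_sqintD i hup).1| |exact: wderivB].
    exact: (sqintB mOm lDu lDp).1.
  have := l2normB mOm lDu (sqintB mOm lDu lDp).
  by congr (_ <= _); congr l2norm; apply/funext => x; rewrite opprB addrC subrK.
have t3 := poincare_test i M0 OmM tphi.
have {}hphi : C * hn (u \- phi) <= e by rewrite mulrC -ler_pdivlMr// ltW.
apply: le_trans t1 _.
have t4 : 2 * M * nrm (partial i phi) <= 2 * M * (nrm (D i u) + hn (u \- phi)).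
  by rewrite ler_wpM2l// mulr_ge0.
move: hphi t3 t4; rewrite /C; lra.
Qed.

(** Both sides equal minus the integral of [u] against a mixed second derivative of [psi], and those
    commute. *)
Lemma korn_test i j u psi : H1 u -> test_function Om psi ->
  ip (D i u) (partial j psi) = ip (D j u) (partial i psi).
Proof.
move=> hu tpsi.
have w k l : ip (D k u) (partial l psi) = - \int[leb]_(x in Om) (u x * partial k (partial l psi) x).
  have [_ _ /(_ _ (test_partial l tpsi))] := H1_weakD k hu.
  by rewrite dotpE mi_partial_unit mi_order_unit expr1 mulN1r => ->; rewrite opprK.
by rewrite !w partialC//; exact: test_smooth tpsi.
Qed.

Lemma korn i j u v : H1 u -> H10 Om v -> ip (D i u) (D j v) = ip (D j u) (D i v).
Proof.
move=> hu [hv hap]; apply/eqP; rewrite -subr_eq0; apply/eqP.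
apply: (@eq0_of_le_small _ _ (2 * hn u)); first by rewrite mulr_ge0// Hnorm_ge0.
move=> e /hap[psi tpsi /ltW he].
have hp := test_H1 tpsi; have hvp := H1B hv hp.
have lD k w : H1 w -> L2 (D k w) by exact: H1_sqintD.
have b k l : `|ip (D k u) (D l v) - ip (D k u) (partial l psi)| <= hn u * e.
  have lpp := test_sqint (test_partial l tpsi).
  rewrite -(dotpBr mOm (lD _ _ hv) lpp (lD _ _ hu)).
  have -> : ip (D k u) (fun x => D l v x - partial l psi x) = ip (D k u) (D l (v \- psi)).
    apply: (dotp_ae_eq mOm) => //.
    - exact: (lD k _ hu).1.
    - exact: (lD k _ hu).1.
    - exact: (sqintB mOm (lD _ _ hv) lpp).1.
    - exact: (lD _ _ hvp).1.
    - exact: ae_eq_refl.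
    - apply: ae_eq_sym.
      by apply: filterS2 (wderivB l hv hp) (wderiv_test l tpsi) => x h1 h2 Ox;
        rewrite h1// h2.
  apply: le_trans (cauchy_schwarz mOm (lD _ _ hu) (lD _ _ hvp)) _.
  apply: ler_pM; rewrite ?l2norm_ge0//; first exact: l2normD_le_Hnorm1.
  exact: le_trans (l2normD_le_Hnorm1 l hvp) he.
have -> : ip (D i u) (D j v) - ip (D j u) (D i v) =
    (ip (D i u) (D j v) - ip (D i u) (partial j psi)) -
    (ip (D j u) (D i v) - ip (D j u) (partial i psi)).
  by rewrite (korn_test i j hu tpsi); ring.
apply: le_trans (ler_normB _ _) _.
by rewrite -mulrA mulr_natl mulr2n lerD.
Qed.

Definition flin (c : R) u v : E -> R := fun x => c * u x + v x.

Definition H1_dot u v : R := ip u v + \sum_i ip (D i u) (D i v).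

Lemma flinB u v : flin (-1) v u = u \- v.
Proof. by apply/funext => x; rewrite /flin mulN1r addrC. Qed.

Lemma H1_dotC u v : H1_dot u v = H1_dot v u.
Proof.
have e : \sum_i ip (D i u) (D i v) = \sum_i ip (D i v) (D i u).
  by apply: eq_bigr => i _; rewrite dotpC.
by rewrite /H1_dot e (dotpC leb Om u v).
Qed.

(** Linearity is stated after pairing with [g], because the chosen derivative of a combination
    equals the combination of the chosen derivatives only almost everywhere. *)
Lemma dotpD_lin c u v g i : H1 u -> H1 v -> L2 g ->
  ip (D i (flin c u v)) g = c * ip (D i u) g + ip (D i v) g.
Proof.
move=> hu hv hg.
have lu := H1_sqintD i hu; have lv := H1_sqintD i hv.
have lcu : L2 (fun x => c * D i u x) by exact: sqintZ.
rewrite -dotpZl// -dotpDl//.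
apply: (dotp_ae_eq mOm).
- exact: (H1_sqintD i (H1_lin c hu hv)).1.
- exact: (sqintD mOm lcu lv).1.
- exact: hg.1.
- exact: hg.1.
- exact: wderiv_lin.
- exact: ae_eq_refl.
Qed.

Lemma H1_dot_lin c u v w : H1 u -> H1 v -> H1 w ->
  H1_dot (flin c u v) w = c * H1_dot u w + H1_dot v w.
Proof.
move=> hu hv hw; have lu := H1_sqint hu; have lv := H1_sqint hv.
have lw := H1_sqint hw.
have lcu : L2 (fun x => c * u x) by exact: sqintZ.
rewrite /H1_dot dotpDl// dotpZl// mulrDr addrACA; congr (_ + _).
rewrite mulr_sumr -big_split /=; apply: eq_bigr => i _.
by apply: dotpD_lin => //; exact: H1_sqintD.
Qed.

Lemma H1_dot_ge0 u : 0 <= H1_dot u u.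
Proof. by rewrite addr_ge0 ?dotp_ge0// sumr_ge0// => i _; exact: dotp_ge0. Qed.

Lemma Hnorm1E u : H1 u -> hn u = seminorm H1_dot u.
Proof.
move=> hu; rewrite /seminorm -[LHS]ger0_norm ?Hnorm_ge0// -sqrtr_sqr; congr Num.sqrt.
by rewrite sqr_Hnorm1// sqr_l2norm; congr (_ + _); apply: eq_bigr => i _; rewrite sqr_l2norm.
Qed.

Lemma Hnorm1_lin c u v : H1 u -> H1 v -> hn (flin c u v) <= `|c| * hn u + hn v.
Proof.
move=> hu hv; rewrite !Hnorm1E//; last exact: H1_lin.
exact: (@seminorm_lin _ _ H1 flin H1_dot (H1_lin)
  (fun f g _ _ => H1_dotC f g) H1_dot_lin (fun f _ => H1_dot_ge0 f)).
Qed.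

Lemma Hnorm1_triangle u v w : H1 u -> H1 v -> H1 w ->
  hn (u \- w) <= hn (u \- v) + hn (v \- w).
Proof.
move=> hu hv hw.
have -> : u \- w = flin 1 (u \- v) (v \- w).
  by apply/funext => x; rewrite /flin /= mul1r addrA subrK.
by have := Hnorm1_lin 1 (H1B hu hv) (H1B hv hw); rewrite normr1 mul1r.
Qed.

Lemma l2norm_wderivB u v i : H1 u -> H1 v ->
  nrm (D i (u \- v)) = nrm (fun x => D i u x - D i v x).
Proof.
move=> hu hv; have huv := H1B hu hv.
apply: (l2norm_ae_eq mOm).
- exact: (H1_sqintD i huv).1.
- exact: (sqintB mOm (H1_sqintD i hu) (H1_sqintD i hv)).1.
- exact: wderivB.
Qed.

Lemma Hnorm1BC u v : H1 u -> H1 v -> hn (u \- v) = hn (v \- u).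
Proof.
move=> hu hv; apply: (@pexpIrn R 2 isT); rewrite ?nnegrE; [exact: Hnorm_ge0..|].
apply: (etrans (sqr_Hnorm1 (H1B hu hv))).
apply: (etrans _ (esym (sqr_Hnorm1 (H1B hv hu)))).
rewrite [nrm (u \- v)](l2normBC leb Om u v); apply: (f_equal2 +%R erefl).
apply: eq_bigr => i _.
by rewrite (l2norm_wderivB i hu hv) (l2norm_wderivB i hv hu) l2normBC.
Qed.

Lemma H10_lin c u v : H10 Om u -> H10 Om v -> H10 Om (flin c u v).
Proof.
move=> [hu au] [hv av]; split; first exact: H1_lin.
move=> e e0.
have C0 : 0 < `|c| + 1 by rewrite ltr_wpDl.
have h2 : 0 < 2 :> R by [].
have [p tp hp] := au _ (divr_gt0 (divr_gt0 e0 h2) C0).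
have [r tr hr] := av _ (divr_gt0 e0 h2).
exists (flin c p r).
  apply: testD => //; exact: testZ.
have h1p := test_H1 tp; have h1r := test_H1 tr.
have := Hnorm1_lin c (H1B hu h1p) (H1B hv h1r).
have -> : flin c (u \- p) (v \- r) = flin c u v \- flin c p r.
  by apply/funext => x; rewrite /flin /=; ring.
move=> /le_lt_trans; apply; rewrite [ltRHS]splitr; apply: ler_ltD => //.
move: hp; rewrite ltr_pdivlMr// mulrDr mulr1 mulrC => h.
have := Hnorm_ge0 1 (u \- p); move: h; move: (hn _) => x; lra.
Qed.

(** The functions and each of their first derivatives converge in L^2 separately. The identity
    defining a weak derivative survives the limit because it pairs them with a fixed test function,
    and a diagonal choice keeps the limit approximable by test functions. *)
Lemma H10_complete (v_ : nat -> E -> R) : (forall k, H10 Om (v_ k)) ->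
  (forall e, 0 < e -> exists N, forall m k, (N <= m)%N -> (N <= k)%N ->
     hn (v_ m \- v_ k) < e) ->
  exists2 w, H10 Om w & forall e, 0 < e -> exists N, forall k, (N <= k)%N ->
    hn (v_ k \- w) < e.
Proof.
move=> hv cv; have h1 k : H1 (v_ k) by have [] := hv k.
have lv k : L2 (v_ k) by exact: H1_sqint (h1 k).
have lD k i : L2 (D i (v_ k)) by exact: H1_sqintD (h1 k).
have [|w lw cw] := l2_complete mOm lv.
  move=> e /cv[N hN]; exists N => j k Nj Nk; apply: le_lt_trans (hN _ _ Nj Nk).
  exact: l2norm_le_Hnorm1 (H1B (h1 j) (h1 k)).
have /choice[g hg] : forall i, exists g, L2 g /\ forall e, 0 < e ->
    exists N, forall k, (N <= k)%N -> nrm (fun x => D i (v_ k) x - g x) < e.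
  move=> i; have [|g lg cg] := l2_complete mOm (fun k => lD k i).
    move=> e /cv[N hN]; exists N => j k Nj Nk; apply: le_lt_trans (hN _ _ Nj Nk).
    by rewrite -l2norm_wderivB//; exact: l2normD_le_Hnorm1 (H1B (h1 j) (h1 k)).
  by exists g.
have lg i : L2 (g i) by have [] := hg i.
have wg i : weak_derivative Om (mi_unit i) w (g i).
  split; [exact: sqint_loc_integrable|exact: sqint_loc_integrable|].
  move=> phi tphi; rewrite mi_order_unit expr1 mulN1r mi_partial_unit.
  have lp := test_sqint tphi; have lpp := test_sqint (test_partial i tphi).
  apply/eqP; rewrite -addr_eq0; apply/eqP.
  apply: (@eq0_of_le_small _ _ (nrm phi + nrm (partial i phi))).
    by rewrite addr_ge0 ?l2norm_ge0.
  move=> e e0; have [N1 h1N] := cw _ e0; have [N2 h2N] := (hg i).2 _ e0.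
  set k := maxn N1 N2.
  have {}h1N := h1N k (leq_maxl _ _); have {}h2N := h2N k (leq_maxr _ _).
  have [_ _ /(_ _ tphi)] := H1_weakD i (h1 k).
  rewrite mi_order_unit expr1 mulN1r mi_partial_unit => /eqP; rewrite -addr_eq0 => /eqP z.
  rewrite -[X in `|X|]subr0 -z.
  rewrite -!dotpE.
  rewrite opprD addrACA -!dotpBl//.
  rewrite [X in X + _](_ : _ = - ip (fun x => v_ k x - w x) (partial i phi)); last first.
    by rewrite !dotpBl// opprB.
  rewrite [X in _ + X](_ : _ = - ip (fun x => D i (v_ k) x - g i x) phi); last first.
    by rewrite !dotpBl// opprB.
  rewrite -opprD normrN (le_trans (ler_normD _ _))// mulrDl addrC lerD//.
    rewrite mulrC; apply: le_trans (cauchy_schwarz mOm (sqintB mOm (lD _ _) (lg _)) lp) _.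
    by rewrite ler_wpM2r ?l2norm_ge0// ltW.
  rewrite mulrC; apply: le_trans (cauchy_schwarz mOm (sqintB mOm (lv _) lw) lpp) _.
  by rewrite ler_wpM2r ?l2norm_ge0// ltW.
have hw : H1 w by exact: (H1_intro lw wg lg).
have cvg e : 0 < e -> exists N, forall k, (N <= k)%N -> hn (v_ k \- w) < e.
  (* There are d + 1 terms, the function and its d derivatives; dividing by d + 2 leaves their sum
     strictly below [e]. *)
  move=> e0; have e1 : 0 < e / d.+2%:R by rewrite divr_gt0.
  have [N0 hN0] := cw _ e1.
  have /choice[N hN] := fun i => (hg i).2 _ e1.
  exists (maxn N0 (\max_i N i)) => k; rewrite geq_max => /andP[k0 kN].
  have hkw := H1B (h1 k) hw.
  apply: (@le_lt_trans _ _ (nrm (v_ k \- w) + \sum_i nrm (D i (v_ k \- w)))).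
    rewrite -ler_sqr ?nnegrE ?Hnorm_ge0//; last first.
      by rewrite addr_ge0 ?l2norm_ge0// sumr_ge0// => i _; exact: l2norm_ge0.
    rewrite sqr_Hnorm1// sqrrD -addrA lerD2l.
    apply: (@le_trans _ _ ((\sum_i nrm (D i (v_ k \- w))) ^+ 2)).
      have := sqrt_sum_sqr_le (fun i => l2norm_ge0 leb Om (D i (v_ k \- w))).
      rewrite -ler_sqr ?nnegrE ?sqrtr_ge0//; last first.
        by apply: sumr_ge0 => i _; exact: l2norm_ge0.
      by rewrite sqr_sqrtr// sumr_ge0// => i _; exact: sqr_ge0.
    rewrite lerDr mulrn_wge0// mulr_ge0 ?l2norm_ge0//.
    by rewrite sumr_ge0// => i _; exact: l2norm_ge0.
  apply: (@le_lt_trans _ _ (e / d.+2%:R + \sum_(i < d) e / d.+2%:R)).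
    apply: lerD; first exact/ltW/hN0.
    apply: ler_sum => i _; apply/ltW.
    have -> : nrm (D i (v_ k \- w)) = nrm (fun x => D i (v_ k) x - g i x).
      apply: (l2norm_ae_eq mOm).
      - exact: (H1_sqintD i hkw).1.
      - exact: (sqintB mOm (lD k i) (lg i)).1.
      - by apply: filterS2 (wderivB i (h1 k) hw) (wderiv_ae_eq (wg i)) =>
          x p q Ox; rewrite p// (wDE i w) q.
    by apply: hN; apply: leq_trans kN; exact: leq_bigmax.
  rewrite sumr_const card_ord -mulrS -mulrnAr -[ltRHS]mulr1 ltr_pM2l//.
  by rewrite -[_ *+ _]mulr_natl ltr_pdivrMr// mul1r ltr_nat.
exists w => //; split=> // e e0; have h2 : 0 < 2 :> R by [].
have [N hN] := cvg _ (divr_gt0 e0 h2).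
have [phi tphi hphi] := (hv N).2 _ (divr_gt0 e0 h2).
exists phi => //.
apply: le_lt_trans (Hnorm1_triangle hw (h1 N) (test_H1 tphi)) _.
rewrite (Hnorm1BC hw (h1 N)) (splitr e); apply: ltrD; last exact: hphi.
exact: hN (leqnn N).
Qed.

Definition vlin (c : R) F G : E -> E := fun x => c *: F x + G x.

Lemma comp_vlin c F G i : comp (vlin c F G) i = flin c (comp F i) (comp G i).
Proof. by apply/funext => x; rewrite /comp /vlin /flin !mxE. Qed.

Lemma vlinB F G : vlin (-1) G F = F \- G.
Proof. by apply/funext => x; rewrite /vlin scaleN1r addrC. Qed.

Lemma compB F G i : comp (F \- G) i = comp F i \- comp G i.
Proof. by apply/funext => x; rewrite /comp !mxE. Qed.

Lemma vH1_lin c F G : vH 1 Om F -> vH 1 Om G -> vH 1 Om (vlin c F G).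
Proof. by move=> hF hG i; rewrite comp_vlin; exact: (H1_lin c (hF i) (hG i)). Qed.

Lemma vH10_vH1 F : vH10 Om F -> vH 1 Om F.
Proof. by move=> hF i; have [] := hF i. Qed.

Lemma vH10_lin c F G : vH10 Om F -> vH10 Om G -> vH10 Om (vlin c F G).
Proof. by move=> hF hG i; rewrite comp_vlin; exact: (H10_lin c (hF i) (hG i)). Qed.

Lemma vH10B F G : vH10 Om F -> vH10 Om G -> vH10 Om (F \- G).
Proof. by move=> hF hG; rewrite -vlinB; exact: vH10_lin. Qed.

Lemma H10_0 : H10 Om (fun=> 0).
Proof.
have h0 : H1 (fun=> 0) by exact/(test_H1)/test0.
have e0 : flin (-1) (fun=> 0) (fun=> 0) = (fun=> 0) :> (E -> R).
  by apply/funext => x; rewrite /flin mulr0 addr0.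
split=> // e e_gt0; exists (fun=> 0); first exact: test0.
have -> : (fun _ : E => 0 : R) \- (fun=> 0) = (fun=> 0).
  by apply/funext => x; rewrite /= subrr.
rewrite Hnorm1E// /seminorm; have := H1_dot_lin (-1) h0 h0 h0.
by rewrite e0 mulN1r addNr => ->; rewrite sqrtr0.
Qed.

Lemma vH_norm_ge0 k F : 0 <= vH_norm k Om F. Proof. exact: sqrtr_ge0. Qed.

Lemma Hnorm_le_vH_norm k F i : Hnorm k Om (comp F i) <= vH_norm k Om F.
Proof. exact: (@le_sqrt_sum_sqr _ _ (fun i => Hnorm k Om (comp F i)) i (Hnorm_ge0 _ _)). Qed.

Lemma vH_norm_le k F : vH_norm k Om F <= \sum_i Hnorm k Om (comp F i).
Proof. by apply: sqrt_sum_sqr_le => i; exact: Hnorm_ge0. Qed.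

Lemma sqr_vH1_norm F : vN F ^+ 2 = \sum_i hn (comp F i) ^+ 2.
Proof. by rewrite sqr_sqrtr// sumr_ge0// => i _; exact: sqr_ge0. Qed.

Lemma vH10_complete (F_ : nat -> E -> E) : (forall k, vH10 Om (F_ k)) ->
  (forall e, 0 < e -> exists N, forall m k, (N <= m)%N -> (N <= k)%N ->
     vN (F_ m \- F_ k) < e) ->
  exists2 G, vH10 Om G & forall e, 0 < e -> exists N, forall k, (N <= k)%N ->
    vN (F_ k \- G) < e.
Proof.
move=> hF cF.
have /choice[g hg] : forall i, exists g, H10 Om g /\ forall e, 0 < e ->
    exists N, forall k, (N <= k)%N -> hn (comp (F_ k) i \- g) < e.
  move=> i; have [|g hg cg] := H10_complete (fun k => hF k i).
    move=> e /cF[N hN]; exists N => m k Nm Nk; rewrite -compB.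
    by apply: le_lt_trans (hN _ _ Nm Nk); exact: Hnorm_le_vH_norm.
  by exists g.
pose G : E -> E := fun x => \row_i g i x.
have Gi i : comp G i = g i by apply/funext => x; rewrite /comp mxE.
exists G; first by move=> i; rewrite Gi; case: (hg i).
move=> e e0; have e1 : 0 < e / d.+1%:R by rewrite divr_gt0.
have /choice[N hN] := fun i => (hg i).2 _ e1.
exists (\max_i N i)%N => k kN; apply: le_lt_trans (vH_norm_le _ _) _.
apply: (@le_lt_trans _ _ (\sum_(i < d) e / d.+1%:R)).
  apply: ler_sum => i _; apply/ltW.
  by rewrite compB Gi; apply: hN; apply: leq_trans kN; exact: leq_bigmax.
rewrite sumr_const card_ord -mulrnAr -[ltRHS]mulr1 ltr_pM2l//.
by rewrite -[_ *+ _]mulr_natl ltr_pdivrMr// mul1r ltr_nat.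
Qed.

Lemma vL2P F : vL2 Om F <-> forall i, L2 (comp F i).
Proof. by split=> h i; apply/(Lp_space2P). Qed.

Lemma vH1_vL2 F : vH 1 Om F -> vL2 Om F.
Proof. by move=> hF; apply/vL2P => i; exact: H1_sqint (hF i). Qed.

Definition vL2_dot F G : R := \sum_i ip (comp F i) (comp G i).

Lemma vL2_dotC F G : vL2_dot F G = vL2_dot G F.
Proof. by apply: eq_bigr => i _; rewrite dotpC. Qed.

Lemma vL2_dot_lin c F G H : vL2 Om F -> vL2 Om G -> vL2 Om H ->
  vL2_dot (vlin c F G) H = c * vL2_dot F H + vL2_dot G H.
Proof.
move=> /vL2P hF /vL2P hG /vL2P hH; rewrite /vL2_dot mulr_sumr -big_split /=.
apply: eq_bigr => i _; rewrite comp_vlin dotpDl//; last exact: sqintZ.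
by rewrite dotpZl.
Qed.

Lemma vL2_dot_ge0 F : 0 <= vL2_dot F F.
Proof. by apply: sumr_ge0 => i _; exact: dotp_ge0. Qed.

Lemma vL2_lin c F G : vL2 Om F -> vL2 Om G -> vL2 Om (vlin c F G).
Proof.
move=> /vL2P hF /vL2P hG; apply/vL2P => i; rewrite comp_vlin.
by apply: (sqintD mOm) => //; exact: sqintZ.
Qed.

Lemma vL2_normE F : vL2 Om F -> vn F = seminorm vL2_dot F.
Proof.
move=> /vL2P hF; rewrite /seminorm /vL2_dot /vL2_norm.
have -> // : \sum_i Lp_norm 2%:E Om (comp F i) ^+ 2 = \sum_i ip (comp F i) (comp F i).
by apply: eq_bigr => i _; rewrite (Lp_norm2E (hF i)) sqr_l2norm.
Qed.

Lemma vL2_norm_ge0 F : 0 <= vn F. Proof. exact: sqrtr_ge0. Qed.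

Lemma sqr_vL2_norm F : vL2 Om F -> vn F ^+ 2 = vL2_dot F F.
Proof. by move=> hF; rewrite (vL2_normE hF) sqr_sqrtr// vL2_dot_ge0. Qed.

Lemma vL2_cauchy_schwarz F G : vL2 Om F -> vL2 Om G -> `|vL2_dot F G| <= vn F * vn G.
Proof.
move=> hF hG; rewrite (vL2_normE hF) (vL2_normE hG).
exact: (@semi_cauchy_schwarz _ _ (vL2 Om) vlin vL2_dot vL2_lin
  (fun F G _ _ => vL2_dotC F G) vL2_dot_lin (fun F _ => vL2_dot_ge0 F)).
Qed.

Lemma vL2_norm_lin c F G : vL2 Om F -> vL2 Om G -> vn (vlin c F G) <= `|c| * vn F + vn G.
Proof.
move=> hF hG; rewrite (vL2_normE hF) (vL2_normE hG) (vL2_normE (vL2_lin c hF hG)).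
exact: (@seminorm_lin _ _ (vL2 Om) vlin vL2_dot vL2_lin
  (fun F G _ _ => vL2_dotC F G) vL2_dot_lin (fun F _ => vL2_dot_ge0 F)).
Qed.

Lemma vL2_norm_le_vH1 F : vH 1 Om F -> vn F <= vN F.
Proof.
move=> hF; rewrite /vL2_norm /vH_norm ler_sqrt; last first.
  by apply: sumr_ge0 => i _; exact: sqr_ge0.
apply: ler_sum => i _; have li := H1_sqint (hF i).
rewrite (Lp_norm2E li); apply: lerXn2r; rewrite ?nnegrE.
- exact: l2norm_ge0.
- exact: Hnorm_ge0.
- exact: (l2norm_le_Hnorm1 (hF i)).
Qed.

Lemma loadE F G : vL2 Om F -> vL2 Om G -> load Om F G = vL2_dot F G.
Proof.
move=> /vL2P hF /vL2P hG; rewrite /load /vL2_dot.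
rewrite (Rintegral_sum mOm) => [|i]; last exact: (sqintM mOm (hF i) (hG i)).
by apply: eq_bigr => i _; rewrite dotpE.
Qed.

Definition strainc i j F : E -> R :=
  fun x => 2^-1 * (D j (comp F i) x + D i (comp F j) x).

Definition dive F : E -> R := fun x => \sum_i D i (comp F i) x.

Lemma vH1_sqintD F i j : vH 1 Om F -> L2 (D j (comp F i)).
Proof. by move=> hF; exact: (H1_sqintD j (hF i)). Qed.

Lemma sqint_strainc F i j : vH 1 Om F -> L2 (strainc i j F).
Proof. by move=> hF; apply: sqintZ => //; apply: sqintD => //; exact: vH1_sqintD. Qed.

Lemma sqint_dive F : vH 1 Om F -> L2 (dive F).
Proof. by move=> hF; apply: sqint_sum => // i; exact: vH1_sqintD. Qed.

Lemma dotp_strainc F g i j : vH 1 Om F -> L2 g ->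
  ip (strainc i j F) g = 2^-1 * (ip (D j (comp F i)) g + ip (D i (comp F j)) g).
Proof.
move=> hF hg; have h1 := vH1_sqintD i j hF; have h2 := vH1_sqintD j i hF.
by rewrite dotpZl ?dotpDl//; exact: sqintD.
Qed.

Lemma strainc_lin c F G g i j : vH 1 Om F -> vH 1 Om G -> L2 g ->
  ip (strainc i j (vlin c F G)) g = c * ip (strainc i j F) g + ip (strainc i j G) g.
Proof.
move=> hF hG hg; rewrite !dotp_strainc//; last exact: vH1_lin.
rewrite !comp_vlin (dotpD_lin c j (hF i) (hG i) hg).
by rewrite (dotpD_lin c i (hF j) (hG j) hg); ring.
Qed.

Lemma dive_lin c F G g : vH 1 Om F -> vH 1 Om G -> L2 g ->
  ip (dive (vlin c F G)) g = c * ip (dive F) g + ip (dive G) g.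
Proof.
move=> hF hG hg.
rewrite !dotp_suml//; try (by move=> i; apply: vH1_sqintD => //; exact: vH1_lin).
rewrite mulr_sumr -big_split /=; apply: eq_bigr => i _.
by rewrite comp_vlin (dotpD_lin c i (hF i) (hG i) hg).
Qed.

Lemma l2norm_vH1D F i j : vH 1 Om F -> nrm (D j (comp F i)) <= vN F.
Proof.
move=> hF; apply: le_trans (Hnorm_le_vH_norm _ _ i).
exact: (l2normD_le_Hnorm1 j (hF i)).
Qed.

Lemma l2norm_strainc F i j : vH 1 Om F -> nrm (strainc i j F) <= vN F.
Proof.
move=> hF; have h1 := vH1_sqintD i j hF; have h2 := vH1_sqintD j i hF.
rewrite (l2normZ mOm); last exact: (sqintD mOm).
rewrite (ger0_norm (_ : 0 <= 2^-1)) ?invr_ge0//.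
have := l2normD mOm h1 h2; have := l2norm_vH1D i j hF; have := l2norm_vH1D j i hF.
move: (nrm _) (nrm _) (nrm _) (vN F) => a b c e; lra.
Qed.

Lemma l2norm_dive F : vH 1 Om F -> nrm (dive F) <= d%:R * vN F.
Proof.
move=> hF; apply: le_trans (l2norm_sum mOm _ (fun i => vH1_sqintD i i hF)) _.
apply: le_trans (ler_sum _ (fun i _ => l2norm_vH1D i i hF)) _.
by rewrite sumr_const card_ord mulr_natl.
Qed.

(* On [vH10] the mixed products add up to [int (div F)^2], by [korn]. *)
Lemma korn_first F : vH10 Om F ->
  \sum_i \sum_j nrm (D j (comp F i)) ^+ 2 <= 2 * \sum_i \sum_j nrm (strainc i j F) ^+ 2.
Proof.
move=> h0; have hF := vH10_vH1 h0.
have dd : 0 <= \sum_i \sum_j ip (D j (comp F i)) (D i (comp F j)).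
  have -> : \sum_i \sum_j ip (D j (comp F i)) (D i (comp F j)) = ip (dive F) (dive F).
    rewrite dotp_suml//; [|by move=> i; exact: vH1_sqintD|exact: sqint_dive].
    apply: eq_bigr => i _; rewrite dotpC dotp_suml//; [|by move=> j; exact: vH1_sqintD|exact: vH1_sqintD].
    apply: eq_bigr => j _; rewrite (korn j i (hF i) (h0 j)) dotpC//.
  exact: dotp_ge0.
have e i j : 2 * nrm (strainc i j F) ^+ 2 = 2^-1 * nrm (D j (comp F i)) ^+ 2 +
   2^-1 * nrm (D i (comp F j)) ^+ 2 + ip (D j (comp F i)) (D i (comp F j)).
  have h1 := vH1_sqintD i j hF; have h2 := vH1_sqintD j i hF.
  have hs := sqint_strainc i j hF.
  rewrite !sqr_l2norm dotp_strainc// !(dotpC _ _ _ (strainc i j F)) !dotp_strainc//.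
  rewrite (dotpC _ _ (D i (comp F j)) (D j (comp F i))).
  move: (ip _ _) (ip _ _) (ip _ _) => a b c; lra.
pose S : R := \sum_i \sum_j nrm (D j (comp F i)) ^+ 2.
pose S' : R := \sum_i \sum_j nrm (D i (comp F j)) ^+ 2.
have SS' : S' = S by rewrite /S' exchange_big.
suff h : 2 * \sum_i \sum_j nrm (strainc i j F) ^+ 2 = 2^-1 * S + 2^-1 * S' +
    \sum_i \sum_j ip (D j (comp F i)) (D i (comp F j)).
  have h' : S <= 2^-1 * S + 2^-1 * S' +
    \sum_i \sum_j ip (D j (comp F i)) (D i (comp F j)).
    by rewrite SS'; lra.
  by rewrite -h in h'.
rewrite /S /S' !mulr_sumr -!big_split /=; apply: eq_bigr => i _.
by rewrite !mulr_sumr -!big_split /=; apply: eq_bigr => j _.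
Qed.

Variables (mu lam : E -> R) (mumin mumax lammax : R).
Hypothesis mmu : measurable_fun Om mu.
Hypothesis mlam : measurable_fun Om lam.
Hypothesis mumin_gt0 : 0 < mumin.
Hypothesis mumax_ge0 : 0 <= mumax.
Hypothesis lammax_ge0 : 0 <= lammax.
Hypothesis mu_bnd : forall x, Om x -> mumin <= mu x <= mumax.
Hypothesis lam_bnd : forall x, Om x -> 0 <= lam x <= lammax.
Variables (K : R) (i0 : 'I_d).
Hypothesis K0 : 0 <= K.
Hypothesis OmK : forall x, Om x -> `|x| <= K.

Let mu2 : E -> R := fun x => 2 * mu x.

Let mmu2 : measurable_fun Om mu2.
Proof. by apply: measurable_funM => //; exact: measurable_cst. Qed.

Let mu2_bnd x : Om x -> 2 * mumin <= mu2 x <= 2 * mumax.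
Proof. by move=> /mu_bnd; rewrite /mu2 !ler_pM2l. Qed.

Let mumin2_ge0 : 0 <= 2 * mumin. Proof. by rewrite mulr_ge0// ltW. Qed.

(** The form [elasticity_form] expanded into weighted L^2 products, so that linearity, symmetry and
    bounds can be obtained term by term. *)
Definition elform F G : R :=
  \sum_i \sum_j ip (strainc i j F) (fun x => 2 * mu x * strainc i j G x) +
  ip (dive F) (fun x => lam x * dive G x).

Let sqint_mu v : L2 v -> L2 (fun x => mu2 x * v x).
Proof. exact: (sqint_weight mOm mmu2 mumin2_ge0 mu2_bnd). Qed.

Let sqint_lam v : L2 v -> L2 (fun x => lam x * v x).
Proof. exact: (sqint_weight mOm mlam (lexx 0) lam_bnd). Qed.

Lemma elasticity_formE F G : vH 1 Om F -> vH 1 Om G ->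
  elasticity_form Om mu lam F G = elform F G.
Proof.
move=> hF hG.
have int_s i j : leb.-integrable Om
    (EFin \o (fun x => strainc i j F x * (2 * mu x * strainc i j G x))).
  exact: (sqintM mOm (sqint_strainc i j hF) (sqint_mu (sqint_strainc i j hG))).
have int_d : leb.-integrable Om (EFin \o (fun x => dive F x * (lam x * dive G x))).
  exact: (sqintM mOm (sqint_dive hF) (sqint_lam (sqint_dive hG))).
have iss i : leb.-integrable Om
    (EFin \o (fun x => \sum_j strainc i j F x * (2 * mu x * strainc i j G x))).
  by apply: (integrable_sumR mOm) => j; exact: int_s.
have isss : leb.-integrable Om (EFin \o
    (fun x => \sum_i \sum_j strainc i j F x * (2 * mu x * strainc i j G x))).
  by apply: (integrable_sumR mOm) => i; exact: iss.
transitivity (\int[leb]_(x in Om)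
   (\sum_i \sum_j strainc i j F x * (2 * mu x * strainc i j G x) +
    dive F x * (lam x * dive G x))).
  rewrite /elasticity_form; apply: eq_Rintegral => x _.
  have -> : divergence Om F x = dive F x.
    by apply: eq_bigr => i _; rewrite wDE.
  have -> : divergence Om G x = dive G x.
    by apply: eq_bigr => i _; rewrite wDE.
  apply: f_equal2; last by ring.
  rewrite mulr_sumr; apply: eq_bigr => i _; rewrite mulr_sumr; apply: eq_bigr => j _.
  by rewrite /strain !mxE /strainc !wDE; ring.
rewrite (RintegralD mOm isss int_d) /elform (dotpE _ _ (dive F)).
apply: f_equal2; last by [].
rewrite (Rintegral_sum mOm _ iss); apply: eq_bigr => i _.
rewrite (Rintegral_sum mOm _ (int_s i)); apply: eq_bigr => j _.
by rewrite dotpE.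
Qed.

Lemma elformC F G : elform F G = elform G F.
Proof.
rewrite /elform [ip (dive F) _]dotp_weightC.
by congr (_ + _); apply: eq_bigr => i _; apply: eq_bigr => j _; rewrite dotp_weightC.
Qed.

Lemma elform_lin c F G H : vH 1 Om F -> vH 1 Om G -> vH 1 Om H ->
  elform (vlin c F G) H = c * elform F H + elform G H.
Proof.
move=> hF hG hH; rewrite /elform (dive_lin c hF hG (sqint_lam (sqint_dive hH))).
rewrite mulrDr addrACA; apply: (f_equal2 +%R); last by [].
rewrite mulr_sumr -big_split /=; apply: eq_bigr => i _.
rewrite mulr_sumr -big_split /=; apply: eq_bigr => j _.
exact: (strainc_lin c i j hF hG (sqint_mu (sqint_strainc i j hH))).
Qed.

(** Each of the d^2 strain components has L^2 norm at most that of [vN] and carries the weight 2 mu;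
    the divergence is bounded by d times [vN], which is then squared. *)
Definition elcont : R := 2 * d%:R ^+ 2 * mumax + d%:R ^+ 2 * lammax.

Lemma elform_le F : vH 1 Om F -> elform F F <= elcont * vN F ^+ 2.
Proof.
move=> hF; have vN0 := vH_norm_ge0 1 F; rewrite /elform /elcont mulrDl.
apply: lerD.
  apply: (@le_trans _ _ (\sum_(i < d) \sum_(j < d) (2 * mumax * vN F ^+ 2))).
    apply: ler_sum => i _; apply: ler_sum => j _.
    have hs := sqint_strainc i j hF.
    apply: le_trans (dotp_weight_le mOm mmu2 mumin2_ge0 mu2_bnd hs) _.
    rewrite -sqr_l2norm ler_wpM2l ?mulr_ge0//.
    by apply: lerXn2r; rewrite ?nnegrE ?l2norm_ge0// l2norm_strainc.
  rewrite double_sum_const; move: (vN F ^+ 2) => x.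
  by apply: le_of_eq; ring.
apply: le_trans (dotp_weight_le mOm mlam (lexx 0) lam_bnd (sqint_dive hF)) _.
rewrite -sqr_l2norm mulrAC -exprMn mulrC; apply: ler_wpM2r => //.
by apply: lerXn2r; rewrite ?nnegrE ?l2norm_ge0 ?mulr_ge0// l2norm_dive.
Qed.

(** The factor 2 in Korn's inequality cancels the 2 in the weight 2 mu, leaving mumin times the
    squared norm of the gradient; Poincare with constant 2 K turns the gradient norm into the full
    H^1 norm, whence (2 K)^2 + 1. *)
Definition elcoer : R := mumin / (4 * K ^+ 2 + 1).

Lemma elcoer_gt0 : 0 < elcoer.
Proof. by rewrite divr_gt0// ltr_wpDl// mulr_ge0// sqr_ge0. Qed.

Lemma elform_ge F : vH10 Om F -> elcoer * vN F ^+ 2 <= elform F F.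
Proof.
move=> h0; have hF := vH10_vH1 h0.
pose Gr := \sum_i \sum_j nrm (D j (comp F i)) ^+ 2.
have hGr : vN F ^+ 2 <= (4 * K ^+ 2 + 1) * Gr.
  rewrite sqr_vH1_norm /Gr mulr_sumr; apply: ler_sum => i _.
  rewrite (sqr_Hnorm1 (hF i)) mulrDl mul1r lerD2r.
  have p := poincare i0 K0 OmK (h0 i).
  apply: (@le_trans _ _ (4 * K ^+ 2 * nrm (D i0 (comp F i)) ^+ 2)).
    rewrite (_ : 4 * K ^+ 2 * _ = (2 * K * nrm (D i0 (comp F i))) ^+ 2); last by ring.
    by apply: lerXn2r; rewrite ?nnegrE ?l2norm_ge0 ?mulr_ge0// l2norm_ge0.
  rewrite ler_wpM2l ?mulr_ge0 ?sqr_ge0// (bigD1 i0)//= lerDl.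
  by apply: sumr_ge0 => j _; exact: sqr_ge0.
have hB : mumin * Gr <= elform F F.
  have c0 : 0 <= ip (dive F) (fun x => lam x * dive F x).
    by have := le_dotp_weight mOm mlam (lexx 0) lam_bnd (sqint_dive hF); rewrite mul0r.
  apply: (@le_trans _ _ (mumin * (2 * \sum_i \sum_j nrm (strainc i j F) ^+ 2))).
    by rewrite ler_pM2l//; exact: korn_first.
  rewrite -[leLHS]addr0 /elform; apply: lerD => //.
  rewrite mulrA mulr_sumr; apply: ler_sum => i _; rewrite mulr_sumr; apply: ler_sum => j _.
  rewrite sqr_l2norm (mulrC mumin).
  exact: (le_dotp_weight mOm mmu2 mumin2_ge0 mu2_bnd (sqint_strainc i j hF)).
have k0 : 0 < 4 * K ^+ 2 + 1 by rewrite ltr_wpDl// mulr_ge0// sqr_ge0.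
apply: le_trans hB; rewrite /elcoer mulrAC ler_pdivrMr// -mulrA.
by rewrite ler_pM2l// mulrC.
Qed.

Lemma elcont_ge0 : 0 <= elcont.
Proof. by rewrite addr_ge0 ?mulr_ge0 ?sqr_ge0. Qed.

Local Notation en := (seminorm elform).

Lemma elform_ge0 F : vH10 Om F -> 0 <= elform F F.
Proof.
move=> h0; apply: le_trans (elform_ge h0).
by rewrite mulr_ge0 ?sqr_ge0// ltW// elcoer_gt0.
Qed.

Lemma vH1_norm_le_energy F : vH10 Om F -> Num.sqrt elcoer * vN F <= en F.
Proof.
move=> h0; rewrite -[leLHS]ger0_norm ?mulr_ge0 ?sqrtr_ge0// -sqrtr_sqr.
rewrite ler_sqrt ?elform_ge0// exprMn sqr_sqrtr ?elform_ge//.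
by rewrite ltW// elcoer_gt0.
Qed.

(** The added 1 makes the constant strictly positive, so that it can be divided by when completeness
    is transferred to the energy seminorm. *)
Lemma energy_le_vH1_norm F : vH10 Om F -> en F <= Num.sqrt (elcont + 1) * vN F.
Proof.
move=> h0; have c0 := elcont_ge0.
have c1 : 0 <= elcont + 1 by rewrite addr_ge0.
rewrite -[leRHS]ger0_norm ?mulr_ge0 ?sqrtr_ge0// -sqrtr_sqr.
rewrite ler_sqrt ?sqr_ge0// exprMn sqr_sqrtr//.
apply: le_trans (elform_le (vH10_vH1 h0)) _.
by rewrite ler_wpM2r ?sqr_ge0// lerDl.
Qed.

Lemma elform_cauchy_schwarz F G : vH10 Om F -> vH10 Om G ->
  `|elform F G| <= (elcont + 1) * vN F * vN G.
Proof.
move=> hF hG; have c1 : 0 <= elcont + 1 by rewrite addr_ge0// elcont_ge0.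
apply: (@le_trans _ _ (en F * en G)).
  exact: (@semi_cauchy_schwarz _ _ (vH10 Om) vlin elform (vH10_lin)
    (fun F G _ _ => elformC F G)
    (fun c F G H p1 p2 p3 => elform_lin c (vH10_vH1 p1) (vH10_vH1 p2) (vH10_vH1 p3))
    elform_ge0).
have e : (elcont + 1) * vN F * vN G =
    Num.sqrt (elcont + 1) * vN F * (Num.sqrt (elcont + 1) * vN G).
  by rewrite mulrACA -expr2 (sqr_sqrtr c1) mulrA.
by rewrite e; apply: ler_pM; rewrite ?seminorm_ge0//; exact: energy_le_vH1_norm.
Qed.

(** Riesz representation in the energy product: by coercivity and continuity the energy seminorm is
    equivalent to the H^1 norm on [vH10], which is complete. This provides the solution of the dual
    problem. *)
Lemma elasticity_solution f : vL2 Om f ->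
  exists2 w, vH10 Om w & forall G, vH10 Om G -> elform w G = vL2_dot f G.
Proof.
move=> hf.
have s0 : 0 < Num.sqrt elcoer by rewrite sqrtr_gt0 elcoer_gt0.
have s1 : 0 < Num.sqrt (elcont + 1) by rewrite sqrtr_gt0 ltr_wpDl// elcont_ge0.
apply: (@riesz_representation _ _ (vH10 Om) vlin elform (vH10_lin)
    (fun F G _ _ => elformC F G)
    (fun c F G H p1 p2 p3 => elform_lin c (vH10_vH1 p1) (vH10_vH1 p2) (vH10_vH1 p3))
    elform_ge0 _ (vL2_dot f) (vn f / Num.sqrt elcoer) (fun=> 0)).
- move=> V_ hV cV; have [|w hw cw] := vH10_complete hV.
    move=> e e0; have [N hN] := cV _ (mulr_gt0 s0 e0); exists N => m k Nm Nk.
    rewrite -(ltr_pM2l s0); apply: le_lt_trans (hN k m Nk Nm).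
    by rewrite vlinB; apply: vH1_norm_le_energy; exact: vH10B.
  exists w => // e e0; have [N hN] := cw _ (divr_gt0 e0 s1); exists N => k Nk.
  rewrite vlinB; apply: le_lt_trans (energy_le_vH1_norm (vH10B (hV k) hw)) _.
  by rewrite mulrC -ltr_pdivlMr// hN.
- move=> i; rewrite (_ : comp _ i = fun=> 0); first exact: H10_0.
  by apply/funext => x; rewrite /comp mxE.
- move=> c F G hF hG; have lF := vH1_vL2 (vH10_vH1 hF).
  have lG := vH1_vL2 (vH10_vH1 hG).
  by rewrite vL2_dotC vL2_dot_lin// (vL2_dotC f F) (vL2_dotC f G).
- move=> F hF; have lF := vH1_vL2 (vH10_vH1 hF).
  apply: le_trans (vL2_cauchy_schwarz hf lF) _.
  rewrite -mulrA ler_wpM2l ?vL2_norm_ge0// mulrC ler_pdivlMr// mulrC.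
  apply: le_trans (vH1_norm_le_energy hF); rewrite ler_pM2l//.
  exact: (vL2_norm_le_vH1 (vH10_vH1 hF)).
Qed.

End elasticity.

(** * Mollification *)

Section fubini_product.
Context dX dZ (X : measurableType dX) (Z : measurableType dZ) (R : realType).
Variables (mu : {sigma_finite_measure set X -> \bar R}).
Variables (nu : {sigma_finite_measure set Z -> \bar R}).
Variables (k : Z -> R) (Phi : X * Z -> R) (B : R).
Hypothesis ik : nu.-integrable setT (EFin \o k).
Hypothesis mPhi : measurable_fun setT Phi.
Hypothesis B_ge0 : 0 <= B.
Hypothesis bPhi : forall p, `|Phi p| <= B.

Let mk : measurable_fun setT k.
Proof. by apply/measurable_EFinP; exact: (measurable_int _ ik). Qed.

(** One notion for several averages: mollification, its transpose, the mollification error, and,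
    with the indicator of an interval as kernel, the fundamental theorem of calculus along a
    segment. *)
Definition kernel_avg x : R := \int[nu]_z (k z * Phi (x, z)).

Let L1k : R := \int[nu]_z `|k z|.

Let L1k_ge0 : 0 <= L1k. Proof. exact: Rintegral_ge0. Qed.

Let L1kE : (\int[nu]_z `|(k z)%:E| = L1k%:E)%E.
Proof.
rewrite /L1k /Rintegral fineK// integrable_fin_num//.
by have := integrable_abse ik.
Qed.

Lemma integrable_kernel x : nu.-integrable setT (EFin \o (fun z => k z * Phi (x, z))).
Proof.
apply: (@le_integrable _ _ _ nu _ measurableT _ (fun z => B%:E * (k z)%:E)%E).
- apply/measurable_EFinP; apply: measurable_funM => //.
  by apply: measurableT_comp => //; exact: pair1_measurable.
- move=> z _ /=; rewrite lee_fin normrM normrM mulrC ler_wpM2r//.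
  by rewrite (ger0_norm B_ge0).
- exact: (integrableZl measurableT).
Qed.

Lemma kernel_avg_le x : `|kernel_avg x| <= B * L1k.
Proof.
apply: le_trans (le_normr_Rintegral measurableT (integrable_kernel x)) _.
have ia := integrable_abse ik.
rewrite -RintegralZl//; apply: le_Rintegral => //.
- exact: (integrable_abse (integrable_kernel x)).
- by have := integrableZl measurableT B ia.
- by move=> z _; rewrite normrM mulrC ler_wpM2r.
Qed.

Section weight.
Variable a : X -> R.
Hypothesis ia : mu.-integrable setT (EFin \o a).

Let ma : measurable_fun setT a.
Proof. by apply/measurable_EFinP; exact: (measurable_int _ ia). Qed.

Let f (p : X * Z) : \bar R := (a p.1 * (k p.2 * Phi p))%:E.

Lemma integrable_prod_kernel : (mu \x nu)%E.-integrable setT f.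
Proof.
have mf : measurable_fun setT f.
  apply/measurable_EFinP; apply: measurable_funM.
    by apply: measurableT_comp => //; exact: measurable_fst.
  apply: measurable_funM => //.
  by apply: measurableT_comp => //; exact: measurable_snd.
apply/integrable12ltyP => //.
apply: (@le_lt_trans _ _ (\int[mu]_x ((B * L1k)%:E * `|(a x)%:E|))%E).
  apply: ge0_le_integral => //.
  - by move=> x _; apply: integral_ge0.
  - apply: (measurable_fun_fubini_tonelli_F (abse \o f)) => //=.
    exact: measurableT_comp.
  - apply: emeasurable_funM; first exact: measurable_cst.
    apply: measurableT_comp; first exact: abse_measurable.
    exact/measurable_EFinP.
  - move=> x _; apply: (@le_trans _ _ (\int[nu]_z ((B * `|a x|)%:E * `|(k z)%:E|))%E).
      apply: ge0_le_integral => //.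
      + apply: measurableT_comp; first exact: abse_measurable.
        have := measurable_int _ (integrableZl measurableT (a x) (integrable_kernel x)).
        exact.
      + apply: emeasurable_funM; first exact: measurable_cst.
        apply: measurableT_comp; first exact: abse_measurable.
        exact/measurable_EFinP.
      + move=> z _; rewrite /f /= lee_fin !normrM.
        rewrite [leRHS](_ : _ = `|a x| * (`|k z| * B)); last by ring.
        by rewrite !ler_wpM2l.
    rewrite integralZl//; last exact: integrable_abse.
    by rewrite L1kE !EFinM muleAC.
rewrite integralZl//; last exact: integrable_abse.
apply: lte_mul_pinfty; rewrite ?lee_fin ?mulr_ge0//.
by have /integrableP[_] := ia.
Qed.

Let integrable_weight z : mu.-integrable setT (EFin \o (fun x => a x * Phi (x, z))).
Proof.
apply: (@le_integrable _ _ _ mu _ measurableT _ (fun x => B%:E * (a x)%:E)%E).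
- apply/measurable_EFinP; apply: measurable_funM => //.
  by apply: measurableT_comp => //; exact: pair2_measurable.
- move=> x _ /=; rewrite lee_fin normrM normrM mulrC ler_wpM2r//.
  by rewrite (ger0_norm B_ge0).
- exact: (integrableZl measurableT).
Qed.

Lemma fubini_G_kernel z :
  (\int[mu]_x f (x, z) = (k z * \int[mu]_x (a x * Phi (x, z))%R)%:E)%E.
Proof.
have iz := integrable_weight z.
rewrite -RintegralZl// /Rintegral fineK; last first.
  rewrite integrable_fin_num//.
  by have := integrableZl measurableT (k z) iz.
by apply: eq_integral => x _; rewrite /f /= mulrCA.
Qed.

Lemma fubini_F_kernel x :
  (\int[nu]_z f (x, z) = (a x * kernel_avg x)%:E)%E.
Proof.
rewrite /kernel_avg -RintegralZl//; last exact: integrable_kernel.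
rewrite /Rintegral fineK// integrable_fin_num//.
by have := integrableZl measurableT (a x) (integrable_kernel x).
Qed.

Lemma integrable_kernel_avg :
  mu.-integrable setT (EFin \o (fun x => a x * kernel_avg x)).
Proof.
have := integrable_fubini_F integrable_prod_kernel.
by apply: eq_integrable => // x _; rewrite /fubini_F fubini_F_kernel.
Qed.

Lemma measurable_kernel_avg : measurable_fun setT (fun x => a x * kernel_avg x).
Proof. apply/measurable_EFinP; exact: (measurable_int _ integrable_kernel_avg). Qed.

Lemma integrable_swap :
  nu.-integrable setT (fun z => (k z * \int[mu]_x (a x * Phi (x, z)))%:E).
Proof.
pose La := \int[mu]_x `|a x|.
apply: (@le_integrable _ _ _ nu _ measurableT _ (fun z => (B * La)%:E * (k z)%:E)%E).
- have := measurable_fubini_G integrable_prod_kernel.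
  by apply: eq_measurable_fun => z _; rewrite /fubini_G fubini_G_kernel.
- move=> z _; rewrite /= lee_fin !normrM mulrC ler_wpM2r//.
  apply: le_trans (le_normr_Rintegral measurableT (integrable_weight z)) _.
  rewrite (ger0_norm B_ge0); apply: le_trans (ler_wpM2l B_ge0 (ler_norm _)).
  have ja := integrable_abse ia; rewrite -RintegralZl//.
  apply: le_Rintegral => //.
  + exact: (integrable_abse (integrable_weight z)).
  + by have := integrableZl measurableT B ja.
  + by move=> x _; rewrite normrM mulrC ler_wpM2r.
- exact: (integrableZl measurableT).
Qed.

Lemma Rintegral_swap :
  \int[mu]_x (a x * kernel_avg x) = \int[nu]_z (k z * \int[mu]_x (a x * Phi (x, z))).
Proof.
have h := Fubini integrable_prod_kernel; rewrite /Rintegral; congr fine.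
under eq_integral do rewrite -fubini_F_kernel.
by rewrite h; apply: eq_integral => z _; rewrite fubini_G_kernel.
Qed.

End weight.
(* By duality: Fubini and Cauchy-Schwarz for the average paired with itself. *)
Lemma minkowski_integral (D : set X) (A : R) : measurable D -> (mu D < +oo)%E ->
  0 <= A -> (forall z, k z != 0 -> l2norm mu D (fun x => Phi (x, z)) <= A) ->
  sqint mu D kernel_avg /\ l2norm mu D kernel_avg <= L1k * A.
Proof.
move=> mD Doo A0 hA.
have ic (c : R) : mu.-integrable D (EFin \o cst c).
  apply: measurable_bounded_integrable => //.
  by exists `|c|; split; [exact: num_real|move=> r cr x _ /=; exact: ltW].
have i1 : mu.-integrable setT (EFin \o (\1_D : X -> R)).
  rewrite (_ : _ \o _ = (EFin \o cst 1) \_ D).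
    exact/(integrable_mkcond _ mD).
  by apply/funext => x; rewrite patchE /= indicE; case: (x \in D).
have mk1 := measurable_kernel_avg i1.
have mkD : measurable_fun D kernel_avg.
  have := measurable_funTS (D := D) mk1.
  apply: eq_measurable_fun => x xD; by rewrite indicE xD mul1r.
have s1 : sqint mu D (fun=> 1) by split => //; rewrite /= expr1n; exact: ic.
have sK : sqint mu D kernel_avg.
  apply: (sqint_bounded mD (v := fun=> 1) (c := B * L1k)) => // x _.
  by rewrite normr1 mulr1 kernel_avg_le.
split=> //; set N := l2norm mu D kernel_avg.
have iK : mu.-integrable setT (EFin \o (kernel_avg \_ D)).
  rewrite (_ : _ \o _ = (EFin \o kernel_avg) \_ D).
    apply/(integrable_mkcond _ mD).
    have := sqintM mD sK s1; apply: eq_integrable => // x _ /=.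
    by rewrite mulr1.
  by apply/funext => x; rewrite !patchE /= patchE; case: ifP.
have KE (g : X -> R) : \int[mu]_x ((kernel_avg \_ D) x * g x) = dotp mu D kernel_avg g.
  rewrite dotpE [RHS]Rintegral_mkcond; apply: eq_Rintegral => x _.
  by rewrite !patchE; case: ifP => //; rewrite mul0r.
have N2 : N ^+ 2 <= L1k * (N * A).
  rewrite sqr_l2norm -KE (Rintegral_swap iK) /L1k -RintegralZr//; last first.
    exact: (integrable_abse ik).
  apply: le_Rintegral => //.
  - exact: integrable_swap iK.
  - by have := integrableZr measurableT (N * A) (integrable_abse ik).
  - move=> z _; rewrite KE; apply: le_trans (ler_norm _) _; rewrite normrM.
    (* The slice bound is available only where the kernel is nonzero; elsewhere the integrand
       vanishes. *)
    have [->|kz] := eqVneq (k z) 0; first by rewrite normr0 !mul0r.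
    have sz : sqint mu D (fun x => Phi (x, z)).
      apply: (sqint_bounded mD (v := fun=> 1) (c := B)) => // [|x _].
        by apply: measurable_funTS; apply: measurableT_comp => //; exact: pair2_measurable.
      by rewrite normr1 mulr1 bPhi.
    rewrite ler_wpM2l//; apply: le_trans (cauchy_schwarz mD sK sz) _.
    by rewrite ler_wpM2l ?l2norm_ge0// hA.
have [N0|N0] := eqVneq N 0; first by rewrite N0 mulr_ge0.
have Np : 0 < N by rewrite lt_def N0 l2norm_ge0.
by rewrite -(ler_pM2l Np) mulrCA -expr2.
Qed.

End fubini_product.

(** * Mollification at scale [t] *)

Section mollifier.
Context {R : realType} {d : nat}.
Local Notation E := 'rV[R]_d.
Local Notation leb := (@lebesgue_rV R d).
Implicit Types (u v phi : E -> R) (i : 'I_d) (A D : set E).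
Local Notation nT := (l2norm leb setT).
Local Notation ei i := (delta_mx ord0 i : E).

Lemma l2norm_supp A u : (forall x, ~ A x -> u x = 0) -> l2norm leb A u = nT u.
Proof.
move=> h; rewrite /l2norm !dotpE; congr Num.sqrt; apply: Rintegral_supp => x Ax.
by rewrite h// mulr0.
Qed.

Lemma sqintS D u : measurable D -> sqint leb setT u -> sqint leb D u.
Proof.
move=> mD [mu iu]; split; first exact: measurable_funTS.
exact: (integrableS measurableT mD _ iu).
Qed.

Lemma l2norm_subset D u : measurable D -> sqint leb setT u -> l2norm leb D u <= nT u.
Proof.
move=> mD hu; rewrite /l2norm ler_sqrt ?dotp_ge0// !dotpE /Rintegral.
have iu := sqintM measurableT hu hu.
apply: fine_le.
- apply: integrable_fin_num => //; exact: (integrableS measurableT mD _ iu).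
- exact: integrable_fin_num.
- apply: ge0_subset_integral => //; first exact: (measurable_int _ iu).
  by move=> x _; rewrite lee_fin -expr2 sqr_ge0.
Qed.

Lemma l2norm_translate c u : measurable_fun setT u -> nT (fun x => u (x + c)) = nT u.
Proof.
move=> mu; rewrite /l2norm !dotpE; congr Num.sqrt; rewrite /Rintegral; congr fine.
apply: (integral_rV_translate c (f := fun x => (u x * u x)%:E)).
by apply/measurable_EFinP; exact: measurable_funM.
Qed.

Lemma test_sqintT phi : test_function setT phi -> sqint leb setT phi.
Proof. exact: (test_sqint openT). Qed.

(** The segment is parametrized by [0, 1], which covers both signs of [s], and the integral has the
    shape of a [kernel_avg] so that Minkowski's inequality applies to it. *)
Lemma line_FTC phi i (s : R) x : smooth phi ->
  \int[@lebesgue_measure R]_h (\1_(`[0, 1]%classic) h *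
     (s * partial i phi (x + (s * h) *: ei i))) = phi (x + s *: ei i) - phi x.
Proof.
pose L (h : R) : E := x + (s * h) *: ei i.
have dL psi : smooth psi -> forall h : R,
    is_derive h 1 (fun h => psi (L h)) (s * partial i psi (L h)).
  move=> spsi h; pose G (h : R) := psi (x + h *: ei i).
  have dG (h' : R) : is_derive h' 1 G (partial i psi (x + h' *: ei i)).
    by apply/is_derive_line; exact: smooth_is_derive.
  have := @is_derive_affine R R^o G h 0 1 s _ (dG (0 + s *: (h : R^o))).
  by rewrite add0r; congr is_derive; apply/funext => z; rewrite /G add0r.
have cL psi : smooth psi -> continuous (fun h => psi (L h)).
  move=> spsi h; apply/differentiable_continuous/derivable1_diffP.
  by case: (dL psi spsi h).
move=> sphi; pose F (h : R) := phi (L h); pose f (h : R) := s * partial i phi (L h).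
have dF : forall h : R, is_derive h 1 F (f h) by exact: dL.
have cF : continuous F by exact: cL.
have cf : continuous f.
  by move=> h; apply: cvgM; [exact: cvg_cst|exact: (cL _ (smooth_partial i sphi))].
have -> : \int[@lebesgue_measure R]_h (\1_(`[0, 1]%classic) h * f h) =
    fine (\int[@lebesgue_measure R]_(h in `[0%R, 1%R]) (f h)%:E)%E.
  rewrite [in RHS]integral_mkcond /Rintegral; congr fine.
  apply: eq_integral => h _; rewrite patchE indicE.
  by case: (h \in _); rewrite ?mul1r ?mul0r.
rewrite (@continuous_FTC2 _ f F) //.
- by rewrite /F /L mulr1 mulr0 scale0r addr0.
- by apply: continuous_subspaceT.
- split.
  + by move=> h _; case: (dF h).
  + by apply: cvg_at_right_filter; exact: cF.
  + by apply: cvg_at_left_filter; exact: cF.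
- by move=> h _; rewrite derive1E; case: (dF h).
Qed.

Lemma sqint_translate c u : measurable_fun setT u -> sqint leb setT u ->
  sqint leb setT (fun x => u (x + c)).
Proof.
move=> mu [_ /integrableP[m2 i2]].
have mt : measurable_fun setT (fun x : E => u (x + c)).
  by apply: measurableT_comp => //; exact: measurable_rV_addr.
split=> //; apply/integrableP; split; first exact/measurable_EFinP/measurable_funX.
have := integral_rV_translate c (f := fun x => `|(u x ^+ 2)%:E|%E).
by move=> -> //; apply: measurableT_comp.
Qed.

(** The increment is an average of translates of [s] times the derivative, all of the same L^2 norm;
    Minkowski's integral inequality bounds the average by that norm. *)
Lemma l2norm_shift_coord phi i (s : R) : test_function setT phi ->
  nT (fun x => phi (x + s *: ei i) - phi x) <= `|s| * nT (partial i phi).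
Proof.
move=> tphi; have tp := test_partial i tphi; have sphi := test_smooth tphi.
have [B [M [B0 M0 hB hM]]] := test_bounds tphi.
have [B' [M' [B'0 M'0 hB' hM']]] := test_bounds tp.
(* A ball that contains the supports of [phi] and of its translate; [minkowski_integral] works on
   sets of finite measure. *)
pose D : set E := [set x | `|x| <= M + `|s| ].
rewrite -(@l2norm_supp D); last first.
  move=> x /negP; rewrite -ltNge => Dx.
  have Mx : M < `|x| by apply: le_lt_trans Dx; rewrite lerDl.
  rewrite (hM _ Mx) hM ?subrr// -(ltrD2r `|s|); apply: lt_le_trans Dx _.
  have -> : x = x + s *: ei i - s *: ei i by rewrite addrK.
  apply: le_trans (ler_normB _ _) _; rewrite addrK lerD2l normrZ.
  by rewrite ler_piMr// norm_delta_rV.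
pose Phi (p : E * measurableTypeR R) : R := s * partial i phi (p.1 + (s * p.2) *: ei i).
pose k : R -> R := \1_(`[0, 1]%classic).
have m01 : measurable (`[0, 1]%classic : set R) by exact: measurable_itv.
have ik : (@lebesgue_measure R).-integrable setT (EFin \o k).
  exact: integrable_indic_itv.
have k1 : \int[@lebesgue_measure R]_h `|k h| = 1.
  have l01 : @lebesgue_measure R `[0, 1]%classic = 1%E.
    by have := lebesgue_measure_itv (R := R) `[0, 1]; rewrite /= lte_fin ltr01 sube0.
  have -> : \int[@lebesgue_measure R]_h `|k h| = \int[@lebesgue_measure R]_h k h.
    by apply: eq_Rintegral => h _; rewrite ger0_norm// /k indicE.
  by rewrite /Rintegral /k integral_indic// setIT [X in fine X]l01.
have mPhi : measurable_fun setT Phi.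
  apply: measurable_funM; first exact: measurable_cst.
  apply: measurableT_comp; first exact: test_measurable tp.
  apply: measurable_fun_rV => j; rewrite (_ : _ \o _ = fun p : E * measurableTypeR R =>
      rV_coord j p.1 + s * p.2 * (ei i) ord0 j); last first.
    by apply/funext => p; rewrite /rV_coord /= !mxE.
  apply: measurable_funD.
    by apply: measurableT_comp => //; exact: measurable_rV_coord.
  apply: measurable_funM; last exact: measurable_cst.
  by apply: measurable_funM; [exact: measurable_cst|exact: measurable_snd].
have bPhi p : `|Phi p| <= `|s| * B' by rewrite normrM ler_wpM2l.
have Doo : (leb D < +oo)%E by exact: lebesgue_norm_ball.
have [] := minkowski_integral (mu := leb) (nu := @lebesgue_measure R) ik mPhi
  (mulr_ge0 (normr_ge0 s) B'0) bPhi (measurable_norm_ball _) Doo (A := `|s| * nT (partial i phi)).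
- by rewrite mulr_ge0// l2norm_ge0.
- move=> h _; have st := sqint_translate ((s * h) *: ei i) (test_measurable tp) (test_sqintT tp).
  rewrite (l2normZ (measurable_norm_ball _)).
    rewrite ler_wpM2l//; apply: le_trans (l2norm_subset (measurable_norm_ball _) st) _.
    by rewrite (l2norm_translate _ (test_measurable tp)).
  exact: (sqintS (measurable_norm_ball _) st).
- rewrite k1 mul1r => _ h; apply: le_trans h; apply: le_of_eq.
  by congr l2norm; apply/funext => x; rewrite -line_FTC.
Qed.

(** The shift is made one coordinate at a time, and translation invariance moves each increment back
    to its base point. *)
Lemma l2norm_shift phi (v : E) : test_function setT phi ->
  nT (fun x : E => phi (x + v) - phi x) <= \sum_i `|v ord0 i| * nT (partial i phi).
Proof.
move=> tphi; have mphi := test_measurable (D := setT) tphi.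
have lp := test_sqintT tphi.
suff h (s : seq 'I_d) : nT (fun x : E => phi (x + \sum_(i <- s) v ord0 i *: ei i) - phi x) <=
    \sum_(i <- s) `|v ord0 i| * nT (partial i phi).
  by rewrite [v in X in X <= _]row_sum_delta; exact: h.
elim: s => [|i s IH].
  rewrite !big_nil (_ : (fun x => _) = fun=> 0) ?l2norm0//.
  by apply/funext => x; rewrite addr0 subrr.
rewrite !big_cons; set c := \sum_(j <- s) _ in IH *; set w := v ord0 i.
have t1 := sqint_translate (w *: ei i + c) mphi lp.
have t2 := sqint_translate (w *: ei i) mphi lp.
apply: le_trans (l2norm_triangle measurableT t1 t2 lp) _; rewrite addrC lerD//.
  exact: l2norm_shift_coord.
apply: le_trans IH.
have mt : measurable_fun setT (fun x : E => phi (x + c) - phi x).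
  by apply: measurable_funB => //; apply: measurableT_comp => //; exact: measurable_rV_addr.
rewrite -(l2norm_translate (w *: ei i) mt); apply: le_of_eq.
by congr l2norm; apply/funext => x; rewrite addrA.
Qed.

Implicit Types (k eta : E -> R) (t : R) (x z : E).
Local Notation test := (test_function setT).

(** Convolution with the kernel t^(-d) k(x / t), after rescaling the integration variable: the
    kernel stays fixed and the scale appears only in the argument of [phi]. *)
Definition mollify t k phi : E -> R := kernel_avg leb k (fun p : E * E => phi (p.1 + (- t) *: p.2)).

(* The transpose of [mollify t k] for the duality [int u v]. *)
Definition mollify_dual t k eta : E -> R := kernel_avg leb k (fun p : E * E => eta (p.1 + t *: p.2)).

Lemma measurable_scaled_shift t phi : test phi ->
  measurable_fun setT (fun p : E * E => phi (p.1 + t *: p.2)).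
Proof.
move=> tphi; apply: measurableT_comp; first exact: test_measurable tphi.
apply: measurable_fun_rV => j; rewrite (_ : _ \o _ = fun p : E * E =>
    rV_coord j p.1 + t * rV_coord j p.2); last first.
  by apply/funext => p; rewrite /rV_coord /= !mxE.
apply: measurable_funD.
  by apply: measurableT_comp; [exact: measurable_rV_coord|exact: measurable_fst].
apply: measurable_funM; first exact: measurable_cst.
by apply: measurableT_comp; [exact: measurable_rV_coord|exact: measurable_snd].
Qed.

Lemma integrable_mollify t k eta x : test k -> test eta ->
  leb.-integrable setT (EFin \o (fun z => k z * eta (x + t *: z))).
Proof.
move=> tk te; have [B [M [B0 M0 hB hM]]] := test_bounds te.
exact: (integrable_kernel (nu := leb) (test_integrable tk) (measurable_scaled_shift t te)
  B0 (fun p => hB _) x).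
Qed.

(** Fubini makes both sides integrals over z, and for fixed z a translation by t z identifies the
    inner integrals. *)
Lemma mollify_duality t k phi eta : test k -> test phi -> test eta ->
  \int[leb]_x (eta x * mollify t k phi x) = \int[leb]_x (phi x * mollify_dual t k eta x).
Proof.
move=> tk tp te; have [B [M [B0 M0 hB hM]]] := test_bounds tp.
have [B' [M' [B'0 M'0 hB' hM']]] := test_bounds te.
have ik := test_integrable tk.
rewrite (Rintegral_swap ik (measurable_scaled_shift (- t) tp) B0 (fun p => hB _)
  (test_integrable te)).
rewrite (Rintegral_swap ik (measurable_scaled_shift t te) B'0 (fun p => hB' _)
  (test_integrable tp)).
apply: eq_Rintegral => z _; congr (_ * _).
have mf : measurable_fun setT (fun x => (eta x * phi (x + - t *: z))%:E).
  apply/measurable_EFinP; apply: measurable_funM; first exact: test_measurable te.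
  apply: test_measurable; exact: (test_translate _ tp).
rewrite /= {1}/Rintegral -(integral_rV_translate (t *: z) mf) /Rintegral; congr fine.
by apply: eq_integral => x _; rewrite scaleNr addrK mulrC.
Qed.

(** As a function of z, eta(x + t z) has derivative t times that of [eta]; integrating by parts in z
    moves it to the kernel at the price of -1/t. *)
Lemma mollify_dual_partial t k eta i x : 0 < t -> test k -> test eta ->
  mollify_dual t k (partial i eta) x = - t^-1 * mollify_dual t (partial i k) eta x.
Proof.
move=> t0 tk te; have se := test_smooth te.
have := test_ibp i tk (smooth_affine x t se); rewrite partial_affine//.
rewrite (_ : \int[leb]_z (k z * _) = t * mollify_dual t k (partial i eta) x); last first.
  rewrite /mollify_dual /kernel_avg -RintegralZl//; last first.
    exact: (integrable_mollify _ _ tk (test_partial i te)).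
  by apply: eq_Rintegral => z _; rewrite /= mulrCA.
rewrite -[X in - X]/(mollify_dual t (partial i k) eta x) => h.
by rewrite mulNr -mulrN -h mulKf// gt_eqF.
Qed.

(** A left fold, because the outermost derivative of [eta] is the first to reach the kernel. *)
Definition iter_partial k (s : seq 'I_d) : E -> R := foldl (fun u i => partial i u) k s.

Lemma test_iter_partial k s : test k -> test (iter_partial k s).
Proof. by elim: s k => //= i s IH k tk; apply: IH; exact: test_partial. Qed.

Lemma mollify_dual_iter_partial t k eta s x : 0 < t -> test k -> test eta ->
  mollify_dual t k (foldr (@partial R d) eta s) x =
  (- t^-1) ^+ size s * mollify_dual t (iter_partial k s) eta x.
Proof.
move=> t0 + te; elim: s k => [|i s IH] k tk /=; first by rewrite expr0 mul1r.
rewrite mollify_dual_partial//; last exact: test_foldr_partial.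
by rewrite IH ?exprS ?mulrA//; exact: test_partial.
Qed.

Lemma l2norm_mollify t k phi D : measurable D -> (leb D < +oo)%E -> test k -> test phi ->
  sqint leb D (mollify t k phi) /\
  l2norm leb D (mollify t k phi) <= \int[leb]_z `|k z| * nT phi.
Proof.
move=> mD Doo tk tp; have [B [M [B0 M0 hB hM]]] := test_bounds tp.
apply: (minkowski_integral (test_integrable tk) (measurable_scaled_shift (- t) tp) B0
  (fun p => hB _)) => //; first exact: l2norm_ge0.
move=> z _; have mp := test_measurable (D := setT) tp.
have st := sqint_translate (- t *: z) mp (test_sqintT tp).
apply: le_trans (l2norm_subset mD st) _.
by rewrite (l2norm_translate (- t *: z) mp).
Qed.

(** As the kernel has integral 1, the error is the average of the increments phi(x - t z) - phi(x),
    and on the support of the kernel each coordinate of the shift is at most t M. *)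
Lemma l2norm_mollifyB t k phi D (M : R) : 0 <= t -> 0 <= M -> measurable D ->
  (leb D < +oo)%E -> test k -> test phi ->
  \int[leb]_z k z = 1 -> (forall z, k z != 0 -> `|z| <= M) ->
  l2norm leb D (fun x => mollify t k phi x - phi x) <=
  \int[leb]_z `|k z| * (t * M * \sum_i nT (partial i phi)).
Proof.
move=> t0 M0 mD Doo tk tp k1 kM; have [B [M' [B0 M'0 hB hM]]] := test_bounds tp.
have mp := test_measurable (D := setT) tp; have ik := test_integrable tk.
pose Phi (p : E * E) := phi (p.1 + - t *: p.2) - phi p.1.
have mPhi : measurable_fun setT Phi.
  apply: measurable_funB; first exact: measurable_scaled_shift.
  by apply: measurableT_comp => //; exact: measurable_fst.
have bPhi p : `|Phi p| <= B + B by rewrite (le_trans (ler_normB _ _))// lerD.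
have [||_] := minkowski_integral ik mPhi (addr_ge0 B0 B0) bPhi mD Doo
    (A := t * M * \sum_i nT (partial i phi)).
- by rewrite !mulr_ge0// sumr_ge0// => i _; exact: l2norm_ge0.
- move=> z /kM zM; have st := sqint_translate (- t *: z) mp (test_sqintT tp).
  have lp := test_sqintT tp.
  apply: le_trans (l2norm_subset mD (sqintB measurableT st lp)) _.
  apply: le_trans (l2norm_shift _ tp) _; rewrite mulr_sumr; apply: ler_sum => i _.
  rewrite ler_wpM2r ?l2norm_ge0// mxE normrM normrN (ger0_norm t0) ler_wpM2l//.
  exact: le_trans (rV_coord_norm _ _) zM.
- move=> h; apply: le_trans h; apply: le_of_eq.
  congr l2norm; apply/funext => x; rewrite /mollify /kernel_avg -[phi x in LHS]mul1r -k1.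
  rewrite -RintegralZr// -RintegralB//.
  + by apply: eq_Rintegral => z _; rewrite /Phi /= mulrBr.
  + exact: (integrable_mollify (- t) x tk tp).
  + by have := integrableZr measurableT (phi x) ik.
Qed.

(** A bump on the cube of half-width 1, divided by its integral. The integral is positive because
    the bump is positive on the concentric closed cube of side 1, whose measure is 1. *)
Lemma exists_unit_bump : exists rho : E -> R,
  [/\ test rho, \int[leb]_z rho z = 1 & forall z, rho z != 0 -> `|z| <= 1].
Proof.
pose a : E := const_mx (-1); pose b : E := const_mx 1.
pose f := box_bump a b 0; have tf : test f by apply: test_bump.
have f0 z : 0 <= f z by have /andP[] := bump_itv a b 0 z.
have If : 0 < \int[leb]_z f z.
  rewrite lt_def Rintegral_ge0// andbT; apply/negP => /eqP I0.
  have mf : measurable_fun setT (EFin \o f) by apply/measurable_EFinP; exact: (test_measurable tf).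
  have fin : (\int[leb]_z (f z)%:E)%E \is a fin_num.
    by apply: integrable_fin_num => //; exact: (test_integrable tf).
  have : ae_eq leb setT (EFin \o f) (cst 0%E).
    apply/(ae_eq_integral_abs leb measurableT mf).
    have <- : (\int[leb]_z (f z)%:E = 0)%E by rewrite -(fineK fin) [X in X%:E]I0.
    by apply: eq_integral => z _; rewrite /= ger0_norm.
  move=> /= ae0; pose a' : E := const_mx (- 2^-1); pose b' : E := const_mx (2^-1).
  have box := @lebesgue_rV_box R d a' b'.
  have mB := measurable_cbox a' b'.
  have : leb (cbox a' b') = 0%E.
    apply: (measure_negligible mB); apply: negligibleS ae0 => z hz /= h.
    have : 0 < f z.
      apply: bump_gt0 => i; rewrite !mxE; have := hz i; rewrite !mxE.
      by move=> /andP[h1 h2]; apply/andP; split; lra.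
    by have [->] := h Logic.I; rewrite ltxx.
  rewrite box; last by move=> i; rewrite !mxE; lra.
  rewrite big1 => [[]/eqP|i _]; first by rewrite oner_eq0.
  by rewrite !mxE; lra.
exists (fun z => (\int[leb]_z f z)^-1 * f z); split.
- exact: testZ.
- by rewrite (RintegralZl _ measurableT (test_integrable tf)) mulVf// gt_eqF.
- move=> z; rewrite mulf_eq0 negb_or => /andP[_ fz].
  have [hz|/bump_eq0 h] := pselect (obox a b z); last by rewrite /f h eqxx in fz.
  rewrite [leLHS]/Num.norm/= mx_normrE; apply/bigmax_leP; split=> // -[k j] _ /=.
  rewrite ord1 ler_norml; have := hz j; rewrite !mxE => /andP[h1 h2].
  by rewrite !ltW.
Qed.

Variable Om : set E.
Hypothesis oOm : open Om.
Hypothesis bOm : bounded_set Om.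

Let mOm : measurable Om := open_measurable_rV oOm.
Let Omoo : (leb Om < +oo)%E := lebesgue_rV_bounded mOm bOm.

(** Obtained by duality: transposing puts the mollifier on the test function, its derivatives pass
    to the kernel, and transposing back leaves [phi] underived. The signs collected on the way are
    those in the definition of a weak derivative. *)
Lemma weak_derivative_mollify (a : 'I_d -> nat) t k phi : 0 < t -> test k -> test phi ->
  weak_derivative Om a (mollify t k phi)
    (fun x => t^-1 ^+ mi_order a * mollify t (iter_partial k (mi_seq a)) phi x).
Proof.
move=> t0 tk tp; have ta := test_iter_partial (mi_seq a) tk.
split.
- apply: (sqint_loc_integrable oOm bOm); exact: (l2norm_mollify t mOm Omoo tk tp).1.
- apply: (sqint_loc_integrable oOm bOm); apply: sqintZ => //.
  exact: (l2norm_mollify t mOm Omoo ta tp).1.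
move=> eta te; have teT := test_setT te; have tae := test_mi_partial a te.
have taT := test_setT tae.
rewrite (Rintegral_supp (Om := Om)); last first.
  by move=> x Ox; rewrite (test_not_in tae Ox) mulr0.
rewrite (Rintegral_supp (Om := Om)); last first.
  by move=> x Ox; rewrite (test_not_in te Ox) mulr0.
transitivity (\int[leb]_x (phi x * mollify_dual t k (mi_partial a eta) x)).
  by rewrite -mollify_duality//; apply: eq_Rintegral => x _; rewrite mulrC.
set n := mi_order a; set ka := iter_partial k (mi_seq a).
have [B [M [B0 M0 hB hM]]] := test_bounds teT.
have [B' [M' [B'0 M'0 hB' hM']]] := test_bounds tp.
have i1 : leb.-integrable setT (EFin \o (fun x => phi x * mollify_dual t ka eta x)).
  exact: (integrable_kernel_avg (test_integrable ta) (measurable_scaled_shift t teT) B0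
    (fun p => hB _) (test_integrable tp)).
have i2 : leb.-integrable setT (EFin \o (fun x => eta x * mollify t ka phi x)).
  exact: (integrable_kernel_avg (test_integrable ta) (measurable_scaled_shift (- t) tp) B'0
    (fun p => hB' _) (test_integrable teT)).
transitivity ((- t^-1) ^+ n * \int[leb]_x (phi x * mollify_dual t ka eta x)).
  rewrite -RintegralZl//; apply: eq_Rintegral => x _.
  by rewrite mi_partialE mollify_dual_iter_partial// size_mi_seq mulrCA.
rewrite -mollify_duality// [in LHS]exprNn -mulrA; congr (_ * _).
by rewrite -RintegralZl//; apply: eq_Rintegral => x _; rewrite mulrCA mulrC.
Qed.

Implicit Types (g : E -> R) (F : E -> E).
Local Notation L2 := (sqint leb Om).
Local Notation nrm := (l2norm leb Om).

Lemma Lp_norm_wderiv (a : 'I_d -> nat) u g : weak_derivative Om a u g -> L2 g ->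
  Lp_norm 2%:E Om (wderiv Om a u) = nrm g.
Proof.
move=> hg lg; have hw := wderivP hg; have e := weak_derivative_ae_eq oOm hw hg.
have mw : measurable_fun Om (wderiv Om a u) by case: hw => _ [].
have lw := sqint_ae_eq mOm mw (ae_eq_sym e) lg.
by rewrite (Lp_norm2E oOm lw); apply: (l2norm_ae_eq mOm mw lg.1 e).
Qed.

Lemma sobolev_sqint n u : sobolev_space n 2%:E Om u -> L2 u.
Proof.
move=> hu; have [|g wg /(Lp_space2P oOm) lg] := hu (fun=> 0%N).
  by rewrite /mi_order big1.
have lu : loc_integrable Om u by case: wg.
have := weak_derivative_ae_eq oOm (weak_derivative0 lu) wg.
by move=> /ae_eq_sym e; exact: (sqint_ae_eq mOm lu.1 e lg).
Qed.

Lemma vH_vL2 n F : vH n Om F -> vL2 Om F.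
Proof. by move=> hF i; apply/(Lp_space2P oOm); exact: sobolev_sqint (hF i). Qed.

(** The witness is [mollify t rho phi] for a fixed unit bump [rho]. One constant serves both bounds:
    the L^1 norm of [rho] for the distance to [phi], those of its derivatives for the Sobolev
    norm. *)
Lemma mollification n : exists C : R, 0 <= C /\ forall phi t,
  test_function Om phi -> 0 < t <= 1 -> exists g,
  [/\ sobolev_space n 2%:E Om g, t ^+ n * Hnorm n Om g <= C * nrm phi &
      nrm (g \- phi) <= C * t * \sum_i nrm (partial i phi)].
Proof.
have [rho [trho I1 rho1]] := exists_unit_bump.
pose c (a : 'I_d -> nat) : R := \int[leb]_z `|iter_partial rho (mi_seq a) z|.
have c0 a : 0 <= c a by exact: Rintegral_ge0.
pose C := \int[leb]_z `|rho z| + \sum_(a : {ffun 'I_d -> 'I_n.+1}) c (mi_of a).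
have rho0 : 0 <= \int[leb]_z `|rho z| by exact: Rintegral_ge0.
have S0 : 0 <= \sum_(a : {ffun 'I_d -> 'I_n.+1}) c (mi_of a) by exact: sumr_ge0.
exists C; split; first exact: addr_ge0.
move=> phi t tp /andP[t0 t1]; have tpT := test_setT tp.
have nTE psi : test_function Om psi -> nT psi = nrm psi.
  by move=> tpsi; rewrite (@l2norm_supp Om)// => x; exact: test_not_in.
have wd a := weak_derivative_mollify a t0 trho tpT.
have lk a := l2norm_mollify t mOm Omoo (test_iter_partial (mi_seq a) trho) tpT.
have lw (a : 'I_d -> nat) : L2 (fun x => t^-1 ^+ mi_order a *
    mollify t (iter_partial rho (mi_seq a)) phi x).
  by apply: sqintZ => //; exact: (lk a).1.
exists (mollify t rho phi); split.
- move=> a _; exists (fun x => t^-1 ^+ mi_order a *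
    mollify t (iter_partial rho (mi_seq a)) phi x); first exact: wd.
  exact/(Lp_space2P oOm).
(* The order restriction is moved into the summand, so that the root of the sum of squares can be
   bounded by an unrestricted sum. *)
- pose y (a : {ffun 'I_d -> 'I_n.+1}) : R := if (mi_order (mi_of a) <= n)%N
    then Lp_norm 2%:E Om (wderiv Om (mi_of a) (mollify t rho phi)) else 0.
  have y0 a : 0 <= y a.
    by rewrite /y; case: ifP => // _; rewrite (Lp_norm_wderiv (wd _) (lw _)) l2norm_ge0.
  have -> : Hnorm n Om (mollify t rho phi) = Num.sqrt (\sum_a y a ^+ 2).
    rewrite /Hnorm big_mkcond /=; congr Num.sqrt; apply: eq_bigr => a _; rewrite /y.
    by case: ifP => // _; rewrite expr0n.
  have tn0 : 0 <= t ^+ n by rewrite exprn_ge0// ltW.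
  apply: le_trans (ler_wpM2l tn0 (sqrt_sum_sqr_le y0)) _.
  rewrite mulrDl mulr_sumr mulr_suml; apply: ler_wpDl.
    by rewrite mulr_ge0// l2norm_ge0.
  apply: ler_sum => a _; rewrite /y; case: ifP => an; last first.
    by rewrite mulr0 mulr_ge0// l2norm_ge0.
  rewrite (Lp_norm_wderiv (wd _) (lw _)) (l2normZ mOm _ (lk _).1).
  rewrite ger0_norm ?exprn_ge0 ?invr_ge0 ?(ltW t0)// mulrA.
  have h := (lk (mi_of a)).2; rewrite nTE// -/(c _) in h.
  rewrite -[leRHS]mul1r; apply: ler_pM => //.
  + by rewrite mulr_ge0// exprn_ge0// invr_ge0 ltW.
  + exact: l2norm_ge0.
  (* Since t <= 1 and the order of [a] is at most [n], the factor t^n outweighs the loss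
     t^(-|a|). *)
  + rewrite exprVn ler_pdivrMr ?exprn_gt0// mul1r.
    by apply: ler_wiXn2l => //; exact: ltW.
- have h := l2norm_mollifyB (ltW t0) ler01 mOm Omoo trho tpT I1 rho1.
  rewrite mulr1 in h.
  have -> : \sum_i nrm (partial i phi) = \sum_i nT (partial i phi).
    by apply: eq_bigr => i _; rewrite nTE//; exact: test_partial.
  have D0 : 0 <= t * \sum_i nT (partial i phi).
    by rewrite mulr_ge0 ?(ltW t0)// sumr_ge0// => i _; exact: l2norm_ge0.
  apply: le_trans h _; rewrite -mulrA ler_wpM2r// lerDl//.
Qed.

End mollifier.

(** * Galerkin error estimates *)

(** Expresses convergence through functions known to be measurable, which makes the set of
    convergence measurable. *)
Lemma cvgn_limn_einf_esup (R : realType) (u : nat -> R) :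
  cvgn u <-> (limn_einf (EFin \o u) == limn_esup (EFin \o u)) &&
             (limn_esup (EFin \o u) \is a fin_num).
Proof.
split=> [cu|/andP[/eqP e fe]].
  have cE : EFin \o u @ \oo --> (limn u)%:E by apply: cvg_EFin => //; exact: nearW.
  by have [-> ->] := cvg_limn_einf_sup cE; rewrite eqxx.
have c1 : esups (EFin \o u) @ \oo --> limn_esup (EFin \o u).
  by rewrite limn_esup_lim; exact: is_cvg_esups.
have c2 : einfs (EFin \o u) @ \oo --> limn_esup (EFin \o u).
  by rewrite -e limn_einf_lim; exact: is_cvg_einfs.
have cE : EFin \o u @ \oo --> limn_esup (EFin \o u).
  apply: squeeze_cvge c2 c1; apply: nearW => n; apply/andP; split.
    by apply: ereal_inf_lbound; exists n => //=.
  by apply: ereal_sup_ubound; exists n => //=.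
move: cE; rewrite -(fineK fe) => /fine_cvgP[_ h].
by apply/cvg_ex; eexists; exact: h.
Qed.

(* Where the sequence diverges, [limn] is a fixed junk value. *)
Lemma measurable_limn d (T : measurableType d) (R : realType) (D : set T)
    (f : nat -> T -> R) : (forall n, measurable_fun D (f n)) ->
  measurable_fun D (fun x => limn (fun n => f n x)).
Proof.
move=> mf; pose s x := limn_esup (fun n => (f n x)%:E).
pose i x := limn_einf (fun n => (f n x)%:E).
have ms : measurable_fun D s.
  apply: (measurable_fun_limn_esup (f := fun n x => (f n x)%:E)) => n.
  exact/measurable_EFinP.
have mi : measurable_fun D i.
  have -> : i = fun x => (- limn_esup (fun n => - (f n x)%:E))%E.
    apply/funext => x; rewrite -limn_einfN; congr limn_einf.
    by apply/funext => n /=; rewrite opprK.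
  apply: measurableT_comp => //.
  apply: (measurable_fun_limn_esup (f := fun n x => (- (f n x)%:E)%E)) => n.
  by apply: measurableT_comp => //; exact/measurable_EFinP.
rewrite (_ : (fun x => _) = fun x => if (i x == s x) && (s x \is a fin_num)
    then fine (s x) else point); last first.
  apply/funext => x; case: ifPn => h.
    have /cvgn_limn_einf_esup cu := h; rewrite /s.
    have cE : (fun n => (f n x)%:E) @ \oo --> (limn (f^~ x))%:E.
      by apply: cvg_EFin => //; exact: nearW.
    by have [_ ->] := cvg_limn_einf_sup cE.
  by rewrite dvgP// => /cvgn_limn_einf_esup cu; move: h; rewrite cu.
move=> mD; apply: measurable_fun_if => //.
- apply: measurable_and; first exact: measurable_fun_eqe.
  apply: (measurable_fun_bool true).
  exact: emeasurable_fin_num.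
- by apply: measurable_funS (measurableT_comp (fine_measurable _) ms) => //; exact: subIsetl.
Qed.

Lemma measurable_affine_coef (R : realType) d (Om : set 'rV[R]_d) n c0 psi y :
  summable_coef n Om c0 psi -> measurable_fun Om (affine_coef c0 psi y).
Proof.
have mc c : sobolev_space n +oo%E Om c -> measurable_fun Om c.
  move=> /(_ (fun=> 0%N))[|g [[]]]//.
  by rewrite /mi_order big1.
move=> [/mc m0 hpsi _]; apply: measurable_funD => //.
apply: measurable_limn => k; rewrite /series /=.
by apply: measurable_sum => j; apply: measurable_funM => //; exact: mc (hpsi j).
Qed.

Lemma le_mul_inf (R : realType) (S : set R) (a b : R) : 0 <= b -> S !=set0 ->
  (forall s, S s -> a <= b * s) -> a <= b * inf S.
Proof.
move=> b0 S0 h; have [b00|b_neq0] := eqVneq b 0.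
  by have [s /h] := S0; rewrite b00 !mul0r.
have bp : 0 < b by rewrite lt_def b_neq0.
rewrite mulrC -ler_pdivrMr//; apply: lb_le_inf => // s /h.
by rewrite ler_pdivrMr// mulrC.
Qed.

(** Otherwise b Y <= X, so the right-hand side is at most (a + b + 1) X Y, which is less than
    X^2. *)
Lemma le_of_sqr_le (R : realFieldType) (X Y a b : R) : 0 <= X -> 0 <= Y -> 0 <= a ->
  0 <= b -> X ^+ 2 <= a * Y * X + b * (X + Y) * Y -> X <= (a + b + 1) * Y.
Proof.
move=> X0 Y0 a0 b0 h; rewrite leNgt; apply/negP => XY.
have Xp : 0 < X by apply: le_lt_trans XY; rewrite mulr_ge0// !addr_ge0.
have h1 : (a + b + 1) * Y * X < X ^+ 2 by rewrite expr2 ltr_pM2r.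
have h2 : b * Y * Y <= X * Y.
  rewrite ler_wpM2r//; apply: le_trans (ltW XY).
  by rewrite ler_wpM2r// addrAC lerDr addr_ge0.
by nra.
Qed.

(** * Galerkin orthogonality, Cea's lemma and duality *)

Section galerkin.
Context {R : realType} {d : nat}.
Local Notation E := 'rV[R]_d.
Local Notation leb := (@lebesgue_rV R d).
Variable Om : set E.
Hypothesis oOm : open Om.
Hypothesis bOm : bounded_set Om.
Implicit Types (u v : E -> E) (i j : 'I_d).
Local Notation nrm := (l2norm leb Om).
Local Notation D := (wD Om).
Local Notation hn := (Hnorm 1 Om).
Local Notation vN := (vH_norm 1 Om).
Local Notation vn := (vL2_norm Om).
Local Notation comp := Defs.comp.

Let mOm : measurable Om := open_measurable_rV oOm.

Lemma vL2_0 : vL2 Om (fun=> 0).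
Proof.
apply/(vL2P oOm) => i; rewrite (_ : comp _ i = fun=> 0); first exact: sqint0.
by apply/funext => x; rewrite /comp mxE.
Qed.

Lemma vL2_norm0 : vn (fun=> 0) = 0.
Proof.
have h0 := vL2_0; have e : vlin (-1) (fun=> 0) (fun=> 0) = (fun=> 0 : E) :> (E -> E).
  by apply/funext => x; rewrite /vlin scaler0 addr0.
rewrite (vL2_normE oOm h0) /seminorm; have := vL2_dot_lin oOm (-1) h0 h0 h0.
by rewrite e mulN1r addNr => ->; rewrite sqrtr0.
Qed.

Lemma functional_norm_ub (L : (E -> E) -> R) G : bounded_linear_functional Om L ->
  vL2 Om G -> vn G <= 1 -> `|L G| <= functional_norm Om L.
Proof.
move=> [_ [M hM]] hG nG; apply: ub_le_sup; last by exists G.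
exists `|M| => _ [H [hH nH] <-]; apply: le_trans (hM _ hH) _.
apply: le_trans (ler_wpM2r (vL2_norm_ge0 _ _) (ler_norm M)) _.
by rewrite ler_piMr.
Qed.

Lemma functional_norm_ge0 (L : (E -> E) -> R) : bounded_linear_functional Om L ->
  0 <= functional_norm Om L.
Proof.
move=> hL; apply: le_trans (functional_norm_ub hL vL2_0 _) => //.
by rewrite vL2_norm0.
Qed.

Lemma functional_norm_le (L : (E -> E) -> R) F : bounded_linear_functional Om L ->
  vL2 Om F -> `|L F| <= functional_norm Om L * vn F.
Proof.
move=> bL hF; have [linL [M hM]] := bL; have h0 := vL2_0; have v0 := vL2_norm0.
(* A field of norm zero cannot be normalized; there the a priori bound [M] already gives the value
   0. *)
have [Fn0|Fn0] := eqVneq (vn F) 0.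
  by have := hM _ hF; rewrite Fn0 !mulr0.
have Fp : 0 < vn F by rewrite lt_def Fn0 vL2_norm_ge0.
have Fi : 0 <= (vn F)^-1 by rewrite invr_ge0 ltW.
pose G := vlin (vn F)^-1 F (fun=> 0).
have hG : vL2 Om G by exact: vL2_lin.
have nG : vn G <= 1.
  apply: le_trans (vL2_norm_lin oOm _ hF h0) _.
  by rewrite v0 addr0 (ger0_norm Fi) mulVf.
have L0 : L (fun=> 0) = 0.
  by apply/eqP; rewrite -normr_eq0 eq_le normr_ge0 andbT; have := hM _ h0; rewrite v0 mulr0.
have LG : L G = (vn F)^-1 * L F by rewrite /G /vlin linL// L0 addr0.
have := functional_norm_ub bL hG nG.
by rewrite LG normrM (ger0_norm Fi) mulrC ler_pdivrMr.
Qed.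

Variables (mu lam : E -> R) (mumin mumax lammax : R).
Hypothesis mmu : measurable_fun Om mu.
Hypothesis mlam : measurable_fun Om lam.
Hypothesis mumin_gt0 : 0 < mumin.
Hypothesis mumax_ge0 : 0 <= mumax.
Hypothesis lammax_ge0 : 0 <= lammax.
Hypothesis mu_bnd : forall x, Om x -> mumin <= mu x <= mumax.
Hypothesis lam_bnd : forall x, Om x -> 0 <= lam x <= lammax.
Variables (K : R) (i0 : 'I_d).
Hypothesis K0 : 0 <= K.
Hypothesis OmK : forall x, Om x -> `|x| <= K.

Local Notation B := (elform Om mu lam).
Let c : R := elcoer mumin K.
Let M : R := elcont (d := d) mumax lammax + 1.

Let c_gt0 : 0 < c. Proof. exact: elcoer_gt0. Qed.
Let M_ge1 : 1 <= M. Proof. by rewrite lerDr; exact: elcont_ge0. Qed.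
Let M_ge0 : 0 <= M. Proof. exact: le_trans M_ge1. Qed.

Let BC F G : B F G = B G F. Proof. exact: elformC. Qed.

Let BBl F G H : vH10 Om F -> vH10 Om G -> vH10 Om H -> B (F \- G) H = B F H - B G H.
Proof.
move=> /vH10_vH1 hF /vH10_vH1 hG /vH10_vH1 hH; rewrite -vlinB.
by rewrite (elform_lin oOm bOm mmu mlam mumin_gt0 mu_bnd lam_bnd)// mulN1r addrC.
Qed.

Let B_le F G : vH10 Om F -> vH10 Om G -> `|B F G| <= M * vN F * vN G.
Proof.
exact: (elform_cauchy_schwarz oOm bOm mmu mlam mumin_gt0 mumax_ge0 lammax_ge0
  mu_bnd lam_bnd i0 K0 OmK).
Qed.

Variables (f : E -> E) (W : set (E -> E)) (u uh : E -> E).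
Hypothesis W_vH10 : W `<=` vH10 Om.
Hypothesis hu : variational_solution Om mu lam f (vH10 Om) u.
Hypothesis huh : variational_solution Om mu lam f W uh.
Local Notation e := (u \- uh).

Let u10 : vH10 Om u. Proof. by case: hu. Qed.
Let uh10 : vH10 Om uh. Proof. by case: huh => /W_vH10. Qed.
Let e10 : vH10 Om e. Proof. exact: vH10B. Qed.

Let BE F G : vH10 Om F -> vH10 Om G -> elasticity_form Om mu lam F G = B F G.
Proof.
move=> hF hG; apply: (elasticity_formE oOm bOm mmu mlam mumin_gt0 mu_bnd lam_bnd).
- exact: vH10_vH1.
- exact: vH10_vH1.
Qed.

Lemma galerkin_orthogonality v : W v -> B e v = 0.
Proof.
move=> hv; have v10 := W_vH10 hv.
rewrite BBl// -BE// -BE//; have [_ ->//] := hu; have [_ ->//] := huh.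
by rewrite subrr.
Qed.

Lemma cea v : W v -> c * vN e <= M * vN (u \- v).
Proof.
move=> hv; have v10 := W_vH10 hv; have uv10 : vH10 Om (u \- v) by exact: vH10B.
have Bee : B e e = B e (u \- v).
  rewrite (BC e (u \- v)) (BBl u10 uh10 e10) (BBl u10 v10 e10).
  rewrite (BC uh) (BC v) !galerkin_orthogonality//.
  by case: huh.
have [e0|e0] := eqVneq (vN e) 0.
  by rewrite e0 mulr0 mulr_ge0// vH_norm_ge0.
have ep : 0 < vN e by rewrite lt_def e0 vH_norm_ge0.
have h3 : B e (u \- v) <= M * vN e * vN (u \- v).
  exact: le_trans (ler_norm _) (B_le e10 uv10).
have h2 : c * vN e ^+ 2 <= M * vN e * vN (u \- v).
  apply: le_trans (elform_ge oOm bOm mmu mlam mumin_gt0 mu_bnd lam_bnd i0 K0 OmK e10) _.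
  by rewrite Bee.
move: (vN (u \- v)) (vN e) ep h2 => y x x0; rewrite expr2 mulrA (mulrAC M).
by rewrite (ler_pM2r x0).
Qed.

Variables (k : nat) (h A : R).
Hypothesis h_ge0 : 0 <= h.
Hypothesis A_ge0 : 0 <= A.
(* The combination of elliptic regularity and approximation. *)
Hypothesis dual_approx : forall g w, vH k Om g ->
  variational_solution Om mu lam g (vH10 Om) w ->
  inf [set vN (w \- v) | v in W] <= A * h ^+ k.+1 * vH_norm k Om g.

Let W_uh : W uh. Proof. by case: huh. Qed.

Lemma galerkin_H1_error : vH k Om f ->
  vN e <= M / c * A * h ^+ k.+1 * vH_norm k Om f.
Proof.
move=> fk; have h1 : c * vN e <= M * inf [set vN (u \- v) | v in W].
  apply: le_mul_inf => //; first by exists (vN (u \- uh)), uh.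
  by move=> _ [v hv <-]; exact: cea.
rewrite -(ler_pM2l c_gt0); apply: le_trans h1 _.
rewrite (_ : c * _ = M * (A * h ^+ k.+1 * vH_norm k Om f)); last first.
  by field; rewrite gt_eqF.
by rewrite ler_wpM2l//; exact: dual_approx.
Qed.

(** For the dual solution w and any discrete v, (g, e) = B(w, e) = B(w - v, e). Symmetry of the form
    makes the dual problem an instance of the original one, so [dual_approx] bounds the infimum over
    v. *)
Lemma dual_estimate g : vH k Om g ->
  `|vL2_dot Om g e| <= M * A * h ^+ k.+1 * vH_norm k Om g * vN e.
Proof.
move=> gk; have lg := vH_vL2 oOm gk.
have [w w10 hw] := elasticity_solution oOm bOm mmu mlam mumin_gt0 mumax_ge0 lammax_ge0
  mu_bnd lam_bnd i0 K0 OmK lg.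
have sw : variational_solution Om mu lam g (vH10 Om) w.
  split=> // G hG; rewrite BE// hw// loadE//.
  exact: (vH1_vL2 oOm bOm (vH10_vH1 hG)).
rewrite -hw//.
have h1 : `|B w e| <= M * vN e * inf [set vN (w \- v) | v in W].
  apply: le_mul_inf.
  - by rewrite mulr_ge0// vH_norm_ge0.
  - by exists (vN (w \- uh)), uh.
  - move=> _ [v hv <-]; have v10 := W_vH10 hv.
    have wv10 : vH10 Om (w \- v) by exact: vH10B.
    have -> : B w e = B (w \- v) e.
      by rewrite (BBl w10 v10 e10) (BC v) galerkin_orthogonality// subr0.
    by rewrite mulrAC; exact: B_le.
apply: le_trans h1 _.
rewrite (_ : M * A * _ * _ * _ = M * vN e * (A * h ^+ k.+1 * vH_norm k Om g)); last by ring.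
apply: ler_wpM2l; first by rewrite mulr_ge0// vH_norm_ge0.
exact: dual_approx gk sw.
Qed.

Variable Cm : R.
Hypothesis Cm_ge0 : 0 <= Cm.
Hypothesis mollif : forall phi t, test_function Om phi -> 0 < t <= 1 -> exists g,
  [/\ sobolev_space k 2%:E Om g, t ^+ k * Hnorm k Om g <= Cm * nrm phi &
      nrm (g \- phi) <= Cm * t * \sum_i nrm (partial i phi)].

(** The a + b + 1 of [le_of_sqr_le]: the first summand comes from the distance between the error and
    its mollification, the second from the dual estimate. *)
Definition galerkin_dual_const : R :=
  d%:R * (1 + 2 * d%:R * Cm) + M * A * (Cm * d%:R) + 1.

(* Aubin-Nitsche duality; as the error is only in H^1, the dual problem is
   solved for the error mollified at scale [h]. *)
Lemma galerkin_L2_error : (h = 0 -> vN e = 0) -> vn e <= galerkin_dual_const * (h * vN e).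
Proof.
move=> hh0; have e1 := vH10_vH1 e10; have le := vH1_vL2 oOm bOm e1.
have X0 := vL2_norm_ge0 Om e; have N0 := vH_norm_ge0 Om 1 e.
have XN := vL2_norm_le_vH1 oOm bOm e1.
have a0 : 0 <= d%:R * (1 + 2 * d%:R * Cm) by rewrite mulr_ge0// addr_ge0// !mulr_ge0.
have b0 : 0 <= M * A * (Cm * d%:R) by rewrite !mulr_ge0.
have K1 : 1 <= galerkin_dual_const by rewrite lerDr addr_ge0.
(* Mollification is available at scales up to 1; for coarser meshes the factor h costs nothing. *)
have [h1|h1] := leP 1 h.
  apply: le_trans XN _; rewrite mulrA ler_peMl//.
  by rewrite -[leLHS]mulr1 ler_pM.
have [hz|hnz] := eqVneq h 0.
  by rewrite (hh0 hz) in XN *; rewrite !mulr0.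
have hp : 0 < h by rewrite lt_def hnz.
(* The tolerance [Y] chosen next for the approximating test functions has to be positive. *)
have [Nz|Nnz] := eqVneq (vN e) 0.
  by rewrite Nz in XN *; rewrite !mulr0.
have Np : 0 < vN e by rewrite lt_def Nnz.
pose Y := h * vN e; have Yp : 0 < Y by exact: mulr_gt0.
have YN : Y <= vN e by rewrite ler_piMl// ltW.
have /choice[phi hphi] : forall i, exists phi, test_function Om phi /\
    hn (comp e i \- phi) < Y.
  by move=> i; have [_ /(_ _ Yp)[phi tphi hphi]] := e10 i; exists phi.
have h01 : 0 < h <= 1 by rewrite hp ltW.
have /choice[g hg] := fun i => mollif (hphi i).1 h01.
pose G : E -> E := fun x => \row_i g i x.
have Gi i : comp G i = g i by apply/funext => x; rewrite /comp mxE.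
have kG : vH k Om G by move=> i; rewrite Gi; case: (hg i).
have lG := vH_vL2 oOm kG.
have p1 i := test_H1 oOm bOm (hphi i).1.
have lp i := H1_sqint oOm bOm (p1 i).
have lei i : sqint leb Om (comp e i) := H1_sqint oOm bOm (e1 i).
have lgi i : sqint leb Om (g i) by have := (vL2P oOm G).1 lG i; rewrite Gi.
have B1 i : nrm (comp e i \- phi i) <= Y.
  apply: le_trans (ltW (hphi i).2).
  exact: (l2norm_le_Hnorm1 oOm bOm (H1B oOm bOm (e1 i) (p1 i))).
(* One [vN e] for the error itself and one for the tolerance, as [Y] is at most [vN e] when h <
   1. *)
have B2 i j : nrm (partial j (phi i)) <= 2 * vN e.
  have -> : nrm (partial j (phi i)) = nrm (D j (phi i)).
    apply: (l2norm_ae_eq mOm).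
    - exact: (test_sqint oOm (test_partial j (hphi i).1)).1.
    - exact: (H1_sqintD oOm bOm j (p1 i)).1.
    - apply: ae_eq_sym; exact: (wderiv_test oOm j (hphi i).1).
  apply: le_trans (l2normD_le_Hnorm1 oOm bOm j (p1 i)) _.
  have -> : phi i = comp e i \- (comp e i \- phi i).
    by apply/funext => x; rewrite /= opprB addrC subrK.
  have := Hnorm1_lin oOm bOm (-1) (H1B oOm bOm (e1 i) (p1 i)) (e1 i).
  rewrite flinB normrN1 mul1r => hB; apply: le_trans hB _.
  have := Hnorm_le_vH_norm Om 1 e i; have := (hphi i).2; move: YN.
  move: (hn _) (hn _) (vN e) => x y z; lra.
(* [Y] for the test function, and [Cm * h] times d derivatives of size at most [2 * vN e] for its
   mollification. *)
have B3 i : nrm (comp e i \- g i) <= (1 + 2 * d%:R * Cm) * Y.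
  apply: le_trans (l2norm_triangle mOm (lei i) (lp i) (lgi i)) _.
  rewrite mulrDl mul1r lerD//; first exact: B1.
  rewrite l2normBC; have [_ _ hgp] := hg i; apply: le_trans hgp _.
  have S : \sum_j nrm (partial j (phi i)) <= d%:R * (2 * vN e).
    apply: le_trans (ler_sum _ (fun j _ => B2 i j)) _.
    by rewrite sum_ord_const.
  apply: le_trans (ler_wpM2l _ S) _; first by rewrite mulr_ge0.
  by apply: le_of_eq; rewrite /Y; ring.
have B4 i : nrm (phi i) <= vn e + Y.
  have := l2normB mOm (lei i) (sqintB mOm (lei i) (lp i)).
  have -> : (fun x => comp e i x - (comp e i x - phi i x)) = phi i.
    by apply/funext => x; rewrite opprB addrC subrK.
  move=> hB; apply: le_trans hB _; rewrite lerD//; last exact: B1.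
  by rewrite -(Lp_norm2E oOm (lei i)) (@le_sqrt_sum_sqr _ _ (fun i =>
    Lp_norm 2%:E Om (comp e i)))// (Lp_norm2E oOm (lei i)) l2norm_ge0.
have B5 : vn (e \- G) <= d%:R * (1 + 2 * d%:R * Cm) * Y.
  have lpE i : Lp_norm 2%:E Om (comp (e \- G) i) = nrm (comp e i \- g i).
    rewrite compB Gi (Lp_norm2E oOm)//; exact: sqintB.
  have lp0 i : 0 <= Lp_norm 2%:E Om (comp (e \- G) i) by rewrite lpE l2norm_ge0.
  apply: le_trans (sqrt_sum_sqr_le lp0) _.
  apply: (@le_trans _ _ (\sum_(i < d) (1 + 2 * d%:R * Cm) * Y)).
    by apply: ler_sum => i _; rewrite lpE.
  by rewrite sum_ord_const mulrA.
have B6 : h ^+ k * vH_norm k Om G <= Cm * d%:R * (vn e + Y).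
  have hk : 0 <= h ^+ k by rewrite exprn_ge0.
  apply: le_trans (ler_wpM2l hk (vH_norm_le Om k G)) _; rewrite mulr_sumr.
  apply: (@le_trans _ _ (\sum_(i < d) Cm * (vn e + Y))).
    apply: ler_sum => i _; rewrite Gi; have [_ hgi _] := hg i.
    by apply: le_trans hgi _; rewrite ler_wpM2l.
  by rewrite sum_ord_const mulrA (mulrC d%:R).
rewrite -/Y; apply: le_of_sqr_le => //; first exact: ltW.
have -> : vn e ^+ 2 = vL2_dot Om (e \- G) e + vL2_dot Om G e.
  rewrite (sqr_vL2_norm oOm le) -(vlinB e G) (vL2_dot_lin oOm _ lG le le).
  by rewrite mulN1r addrAC addNr add0r.
apply: lerD.
  apply: le_trans (ler_norm _) _.
  have leG : vL2 Om (e \- G) by rewrite -(vlinB e G); exact: vL2_lin.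
  apply: le_trans (vL2_cauchy_schwarz oOm leG le) _.
  by rewrite ler_wpM2r.
apply: le_trans (ler_norm _) _; apply: le_trans (dual_estimate kG) _.
have MA : 0 <= M * A by rewrite mulr_ge0.
(* The power of h is split: h^k pays for the Sobolev norm of the mollified field, and the remaining
   h turns [vN e] into [Y]. *)
rewrite (_ : M * A * h ^+ k.+1 * _ * _ = M * A * (h ^+ k * vH_norm k Om G) * Y); last first.
  by rewrite /Y exprS; ring.
apply: ler_wpM2r; first exact: ltW.
by rewrite -(mulrA (M * A)); exact: ler_wpM2l.
Qed.

End galerkin.

Theorem theorem5p1 (R : realType) (d r theta : nat) (Om : set 'rV[R]_d)
    (mumin mumax lammax Ct Ca : R) :
  d = 2%N \/ d = 3%N ->
  (1 <= theta <= r)%N ->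
  domain Om ->
  0 < mumin -> 0 < mumax -> 0 < lammax ->
  exists C : R,
  forall (mu0 lam0 : 'rV[R]_d -> R) (psi phi : nat -> 'rV[R]_d -> R),
  orthogonal_basis Om psi -> orthogonal_basis Om phi ->
  (forall y x, param_cube y -> Om x ->
     mumin <= affine_coef mu0 psi y x <= mumax) ->
  (forall z x, param_cube z -> Om x ->
     0 <= affine_coef lam0 phi z x <= lammax) ->
  summable_coef theta Om mu0 psi -> summable_coef theta Om lam0 phi ->
  regularity_property theta Om mu0 lam0 psi phi Ct ->
  forall (H : set R) (T : R -> seq 'M[R]_(d.+1, d)),
  regular_family Om H T ->
  approximation_property r Om H T Ca ->
  forall f, vH theta.-1 Om f ->
  forall h, H h ->
  forall y z, param_cube y -> param_cube z ->
  forall u uh : 'rV[R]_d -> 'rV[R]_d,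
  variational_solution Om (affine_coef mu0 psi y) (affine_coef lam0 phi z) f
    (vH10 Om) u ->
  variational_solution Om (affine_coef mu0 psi y) (affine_coef lam0 phi z) f
    (vfe_space r Om (T h)) uh ->
  vH_norm 1 Om (u \- uh) <= C * h ^+ theta * vH_norm theta.-1 Om f /\
  forall L : ('rV[R]_d -> 'rV[R]_d) -> R, bounded_linear_functional Om L ->
    `|L u - L uh| <=
    C * h ^+ theta.+1 * vH_norm theta.-1 Om f * functional_norm Om L.
Proof.
move=> d23 /andP[theta1 theta_r] [oOm _ _ bOm] mumin0 mumax0 lammax0.
(* The data have order [k], the error rate is [k.+1] and the solution has order [k.+2]. *)
have [k theta_k] : exists k, theta = k.+1 by exists theta.-1; rewrite prednK.
have dp : (0 < d)%N by case: d23 => ->.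
(* The direction along which Poincare's inequality is applied. *)
have i0 : 'I_d := Ordinal dp.
have [K [K0 OmK]] : exists K, 0 <= K /\ forall x, Om x -> `|x| <= K.
  have [K [_ hK]] := bOm; exists (`|K| + 1); split; first by rewrite addr_ge0.
  move=> x Ox; apply: (hK (`|K| + 1)) => //.
  by rewrite (le_lt_trans (ler_norm K))// ltrDl.
have [Cm [Cm0 mollif]] := mollification oOm bOm k.
(* [Ca] and [Ct] come without a sign; their absolute values keep the estimates monotone. *)
pose A := `|Ca| * `|Ct|; have A0 : 0 <= A by rewrite mulr_ge0.
pose M : R := elcont (d := d) mumax lammax + 1.
have M0 : 0 <= M by rewrite addr_ge0// elcont_ge0// ltW.
pose C1 := M / elcoer mumin K * A.
have C10 : 0 <= C1 by rewrite mulr_ge0// divr_ge0// ltW// elcoer_gt0.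
pose C2 := galerkin_dual_const (d := d) mumax lammax A Cm.
have C21 : 1 <= C2 by rewrite lerDr addr_ge0// ?mulr_ge0// ?addr_ge0// ?mulr_ge0.
(* [C1] is the constant of the H^1 estimate, and as [C2] is at least 1 the product serves both
   claims. *)
exists (C2 * C1).
move=> mu0 lam0 psi phi _ _ mu_bnd lam_bnd smu slam reg H T [hT _] approx f hf.
move=> h Hh y z hy hz u uh su suh.
have mmu := measurable_affine_coef y smu; have mlam := measurable_affine_coef z slam.
(* [mesh_size] is a maximum that starts from 0, hence nonnegative even for an empty mesh. *)
have h0 : 0 <= h.
  have [_ <-] := hT _ Hh; rewrite /mesh_size; elim: (T h) => [|B s IH].
    by rewrite big_nil.
  by rewrite big_cons le_max IH orbT.
have WV : vfe_space r Om (T h) `<=` vH10 Om by move=> v hv i; case: (hv i).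
rewrite theta_k /= in reg theta_r hf *.
have dual g w : vH k Om g -> variational_solution Om (affine_coef mu0 psi y)
    (affine_coef lam0 phi z) g (vH10 Om) w ->
    inf [set vH_norm 1 Om (w \- v) | v in vfe_space r Om (T h)] <=
    A * h ^+ k.+1 * vH_norm k Om g.
  move=> gk sw; have [wk wn] := reg _ gk _ _ hy hz _ sw.
  have w10 : vH10 Om w by case: sw.
  apply: le_trans (approx _ Hh k.+1 theta_r _ w10 wk) _.
  have n0 := vH_norm_ge0 Om k g; have hk : 0 <= h ^+ k.+1 by rewrite exprn_ge0.
  apply: (@le_trans _ _ (`|Ca| * h ^+ k.+1 * vH_norm k.+2 Om w)).
    by rewrite ler_wpM2r ?vH_norm_ge0// ler_wpM2r// ler_norm.
  rewrite (_ : A * _ * _ = `|Ca| * h ^+ k.+1 * (`|Ct| * vH_norm k Om g)); last first.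
    by rewrite /A; ring.
  rewrite ler_wpM2l ?mulr_ge0//; apply: le_trans wn _.
  by rewrite ler_wpM2r// ler_norm.
have mub x : Om x -> mumin <= affine_coef mu0 psi y x <= mumax by exact: mu_bnd.
have lamb x : Om x -> 0 <= affine_coef lam0 phi z x <= lammax by exact: lam_bnd.
have E1 := galerkin_H1_error oOm bOm mmu mlam mumin0 (ltW mumax0) (ltW lammax0) mub lamb
  i0 K0 OmK WV su suh dual hf.
have F0 := vH_norm_ge0 Om k f.
have hk : 0 <= h ^+ k.+1 by rewrite exprn_ge0.
split.
  apply: le_trans E1 _; rewrite -/M -/C1 ler_wpM2r// ler_wpM2r//.
  by rewrite ler_peMl.
move=> L bL; have FN := functional_norm_ge0 oOm bL.
(* The rate is at least 1, so the H^1 estimate itself annihilates the error at mesh size 0, where no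
   mollification scale is available. *)
have hz0 : h = 0 -> vH_norm 1 Om (u \- uh) = 0.
  move=> hz0; apply/eqP; rewrite eq_le vH_norm_ge0 andbT; apply: le_trans E1 _.
  by rewrite hz0 expr0n mulr0 mul0r.
have E2 := galerkin_L2_error oOm bOm mmu mlam mumin0 (ltW mumax0) (ltW lammax0) mub lamb
  i0 K0 OmK WV su suh h0 A0 dual Cm0 mollif hz0.
have lu := vH1_vL2 oOm bOm (vH10_vH1 su.1).
have luh := vH1_vL2 oOm bOm (vH10_vH1 (WV _ suh.1)).
have -> : L u - L uh = L (u \- uh).
  by rewrite -vlinB /vlin bL.1// mulN1r addrC.
have le : vL2 Om (u \- uh) by rewrite -vlinB; exact: vL2_lin.
apply: le_trans (functional_norm_le oOm bL le) _.
rewrite [leRHS]mulrC ler_wpM2l//; apply: le_trans E2 _.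
rewrite -/C2 exprS (_ : C2 * C1 * _ * _ = C2 * (h * (C1 * h ^+ k.+1 * vH_norm k Om f))).
  by rewrite ler_wpM2l ?(le_trans ler01)// ler_wpM2l.
by ring.
Qed.
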